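(* In an edge-to-edge tiling of a flat torus by unit-area efficient pentagons and unit-area non-convex quadrilaterals, if the ratio of the number of efficient pentagons to the number of non-convex quadrilaterals exceeds $14$, then the tiling has at least one degree-four efficient vertex.
   Context: Edge-to-edge means adjacent tiles meet only along entire edges or at vertices. A unit-area pentagon is efficient if its perimeter is less than or equal to that of a unit-area Cairo pentagon, namely $2\sqrt{2+\sqrt3}\approx 3.86$. (A Cairo pentagon has three angles of $2\pi/3$ and two nonadjacent right angles and is circumscribed about a circle.) An efficient vertex is a vertex of the tiling which is surrounded exclusively by efficient pentagons; its degree is the number of tiles (equivalently edges) meeting there. *)

(* Defs.v *)
From HB Require Import structures.
From mathcomp Require Import all_boot all_order all_algebra.
From mathcomp Require Import all_classical all_reals all_analysis.

Set Implicit Arguments.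
Unset Strict Implicit.
Unset Printing Implicit Defensive.

Import Order.TTheory GRing.Theory Num.Theory numFieldNormedType.Exports.

Local Open Scope classical_set_scope.
Local Open Scope ring_scope.

Section polygons.
Context {R : realType}.
Local Notation plane := (R * R)%type.
Implicit Types (p q : seq plane) (u v x : plane) (i j : nat) (t : R).

(* A polygon is given by the cyclic sequence of its vertices. *)
Definition vertex p i : plane := p`_(i %% size p).

Definition side_point p i t : plane :=
  (1 - t) *: vertex p i + t *: vertex p i.+1.

Definition side p i : set plane := side_point p i @` `[0, 1].

Definition boundary p : set plane :=
  \bigcup_(i in [set i | (i < size p)%N]) side p i.

(* The closed polygonal loop through the vertices is injective. *)
Definition simple_polygon p : Prop :=
  (2 < size p)%N /\
  forall i j s t, (i < size p)%N -> (j < size p)%N ->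
    0 <= s < 1 -> 0 <= t < 1 ->
    side_point p i s = side_point p j t -> i = j /\ s = t.

(* The inside of the Jordan curve: the points lying in a bounded connected
   component of the complement of the boundary. *)
Definition inside p : set plane :=
  [set x | ~ boundary p x /\
           bounded_set (connected_component (~` boundary p) x)].

Definition region p : set plane := inside p `|` boundary p.

Definition area p : \bar R :=
  (lebesgue_measure \x lebesgue_measure)%E (region p).

(* The norm of the library on R * R is the sup norm, hence an explicit
   Euclidean distance. *)
Definition euclidean_dist u v : R :=
  Num.sqrt ((u.1 - v.1) ^+ 2 + (u.2 - v.2) ^+ 2).

Definition perimeter p : R :=
  \sum_(i < size p) euclidean_dist (vertex p i) (vertex p i.+1).

Definition efficient_pentagon p : Prop :=
  [/\ simple_polygon p, size p = 5%N, area p = 1%E &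
      perimeter p <= 2 * Num.sqrt (2 + Num.sqrt 3)].

Definition unit_nonconvex_quadrilateral p : Prop :=
  [/\ simple_polygon p, size p = 4%N, area p = 1%E &
      ~ convex_set (region p)].

Definition meet_edge_to_edge p q : Prop :=
  forall x, region p x -> region q x ->
    (x \in p /\ x \in q) \/
    exists i j, [/\ (i < size p)%N, (j < size q)%N,
                    side p i = side q j & side p i x].

End polygons.

(* A tiling of the flat torus R^2 / (Z b1 + Z b2) is described by its lift to
   the plane: [P i], for i in the finite type I, is one lift of the i-th tile of
   the torus, and the tiles of the lifted tiling, indexed by I * (Z * Z), are
   the translates of the [P i] by the vectors of the lattice. *)
Section torus_tilings.
Context {R : realType} {I : finType}.
Local Notation plane := (R * R)%type.
Variables (b1 b2 : plane) (P : I -> seq plane).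

Definition lattice_basis : Prop := b1.1 * b2.2 - b1.2 * b2.1 != 0.

Definition lattice_vector (m : int * int) : plane := b1 *~ m.1 + b2 *~ m.2.

Definition tile (k : I * (int * int)) : seq plane :=
  [seq x + lattice_vector k.2 | x <- P k.1].

Definition edge_to_edge_torus_tiling : Prop :=
  [/\ lattice_basis,
      forall i, simple_polygon (P i),
      \bigcup_k region (tile k) = setT,
      forall k l, k != l -> inside (tile k) `&` inside (tile l) = set0 &
      forall k l, k != l -> meet_edge_to_edge (tile k) (tile l)].

Definition tiling_vertex (v : plane) : Prop := exists k, v \in tile k.

Definition tiles_at (v : plane) : set (I * (int * int)) :=
  [set k | region (tile k) v].

Definition efficient_vertex (v : plane) : Prop :=
  tiling_vertex v /\ forall k, tiles_at v k -> efficient_pentagon (tile k).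

(* The degree counts tiles of the lift: a tile of the torus having several of
   its corners at v counts once for each corner. *)
Definition vertex_degree (v : plane) (d : nat) : Prop := (tiles_at v #= `I_d)%card.

End torus_tilings.

(* Main.v *)
Require Import Defs.
From mathcomp Require Import all_boot all_order all_algebra.
From mathcomp Require Import all_classical all_reals all_analysis.
From mathcomp Require Import measurable_realfun ring lra zify.

Set Implicit Arguments.
Unset Strict Implicit.
Unset Printing Implicit Defensive.

Import Order.TTheory GRing.Theory Num.Theory numFieldNormedType.Exports.

Local Open Scope classical_set_scope.
Local Open Scope ring_scope.

(* Fix a direction d parallel to no line through two vertices of a tile. The two
   opposite directions d and -d enter a triangle from exactly one of its corners,
   the middle one across d, so they enter a tile with n corners from at most n - 2
   of them (a tile is covered by n - 2 triangles on its vertices), while at every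
   vertex of the tiling each of d and -d enters some tile. This replaces the angle
   sum, or Euler's formula: with P pentagons, Q quadrilaterals and V vertices, it
   gives 2 V <= 3 P + 2 Q. An efficient pentagon is convex with all angles larger
   than 72 degrees, so at most four of them meet at a vertex. Hence, if there is no
   efficient vertex of degree four, then a vertex with p pentagonal and q
   quadrangular corners satisfies p <= 3 + q, and summing over the vertices
   5 P <= 3 V + 4 Q, whence P <= 14 Q.

   The angles: a nonconvex pentagon lies in the hull of four of its vertices, so
   its perimeter is at least 4. For a convex one, cut off the corner triangle, and
   bound the area of the rest by Bretschneider's formula. To avoid measuring angles
   at a vertex, compare the sectors with the five rotations of a vector by
   72 degrees. *)

(** * Isoperimetric estimates *)

Section Isoperimetry.
Context {R : realType}.
Local Notation plane := (R * R)%type.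
Implicit Types (a b c d e u v w x : plane).

(** The regions are known only through one-sided inclusions, in place of the Jordan curve theorem. A
    ray that misses the boundary shows that its origin is not [inside], which confines a region to a
    hull or to two triangles; a connectedness argument puts the open convex pentagon [inside]. So
    areas are only bounded from above, and the triangles need only cover a tile. The count then
    gives an inequality, which suffices because only an upper bound on the number of vertices is
    wanted. The constants are rational roundings. The squared perimeter bound is 8 + 4 sqrt 3, about
    14.93, and becomes 15; the cosine of 72 degrees, about 0.309, becomes 7/25, an angle of the
    7-24-25 triangle, whose sine is rational too. The slack between them turns the area estimate
    into polynomial inequalities. The number 4 is the perimeter of the unit square, the best among
    quadrilaterals, and 15 is less than its square. The ratio 14 arises as 10 P <= 6 V + 8 Q <= 9 P
    + 14 Q. *)

Definition orient a b c : R :=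
  (b.1 - a.1) * (c.2 - a.2) - (b.2 - a.2) * (c.1 - a.1).

Definition dot u v : R := u.1 * v.1 + u.2 * v.2.

Lemma pair_eq u v : u.1 = v.1 -> u.2 = v.2 -> u = v.
Proof. by case: u v => [? ?] [? ?] /= -> ->. Qed.

Lemma dist_ge0 u v : 0 <= euclidean_dist u v.
Proof. exact: sqrtr_ge0. Qed.

Lemma sqr_dist u v : euclidean_dist u v ^+ 2 = (u.1 - v.1) ^+ 2 + (u.2 - v.2) ^+ 2.
Proof. by rewrite sqr_sqrtr // addr_ge0 ?sqr_ge0. Qed.

Lemma distC u v : euclidean_dist u v = euclidean_dist v u.
Proof. by rewrite /euclidean_dist -sqrrN opprB -(sqrrN (u.2 - _)) opprB. Qed.

(** Stated for coordinates rather than points, since [bretschneider] applies it to vectors whose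
    entries are an orientation and a scalar product. The scalar product is bounded through
    Lagrange's identity. *)
Lemma norm2_triangle (x1 y1 x2 y2 p q : R) : 0 <= p -> 0 <= q ->
  x1 ^+ 2 + y1 ^+ 2 = p ^+ 2 -> x2 ^+ 2 + y2 ^+ 2 = q ^+ 2 ->
  (x1 + x2) ^+ 2 + (y1 + y2) ^+ 2 <= (p + q) ^+ 2.
Proof.
move=> p0 q0 hp hq.
have pq : x1 * x2 + y1 * y2 <= p * q.
  apply: le_trans (ler_norm _) _.
  rewrite -(@ler_pXn2r _ 2) ?nnegrE ?mulr_ge0 // real_normK ?num_real //.
  by have := sqr_ge0 (x1 * y2 - x2 * y1); rewrite exprMn -hp -hq; lra.
by move: pq hp hq; rewrite !expr2; lra.
Qed.

Lemma dist_triangle u v w :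
  euclidean_dist u w <= euclidean_dist u v + euclidean_dist v w.
Proof.
rewrite -(@ler_pXn2r _ 2) ?nnegrE ?addr_ge0 ?dist_ge0 //.
have := norm2_triangle (dist_ge0 u v) (dist_ge0 v w)
  (esym (sqr_dist u v)) (esym (sqr_dist v w)).
by rewrite sqr_dist [u.1 - v.1 + _]addrA [u.2 - v.2 + _]addrA !subrK.
Qed.


(** The quadratic form is [(8 * e + 3 * y) ^+ 2 - 45 * e ^+ 2]: what remains for 135 times the area
    of the quadrilateral in the worst case of a corner with m = 5e/3 and T = e^2/3, where y = s - e.
    The left side is Bretschneider's bound on that area, with 675 = 16 * 135^2 / 432. *)
Lemma quartic_estimate (e y : R) : 0 <= e -> 0 <= y ->
  675 * (y * (4 * e + y) ^+ 3) <=
  16 * (19 * e ^+ 2 + 48 * e * y + 9 * y ^+ 2) ^+ 2.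
Proof.
move=> e0 y0.
have h1 : 0 <= e * y * (2 * y - e) ^+ 2 by exact: mulr_ge0 (mulr_ge0 e0 y0) (sqr_ge0 _).
have h2 : 0 <= e ^+ 2 * (2 * e - 3 * y) ^+ 2 by exact: mulr_ge0 (sqr_ge0 _) (sqr_ge0 _).
have h3 : 0 <= y ^+ 4 by rewrite exprn_ge0.
have h4 : 0 <= e ^+ 2 * y ^+ 2 by exact: mulr_ge0 (sqr_ge0 _) (sqr_ge0 _).
have h5 : 0 <= e ^+ 4 by rewrite exprn_ge0.
nra.
Qed.

Lemma geometric_mean4 (x y : R) : 0 <= x -> 0 <= y ->
  x * y ^+ 3 * 256 <= (x + 3 * y) ^+ 4.
Proof.
move=> x0 y0.
have h1 : 0 <= (x - y) ^+ 2 * (x + 7 * y) ^+ 2 by exact: mulr_ge0 (sqr_ge0 _) (sqr_ge0 _).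
have h2 : 0 <= (x - y) ^+ 2 * y ^+ 2 by exact: mulr_ge0 (sqr_ge0 _) (sqr_ge0 _).
nra.
Qed.

(* [T] is the area of the triangle cut off at a corner of a pentagon, [m] the sum
   of its two sides at the corner and [e] its third side; [q] is the area of the
   remaining quadrilateral and [s] the sum of its sides other than [e]. For
   fixed [e] and [s] the worst case is [3 m = 5 e], the isosceles triangle with
   an angle of cosine 7/25, and the estimate then becomes [quartic_estimate]. *)
Lemma pentagon_area_bound (m e s q T : R) :
  0 <= e -> e <= m -> e <= s -> 0 <= q ->
  432 * q ^+ 2 <= (s - e) * (s + 3 * e) ^+ 3 ->
  16 * T <= 3 * (m ^+ 2 - e ^+ 2) -> 16 * T <= e * (5 * m - 3 * e) ->
  15 * (T + q) <= (m + s) ^+ 2.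
Proof.
move=> e0 em es q0 hq hT1 hT2.
have s0 : 0 <= s by lra.
have se0 : 0 <= s + e by lra.
have hk : 135 * q <= 19 * e ^+ 2 + 48 * e * (s - e) + 9 * (s - e) ^+ 2.
  have y0 : 0 <= s - e by lra.
  have E : s + 3 * e = 4 * e + (s - e) by ring.
  have K := quartic_estimate e0 y0.
  rewrite -E in K.
  have G0 : 0 <= 19 * e ^+ 2 + 48 * e * (s - e) + 9 * (s - e) ^+ 2.
    by rewrite !addr_ge0 // ?mulr_ge0 ?sqr_ge0 //.
  rewrite -(@ler_pXn2r _ 2) ?nnegrE ?mulr_ge0 //.
  move: K hq; rewrite [(135 * q) ^+ 2]exprMn.
  set A := (_ + _ + _) ^+ 2; set B := _ * _ ^+ 3; set C := q ^+ 2; lra.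
(* The isoperimetric inequality for a quadrilateral of perimeter s + e. It is wanted when m is near
   e and s is large, where [hk], adjusted to the worst case, is too weak; for s near e it is [hk2]
   that is too weak. *)
have hk2 : 16 * q <= (s + e) ^+ 2.
  have := @geometric_mean4 (s - e) ((s + 3 * e) / 3).
  rewrite subr_ge0 es divr_ge0 ?addr_ge0 ?mulr_ge0 // => /(_ isT isT).
  have -> : s - e + 3 * ((s + 3 * e) / 3) = 2 * (s + e) by field.
  rewrite !exprMn exprVn => H.
  rewrite -(@ler_pXn2r _ 2) ?nnegrE ?mulr_ge0 ?sqr_ge0 //.
  move: H hq; rewrite [(16 * q) ^+ 2]exprMn -exprM.
  set A := (s + 3 * e) ^+ 3; set B := (s + e) ^+ _; set C := q ^+ 2.
  by rewrite mulrA; set D := _ * A; lra.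
(* The two bounds on 16 T differ by m (3m - 5e), so this test decides which of them is the sharper
   one. *)
have [h|h] := leP (5 * e) (3 * m).
  have h1 : 0 <= (3 * m - 5 * e) * (m + 2 * s - 2 * e) by apply: mulr_ge0; lra.
  have h2 : 0 <= (3 * m - 5 * e) * e by apply: mulr_ge0; lra.
  nra.
have h1 : 0 <= (m - e) * (5 * e - 3 * m) by apply: mulr_ge0; lra.
nra.
Qed.

(** For each of the triangles [a b c] and [a c d], the orientation and the scalar product at [b] or
    [d] are the product of two sides times the sine and the cosine of their angle. By the law of
    cosines on the common side [a c], the difference of the scalar products depends only on the side
    lengths; the triangle inequality for the two vectors does the rest. *)
Lemma bretschneider a b c d (x := euclidean_dist a b) (y := euclidean_dist b c)
    (z := euclidean_dist c d) (w := euclidean_dist d a) :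
  4 * (orient a b c + orient a c d) ^+ 2 <=
  (x + y + z - w) * (x + y - z + w) * (x - y + z + w) * (- x + y + z + w).
Proof.
have hx := sqr_dist a b; have hy := sqr_dist b c.
have hz := sqr_dist c d; have hw := sqr_dist d a.
rewrite -/x in hx; rewrite -/y in hy; rewrite -/z in hz; rewrite -/w in hw.
pose D1 := (a.1 - b.1) * (c.1 - b.1) + (a.2 - b.2) * (c.2 - b.2).
pose D2 := (a.1 - d.1) * (c.1 - d.1) + (a.2 - d.2) * (c.2 - d.2).
have h1 : orient a b c ^+ 2 + D1 ^+ 2 = (x * y) ^+ 2.
  by rewrite exprMn hx hy /orient /D1; ring.
have h2 : orient a c d ^+ 2 + (- D2) ^+ 2 = (z * w) ^+ 2.
  by rewrite exprMn hz hw /orient /D2; ring.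
have h3 : 2 * (D1 - D2) = x ^+ 2 + y ^+ 2 - z ^+ 2 - w ^+ 2.
  by rewrite hx hy hz hw /D1 /D2; ring.
have xy0 : 0 <= x * y by rewrite mulr_ge0 ?dist_ge0.
have zw0 : 0 <= z * w by rewrite mulr_ge0 ?dist_ge0.
have := norm2_triangle xy0 zw0 h1 h2.
have -> : (x + y + z - w) * (x + y - z + w) * (x - y + z + w) * (- x + y + z + w)
  = 4 * (x * y + z * w) ^+ 2 - (x ^+ 2 + y ^+ 2 - z ^+ 2 - w ^+ 2) ^+ 2 by ring.
by rewrite -h3 [(2 * _) ^+ 2]exprMn; lra.
Qed.

Lemma mean3 (x y z : R) : 0 <= x -> 0 <= y -> 0 <= z ->
  27 * (x * y * z) <= (x + y + z) ^+ 3.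
Proof.
move=> x0 y0 z0.
have h1 := mulr_ge0 x0 (sqr_ge0 (y - z)).
have h2 := mulr_ge0 y0 (sqr_ge0 (z - x)).
have h3 := mulr_ge0 z0 (sqr_ge0 (x - y)).
have h4 := mulr_ge0 x0 (sqr_ge0 (x - y)).
have h5 := mulr_ge0 x0 (sqr_ge0 (x - z)).
have h6 := mulr_ge0 y0 (sqr_ge0 (y - x)).
have h7 := mulr_ge0 y0 (sqr_ge0 (y - z)).
have h8 := mulr_ge0 z0 (sqr_ge0 (z - x)).
have h9 := mulr_ge0 z0 (sqr_ge0 (z - y)).
nra.
Qed.

(* Bretschneider's bound, with the three factors other than [s - e] replaced by
   their mean. *)
Lemma quadrilateral_area_base a b c d (e := euclidean_dist d a)
    (s := euclidean_dist a b + euclidean_dist b c + euclidean_dist c d) :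
  432 * ((orient a b c + orient a c d) / 2) ^+ 2 <= (s - e) * (s + 3 * e) ^+ 3.
Proof.
have t1 : e <= s.
  rewrite /e distC; apply: le_trans (dist_triangle a c d) _.
  by rewrite lerD2r dist_triangle.
set x := euclidean_dist a b; set y := euclidean_dist b c.
set z := euclidean_dist c d.
have H : 4 * (orient a b c + orient a c d) ^+ 2 <=
    (s - e) * (x + y - z + e) * (x - y + z + e) * (- x + y + z + e).
  exact: bretschneider.
have t2 : z <= x + y + e.
  apply: le_trans (dist_triangle c a d) _; rewrite (distC a d) lerD2r.
  by rewrite distC; apply: dist_triangle.
have t3 : x <= y + z + e.
  rewrite /x distC; apply: le_trans (dist_triangle b d a) _.
  by rewrite lerD2r; apply: dist_triangle.
have t4 : y <= x + z + e.
  apply: le_trans (dist_triangle b a c) _; rewrite (distC b) -addrA lerD2l.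
  apply: le_trans (dist_triangle a d c) _.
  by rewrite addrC (distC a) (distC d c).
have := @mean3 (x + y - z + e) (x - y + z + e) (- x + y + z + e).
have -> : x + y - z + e + (x - y + z + e) + (- x + y + z + e) = s + 3 * e.
  by rewrite /s /x /y /z; ring.
move=> M0.
have M : 27 * ((x + y - z + e) * (x - y + z + e) * (- x + y + z + e)) <= (s + 3 * e) ^+ 3.
  by apply: M0; lra.
have : 0 <= s - e by rewrite subr_ge0.
move=> /ler_wpM2l/(_ _ _ M).
move: H; rewrite exprMn exprVn.
lra.
Qed.

(** With [p] and [n] equal to xy (1 + cos) and xy (1 - cos), the squared orientation is [p * n].
    Cosine 7/25 means that the half angle has tangent 3/4, whence [16 * n <= 9 * p] and the first
    bound. The second combines [2 * n <= z ^+ 2] with the square of 3 (x + y) - 5 z being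
    nonnegative. *)
Lemma corner_triangle_bound a b e (x := euclidean_dist a b)
    (y := euclidean_dist e a) (z := euclidean_dist b e) :
  7 / 25 * (x * y) <= dot (b - a) (e - a) ->
  8 * orient a b e <= 3 * ((x + y) ^+ 2 - z ^+ 2) /\
  8 * orient a b e <= z * (5 * (x + y) - 3 * z).
Proof.
move=> hD; set D := dot _ _ in hD; set K := orient a b e.
have hx := sqr_dist a b; have hy := sqr_dist e a; have hz := sqr_dist b e.
rewrite -/x in hx; rewrite -/y in hy; rewrite -/z in hz.
have x0 : 0 <= x by exact: dist_ge0.
have y0 : 0 <= y by exact: dist_ge0.
have z0 : 0 <= z by exact: dist_ge0.
have xy0 : 0 <= x * y by rewrite mulr_ge0.
have hK : K ^+ 2 = (x * y) ^+ 2 - D ^+ 2.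
  by rewrite exprMn hx hy /K /D /orient /dot /=; ring.
have hz2 : z ^+ 2 = x ^+ 2 + y ^+ 2 - 2 * D.
  by rewrite hx hy hz /D /dot /=; ring.
have Dle : D <= x * y.
  apply: le_trans (ler_norm _) _.
  rewrite -(@ler_pXn2r _ 2) ?nnegrE ?real_normK ?num_real //.
  by have := sqr_ge0 K; rewrite hK; lra.
set p := x * y + D; set n := x * y - D.
have p0 : 0 <= p by rewrite /p; lra.
have n0 : 0 <= n by rewrite /n; lra.
have np : 16 * n <= 9 * p by rewrite /p /n; lra.
have mz : (x + y) ^+ 2 - z ^+ 2 = 2 * p by rewrite hz2 /p; ring.
have hK' : K ^+ 2 = p * n by rewrite hK /p /n; ring.
split.
  rewrite mz; apply: le_trans (ler_norm _) _.
  rewrite -(@ler_pXn2r _ 2) ?nnegrE ?real_normK ?num_real // ?mulr_ge0 //.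
  rewrite !exprMn hK'.
  have := ler_wpM2l p0 np; nra.
have zn : 2 * n <= z ^+ 2.
  have := sqr_ge0 (x - y); rewrite hz2 /n; lra.
have m0 : 0 <= x + y by rewrite addr_ge0.
have zm : z <= x + y.
  rewrite -(@ler_pXn2r _ 2) ?nnegrE //; move: mz; lra.
have h0 : 0 <= 5 * (x + y) - 3 * z by lra.
apply: le_trans (ler_norm _) _.
rewrite -(@ler_pXn2r _ 2) ?nnegrE ?real_normK ?num_real // ?mulr_ge0 //.
rewrite !exprMn hK'.
have h1 : 16 * (2 * p) <= (5 * (x + y) - 3 * z) ^+ 2.
  rewrite -mz; have := sqr_ge0 (3 * (x + y) - 5 * z); nra.
have h2 : 2 * n * (16 * (2 * p)) <= z ^+ 2 * (5 * (x + y) - 3 * z) ^+ 2.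
  by apply: ler_pM => //; apply: mulr_ge0 => //; apply: mulr_ge0.
lra.
Qed.

(** Twice the signed area, cut along the diagonals from [b], so that the corner triangle at [a] is
    separated from the quadrilateral [b c d e]. *)
Definition shoelace5 a b c d e : R :=
  orient a b e + orient b c d + orient b d e.

Definition perimeter5 a b c d e : R :=
  euclidean_dist a b + euclidean_dist b c + euclidean_dist c d +
  euclidean_dist d e + euclidean_dist e a.

(** A cosine of at least 7/25 would make 15 times the area at most the squared perimeter, hence the
    area less than 1. *)
Lemma efficient_corner_angle a b c d e :
  0 <= orient b c d + orient b d e -> 2 <= shoelace5 a b c d e ->
  perimeter5 a b c d e ^+ 2 < 15 ->
  dot (b - a) (e - a) < 7 / 25 * (euclidean_dist a b * euclidean_dist e a).
Proof.
move=> q0 A2 L15; rewrite ltNge; apply/negP => /corner_triangle_bound[h1 h2].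
have := @pentagon_area_bound (euclidean_dist a b + euclidean_dist e a)
  (euclidean_dist b e)
  (euclidean_dist b c + euclidean_dist c d + euclidean_dist d e)
  ((orient b c d + orient b d e) / 2) (orient a b e / 2) (dist_ge0 _ _).
have e1 : euclidean_dist b e <= euclidean_dist a b + euclidean_dist e a.
  by rewrite (distC a b) (distC e a); apply: dist_triangle.
have e2 : euclidean_dist b e <=
    euclidean_dist b c + euclidean_dist c d + euclidean_dist d e.
  apply: le_trans (dist_triangle b d e) _.
  by rewrite lerD2r; apply: dist_triangle.
have qb := quadrilateral_area_base b c d e.
rewrite (distC e b) in qb.
have q2 : 0 <= (orient b c d + orient b d e) / 2 by rewrite divr_ge0.
move=> /(_ e1 e2 q2 qb) H.
have {}H := H ltac:(lra) ltac:(lra).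
move: H.
move: L15 A2; rewrite /perimeter5 /shoelace5.
set X := (_ + _) ^+ 2; set Y := (_ + _) ^+ 2.
have -> : Y = X by rewrite /X /Y; congr (_ ^+ 2); ring.
lra.
Qed.

End Isoperimetry.

(** * Areas *)

Section Area.
Context {R : realType}.
Local Notation plane := (R * R)%type.
Local Notation mu := (@lebesgue_measure R).
Implicit Types (a b c : plane) (S : set plane).

(* Measurability of [S] is not required: the library's Lebesgue measure of an
   arbitrary set is its outer measure, and integrals of nonnegative functions
   are monotone without measurability. *)
Definition area_at_most S (A : R) : Prop := exists g : R -> \bar R,
  [/\ measurable_fun setT g, forall x, (0 <= g x)%E,
      forall x, (mu (xsection S x) <= g x)%E & (\int[mu]_x g x <= A%:E)%E].

Lemma ge0_le_integralT (f g : R -> \bar R) :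
  (forall x, (0 <= f x)%E) -> (forall x, (f x <= g x)%E) ->
  (\int[mu]_x f x <= \int[mu]_x g x)%E.
Proof.
move=> f0 fg.
have g0 x : (0 <= g x)%E by apply: le_trans (fg x).
rewrite !ge0_integralTE //; apply: le_ereal_sup => _ [h hf <-].
by exists h => // x; apply: le_trans (fg x); exact: hf.
Qed.

Lemma le_lebesgue (A B : set R) : A `<=` B -> (mu A <= mu B)%E.
Proof. exact: (le_outer_measure (@wlength R idfun)^*%mu). Qed.

Lemma lebesgueU2 (A B : set R) : (mu (A `|` B) <= mu A + mu B)%E.
Proof. exact: (outer_measureU2 (@wlength R idfun)^*%mu). Qed.

Lemma area_at_mostP S A : area_at_most S A ->
  ((lebesgue_measure \x lebesgue_measure) S <= A%:E)%E.
Proof.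
move=> [g [mg g0 Sg gA]]; apply: le_trans gA.
apply: (@ge0_le_integralT (fun x => mu (xsection S x)) g) => //=.
Qed.

Lemma area_at_mostS S S' A : S `<=` S' -> area_at_most S' A -> area_at_most S A.
Proof.
move=> SS' [g [mg g0 Sg gA]]; exists g; split => // x.
by apply: le_trans (Sg x); apply: le_lebesgue; apply: le_xsection.
Qed.

Lemma area_at_mostU S S' A A' : area_at_most S A -> area_at_most S' A' ->
  area_at_most (S `|` S') (A + A').
Proof.
move=> [g [mg g0 Sg gA]] [h [mh h0 Sh hA]].
exists (fun x => g x + h x)%E; split.
- exact: emeasurable_funD.
- by move=> x; rewrite adde_ge0.
- move=> x; have -> : xsection (S `|` S') x = xsection S x `|` xsection S' x.
    by apply/seteqP; split => y; rewrite /= !xsectionE.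
  by apply: le_trans (lebesgueU2 _ _) _; apply: leeD.
- by rewrite ge0_integralD // EFinD leeD.
Qed.


Lemma integral_ramp (u v k l : R) : u <= v ->
  (\int[mu]_(x in `[u, v]) (k * x + l)%:E =
   (k * (v ^+ 2 - u ^+ 2) / 2 + l * (v - u))%:E)%E.
Proof.
rewrite le_eqVlt => /predU1P[<-|uv].
  by rewrite set_itv1 integral_set1 !subrr !mulr0 mul0r addr0.
pose F (x : R) : R := k / 2 * x ^+ 2 + l * x.
have dF (x : R) : is_derive x (1 : R) F (k * x + l).
  rewrite /F; apply: is_derive_eq.
  by rewrite /GRing.scale /=; field.
have cF (x : R) : {for x, continuous F}.
  by apply/differentiable_continuous/derivable1_diffP.
rewrite (@continuous_FTC2 _ _ F).
- by rewrite -EFinD; congr EFin; rewrite /F; field.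
- by [].
- apply: continuous_subspaceT => x.
  by apply: cvgD; [apply: cvgMr; exact: cvg_id | exact: cvg_cst].
- split.
  + by move=> x _; exact: ex_derive.
  + by apply: cvg_at_right_filter; exact: cF.
  + by apply: cvg_at_left_filter; exact: cF.
- by move=> x _; rewrite derive1E; apply: derive_val.
Qed.

(** The factor [s] carries the sign of the orientation, so that clockwise and counterclockwise
    triangles are treated together. *)
Definition triangle (s : R) a b c : set plane :=
  [set x | [/\ 0 <= s * orient a b x, 0 <= s * orient b c x & 0 <= s * orient c a x]].

Lemma triangle_rot (s : R) a b c : triangle s a b c = triangle s b c a.
Proof. by apply/seteqP; split => x [h1 h2 h3]; split. Qed.

Lemma triangle_swap (s : R) a b c : triangle s a b c = triangle (- s) a c b.
Proof.
have E u v x : - s * orient u v x = s * orient v u x by rewrite /orient; ring.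
by apply/seteqP; split => x /= [h1 h2 h3]; split; rewrite ?E // -?E.
Qed.

Lemma lebesgue_slab (s u v l : R) (A : set R) : s = 1 \/ s = -1 ->
  (forall y, A y -> 0 <= s * (y - u) /\ 0 <= s * (v - y)) ->
  s * (v - u) <= l -> 0 <= l -> (mu A <= l%:E)%E.
Proof.
move=> hs hA hl l0.
have [uv|uv] := leP 0 (s * (v - u)); last first.
  have -> : A = set0.
    by apply/seteqP; split => // y /hA [h1 h2]; lra.
  by rewrite measure0 lee_fin.
case: hs => ?; subst s.
  apply: (@le_trans _ _ (mu `[u, v])).
    by apply: le_lebesgue => y /hA; rewrite /= in_itv /=; lra.
  by rewrite lebesgue_measure_itv /=; case: ifP => _; rewrite -?EFinB lee_fin //; lra.
apply: (@le_trans _ _ (mu `[v, u])).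
  by apply: le_lebesgue => y /hA; rewrite /= in_itv /=; lra.
by rewrite lebesgue_measure_itv /=; case: ifP => _; rewrite -?EFinB lee_fin //; lra.
Qed.

(** The lengths of the vertical sections form a tent: zero at [a.1], increasing linearly up to
    [b.1], then decreasing linearly to zero at [c.1]. The sum of the two ramps dominates these
    lengths and has the required integral. *)
Lemma area_triangle_sorted (s : R) a b c : s = 1 \/ s = -1 -> a.1 <= b.1 -> b.1 <= c.1 ->
  0 < s * orient a b c -> area_at_most (triangle s a b c) (s * orient a b c / 2).
Proof.
move=> hs ab bc; set K := s * orient a b c => K0.
have ac : a.1 < c.1.
  rewrite lt_neqAle (le_trans ab bc) andbT; apply/eqP => E.
  have E2 : b.1 = a.1 by apply/le_anti/andP; split; rewrite // E.
  by move: K0; rewrite /K /orient E2 -E; lra.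
(* When [b] is vertically aligned with [a] the division by zero gives slope 0, and this ramp lives
   on a single point; likewise for [k2]. The cases in [H1] and [H2] reflect this. *)
pose k1 := K / ((b.1 - a.1) * (c.1 - a.1)).
pose k2 := K / ((c.1 - b.1) * (c.1 - a.1)).
pose f1 (x : R) : \bar R := (k1 * x + - (k1 * a.1))%:E.
pose f2 (x : R) : \bar R := (- k2 * x + k2 * c.1)%:E.
have k10 : 0 <= k1.
  by apply: divr_ge0; [exact: ltW | apply: mulr_ge0; rewrite subr_ge0 // ltW].
have k20 : 0 <= k2.
  by apply: divr_ge0; [exact: ltW | apply: mulr_ge0; rewrite subr_ge0 // ltW].
have mf (k l : R) : measurable_fun setT (fun x : R => (k * x + l)%:E).
  apply/measurable_EFinP; apply: measurable_funD => //.
have f10 x : `[a.1, b.1]%classic x -> (0 <= f1 x)%E.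
  rewrite /= in_itv /= => /andP[ax _]; rewrite lee_fin.
  by have := @mulr_ge0 _ k1 (x - a.1) k10; rewrite subr_ge0 mulrBr => /(_ ax).
have f20 x : `[b.1, c.1]%classic x -> (0 <= f2 x)%E.
  rewrite /= in_itv /= => /andP[_ cx]; rewrite lee_fin.
  by have := @mulr_ge0 _ k2 (c.1 - x) k20; rewrite subr_ge0 mulrBr => /(_ cx); lra.
exists (fun x => (f1 \_ `[a.1, b.1]) x + (f2 \_ `[b.1, c.1]) x)%E.
have e10 x : (0 <= (f1 \_ `[a.1, b.1]) x)%E.
  by rewrite patchE; case: ifPn => //; rewrite inE; exact: f10.
have e20 x : (0 <= (f2 \_ `[b.1, c.1]) x)%E.
  by rewrite patchE; case: ifPn => //; rewrite inE; exact: f20.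
have m1 : measurable_fun setT (f1 \_ `[a.1, b.1]).
  by apply/(measurable_restrictT _ _).1 => //; apply: measurable_funTS; exact: (mf k1 (- (k1 * a.1))).
have m2 : measurable_fun setT (f2 \_ `[b.1, c.1]).
  by apply/(measurable_restrictT _ _).1 => //; apply: measurable_funTS; exact: (mf (- k2) (k2 * c.1)).
split.
- exact: emeasurable_funD.
- by move=> x; rewrite adde_ge0.
- move=> x.
  have xac y : triangle s a b c (x, y) -> a.1 <= x <= c.1.
    move=> [h1 h2 h3].
    have e1 : K * (x - a.1) = s * orient a b (x, y) * (c.1 - a.1) +
        s * orient c a (x, y) * (b.1 - a.1) by rewrite /K /orient /=; ring.
    have e2 : K * (c.1 - x) = s * orient b c (x, y) * (c.1 - a.1) +
        s * orient c a (x, y) * (c.1 - b.1) by rewrite /K /orient /=; ring.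
    rewrite -(subr_ge0 a.1) -(subr_ge0 x) -(pmulr_rge0 _ K0) -[X in _ && X](pmulr_rge0 _ K0).
    by rewrite e1 e2 !addr_ge0 // mulr_ge0 // subr_ge0 // ltW.
  have [/andP[ax xc]|nx] := boolP (a.1 <= x <= c.1); last first.
    suff -> : xsection (triangle s a b c) x = set0 by rewrite measure0 adde_ge0.
    apply/seteqP; split => // y; rewrite xsectionE /= => /xac.
    by rewrite (negbTE nx).
  pose yac := a.2 + (c.2 - a.2) * (x - a.1) / (c.1 - a.1).
  have ac0 : 0 < c.1 - a.1 by rewrite subr_gt0.
  have hac y : s * orient c a (x, y) = (c.1 - a.1) * (s * (yac - y)).
    by rewrite /orient /yac /=; field; rewrite gt_eqF.
  have [xb|xb] := boolP ((a.1 < b.1) && (x <= b.1)).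
    move/andP: xb => [ab' xb].
    have ab0 : 0 < b.1 - a.1 by rewrite subr_gt0.
    pose yab := a.2 + (b.2 - a.2) * (x - a.1) / (b.1 - a.1).
    have hab y : s * orient a b (x, y) = (b.1 - a.1) * (s * (y - yab)).
      by rewrite /orient /yab /=; field; rewrite gt_eqF.
    have hx : `[a.1, b.1]%classic x by rewrite /= in_itv /= ax.
    apply: le_trans (leeDl _ (e20 x)).
    rewrite patchE mem_set //; apply: (lebesgue_slab (u := yab) (v := yac) hs).
    + move=> y; rewrite xsectionE => -[h1 _ h3]; split.
        by move: h1; rewrite hab pmulr_rge0.
      by move: h3; rewrite hac pmulr_rge0.
    + rewrite /k1 /K /yac /yab /orient le_eqVlt; apply/orP; left; apply/eqP.
      by field; rewrite !gt_eqF.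
    + by rewrite -lee_fin; apply: f10.
  have bx : b.1 <= x.
    by move: xb; rewrite negb_and -leNgt -ltNge => /orP[/le_trans->//|/ltW].
  have bc' : b.1 < c.1.
    move: xb; rewrite negb_and -leNgt -ltNge => /orP[ba|].
      exact: le_lt_trans ba ac.
    by move/lt_le_trans; apply.
  have bc0 : 0 < c.1 - b.1 by rewrite subr_gt0.
  pose ybc := c.2 + (b.2 - c.2) * (c.1 - x) / (c.1 - b.1).
  have hbc y : s * orient b c (x, y) = (c.1 - b.1) * (s * (y - ybc)).
    by rewrite /orient /ybc /=; field; rewrite gt_eqF.
  have hx : `[b.1, c.1]%classic x by rewrite /= in_itv /= bx.
  apply: le_trans (leeDr _ (e10 x)).
  rewrite patchE mem_set //; apply: (lebesgue_slab (u := ybc) (v := yac) hs).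
  + move=> y; rewrite xsectionE => -[_ h1 h3]; split.
      by move: h1; rewrite hbc pmulr_rge0.
    by move: h3; rewrite hac pmulr_rge0.
  + rewrite /k2 /K /yac /ybc /orient le_eqVlt; apply/orP; left; apply/eqP.
    by field; rewrite !gt_eqF.
  + by rewrite -lee_fin; apply: f20.
- rewrite ge0_integralD // -!integral_mkcond !integral_ramp // -EFinD lee_fin.
  have ac0 : c.1 - a.1 != 0 by rewrite subr_eq0 gt_eqF.
  have H1 : k1 * (b.1 - a.1) ^+ 2 = K * (b.1 - a.1) / (c.1 - a.1).
    have [->|ne] := eqVneq b.1 a.1; first by rewrite subrr expr0n /= !mulr0 mul0r.
    by rewrite /k1; field; rewrite ac0 subr_eq0 ne.
  have H2 : k2 * (c.1 - b.1) ^+ 2 = K * (c.1 - b.1) / (c.1 - a.1).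
    have [->|ne] := eqVneq c.1 b.1; first by rewrite subrr expr0n /= !mulr0 mul0r.
    by rewrite /k2; field; rewrite ac0 subr_eq0 ne.
  have H3 : K = K * (b.1 - a.1) / (c.1 - a.1) + K * (c.1 - b.1) / (c.1 - a.1).
    by field.
  rewrite [K in leRHS]H3 -H1 -H2 le_eqVlt; apply/orP; left; apply/eqP; by field.
Qed.

Lemma area_triangle (s : R) a b c : s = 1 \/ s = -1 -> 0 < s * orient a b c ->
  area_at_most (triangle s a b c) (s * orient a b c / 2).
Proof.
have first_min (t : R) u v w : t = 1 \/ t = -1 -> 0 < t * orient u v w ->
    u.1 <= v.1 -> u.1 <= w.1 ->
    area_at_most (triangle t u v w) (t * orient u v w / 2).
  move=> ht K0 uv uw; have [vw|/ltW wv] := leP v.1 w.1.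
    exact: area_triangle_sorted.
  have E : t * orient u v w = - t * orient u w v by rewrite /orient; ring.
  rewrite E triangle_swap; apply: area_triangle_sorted => //; last by rewrite -E.
  by case: ht => ->; [right | left; rewrite opprK].
move=> hs K0.
have E1 : orient a b c = orient b c a by rewrite /orient; ring.
have E2 : orient a b c = orient c a b by rewrite /orient; ring.
have [ab|ba] := leP a.1 b.1; have [ac|ca] := leP a.1 c.1.
- exact: first_min.
- rewrite -triangle_rot E2; apply: first_min; rewrite -?E2 //; last by lra.
  exact: ltW.
- by rewrite triangle_rot E1; apply: first_min; rewrite -?E1 //; lra.
- have [bc|cb] := leP b.1 c.1.
    by rewrite triangle_rot E1; apply: first_min; rewrite -?E1 //; lra.
  by rewrite -triangle_rot E2; apply: first_min; rewrite -?E2 //; lra.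
Qed.

End Area.

(** * Convex hulls and simple polygons with few vertices *)

Section Hulls.
Context {R : realType}.
Local Notation plane := (R * R)%type.
Implicit Types (a b c d e u v w x y z : plane) (p q : seq plane) (s t k : R).

(* The convex hull, as an intersection of half-planes. *)
Definition hull p : set plane :=
  [set x | forall u k, (forall v, v \in p -> k <= dot u v) -> k <= dot u x].

Lemma hull_mem p x : x \in p -> hull p x.
Proof. by move=> xp u k; apply. Qed.

Lemma hull_sub p q : (forall v, v \in p -> hull q v) -> hull p `<=` hull q.
Proof. by move=> pq x px u k qk; apply: px => v /pq; apply. Qed.

Lemma hull_orient p s a b x : hull p x ->
  (forall v, v \in p -> 0 <= s * orient a b v) -> 0 <= s * orient a b x.
Proof.
move=> px pos; pose u : plane := (s * (a.2 - b.2), s * (b.1 - a.1)).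
have E v : s * orient a b v = dot u v - dot u a.
  by rewrite /orient /dot /u /=; ring.
by rewrite E subr_ge0; apply: px => v /pos; rewrite E subr_ge0.
Qed.

Lemma hull_segment a b t : 0 <= t <= 1 -> hull [:: a; b] ((1 - t) *: a + t *: b).
Proof.
move=> /andP[t0 t1] u k H; have := H a; have := H b.
rewrite !inE !eqxx orbT => /(_ isT) kb /(_ isT) ka.
have -> : dot u ((1 - t) *: a + t *: b) = (1 - t) * dot u a + t * dot u b.
  by rewrite /dot /= /GRing.scale /=; ring.
have h1 : 0 <= (1 - t) * (dot u a - k) by apply: mulr_ge0; lra.
have h2 : 0 <= t * (dot u b - k) by apply: mulr_ge0; lra.
lra.
Qed.

(** The three orientations are the barycentric coordinates of [x], up to the common factor
    [orient a b c]. *)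
Lemma hull_triangle s a b c x : 0 < s * orient a b c -> triangle s a b c x ->
  hull [:: a; b; c] x.
Proof.
move=> K0 [h1 h2 h3] u k H; have := H a; have := H b; have := H c.
rewrite !inE !eqxx !orbT => /(_ isT) kc /(_ isT) kb /(_ isT) ka.
rewrite -subr_ge0 -(pmulr_rge0 _ K0).
have -> : s * orient a b c * (dot u x - k) =
    s * orient b c x * (dot u a - k) + s * orient c a x * (dot u b - k) +
    s * orient a b x * (dot u c - k).
  by rewrite /dot /orient /=; ring.
by rewrite !addr_ge0 // mulr_ge0 // subr_ge0.
Qed.

Definition on_segment a b x := exists2 t, 0 <= t <= 1 & x = (1 - t) *: a + t *: b.

Lemma on_segmentP a b x : on_segment a b x -> hull [:: a; b] x.
Proof. by move=> [t t01 ->]; apply: hull_segment. Qed.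

Lemma collinear_on_segment a b c : orient a b c = 0 ->
  [\/ on_segment b c a, on_segment a c b | on_segment a b c].
Proof.
move=> o0; have [ab|ab] := eqVneq a b.
  constructor 1; exists 0; first by rewrite lexx ler01.
  by rewrite subr0 scale1r scale0r addr0.
pose N := (b.1 - a.1) ^+ 2 + (b.2 - a.2) ^+ 2.
have N0 : 0 < N.
  rewrite lt_neqAle addr_ge0 ?sqr_ge0 // andbT eq_sym; apply: contra ab.
  rewrite paddr_eq0 ?sqr_ge0 // !sqrf_eq0 !subr_eq0 => /andP[/eqP e1 /eqP e2].
  by rewrite [a]surjective_pairing [b]surjective_pairing e1 e2.
pose t := ((b.1 - a.1) * (c.1 - a.1) + (b.2 - a.2) * (c.2 - a.2)) / N.
have c1 : c.1 = a.1 + t * (b.1 - a.1).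
  have -> : c.1 = a.1 + t * (b.1 - a.1) - (b.2 - a.2) / N * orient a b c.
    by rewrite /t /orient /N; field; apply: lt0r_neq0.
  by rewrite o0 mulr0 subr0.
have c2 : c.2 = a.2 + t * (b.2 - a.2).
  have -> : c.2 = a.2 + t * (b.2 - a.2) + (b.1 - a.1) / N * orient a b c.
    by rewrite /t /orient /N; field; apply: lt0r_neq0.
  by rewrite o0 mulr0 addr0.
have [t0|t0] := ltP t 0.
  have t1 : 1 - t != 0 by apply: lt0r_neq0; lra.
  constructor 1; exists (1 / (1 - t)).
    rewrite divr_ge0 ?ler_pdivrMr /=; lra.
  by apply: pair_eq; rewrite /= /GRing.scale /= ?c1 ?c2; field.
have [t1|t1] := ltP 1 t.
  have tn : t != 0 by apply: lt0r_neq0; lra.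
  constructor 2; exists (1 / t).
    rewrite divr_ge0 ?ler_pdivrMr /=; lra.
  by apply: pair_eq; rewrite /= /GRing.scale /= ?c1 ?c2; field.
constructor 3; exists t; first by rewrite t0.
by apply: pair_eq; rewrite /= /GRing.scale /= ?c1 ?c2; ring.
Qed.

End Hulls.

(** * Hulls of two, three or four points with a short perimeter *)

Section SmallHulls.
Context {R : realType}.
Local Notation plane := (R * R)%type.
Local Notation dist := euclidean_dist.
Implicit Types (a b c d e u v w x y z : plane) (p q : seq plane) (s t k : R).

(** A polygon whose region lies in such a hull cannot have unit area. *)
Definition small_hull p := exists2 A, A < 1 & area_at_most (hull p) A.

Lemma small_hull_sub p q : (forall v, v \in p -> hull q v) ->
  small_hull q -> small_hull p.
Proof.
by move=> pq [A A1 qA]; exists A => //; apply: area_at_mostS qA; apply: hull_sub.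
Qed.

(** A triangle of area 1/2 with one side along the segment already bounds the area below 1, so null
    sets need no separate treatment. *)
Lemma small_hull2 a b : small_hull [:: a; b].
Proof.
suff [v [w [ab1 hv hw]]] : exists v w, [/\ orient a v w = 1,
    0 <= orient a v b /\ 0 <= orient v w b & 0 <= orient w a b].
  exists (1 / 2); first by lra.
  have tr : area_at_most (triangle 1 a v w) (1 * orient a v w / 2).
    by apply: area_triangle; [left | rewrite ab1 mulr1].
  rewrite ab1 mulr1 in tr; apply: area_at_mostS tr => x hx.
  have oa y z : orient y z y = 0 /\ orient y z z = 0 by split; rewrite /orient; ring.
  have ova : orient v w a = 1 by rewrite -ab1 /orient; ring.
  have owa : orient w a a = 0 by rewrite /orient; ring.
  have oav : orient a v a = 0 by rewrite /orient; ring.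
  split; apply: hull_orient hx _ => y; rewrite !inE mul1r => /orP[]/eqP->;
    rewrite ?ova ?owa ?oav ?ler01 //; tauto.
have [->|ab] := eqVneq b a.
  exists (a.1 + 1, a.2), (a.1, a.2 + 1); rewrite /orient /=.
  by split; [ring | split; lra | lra].
pose N := (b.1 - a.1) ^+ 2 + (b.2 - a.2) ^+ 2.
have N0 : 0 < N.
  rewrite lt_neqAle addr_ge0 ?sqr_ge0 // andbT eq_sym; apply: contra ab.
  rewrite paddr_eq0 ?sqr_ge0 // !sqrf_eq0 !subr_eq0 => /andP[/eqP e1 /eqP e2].
  by rewrite [a]surjective_pairing [b]surjective_pairing e1 e2.
(* The third corner is [a] displaced at a right angle to [b - a], divided by the squared length so
   that the orientation is exactly 1. *)
exists b, (a.1 - (b.2 - a.2) / N, a.2 + (b.1 - a.1) / N).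
rewrite /orient /=; split.
- by rewrite -[RHS](divff (lt0r_neq0 N0)) /N; field; apply: lt0r_neq0.
- by split; rewrite le_eqVlt; apply/orP; left; apply/eqP; ring.
- rewrite (_ : _ - _ = 1) //.
  by rewrite -[RHS](divff (lt0r_neq0 N0)) /N; field; apply: lt0r_neq0.
Qed.

Lemma orient_le_dist s a b c : s = 1 \/ s = -1 ->
  s * orient a b c <= dist a b * dist b c.
Proof.
move=> hs; apply: le_trans (ler_norm _) _.
rewrite -(@ler_pXn2r _ 2) ?nnegrE ?mulr_ge0 ?dist_ge0 //.
rewrite real_normK ?num_real // !exprMn !sqr_dist.
have -> : s ^+ 2 = 1 by case: hs => ->; rewrite ?sqrrN expr1n.
have := sqr_ge0 ((b.1 - a.1) * (c.1 - b.1) + (b.2 - a.2) * (c.2 - b.2)).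
by rewrite /orient; lra.
Qed.

Lemma orient_rot a b c : orient a b c = orient b c a.
Proof. by rewrite /orient; ring. Qed.

Lemma orient_swap a b c : orient a b c = - orient b a c.
Proof. by rewrite /orient; ring. Qed.

Lemma small_hull3 a b c : dist a b + dist b c + dist c a < 4 ->
  small_hull [:: a; b; c].
Proof.
move=> L4; have [oz|oz] := eqVneq (orient a b c) 0.
  have [ha|hb|hc] := collinear_on_segment oz.
  - apply: small_hull_sub (small_hull2 b c) => v.
    rewrite !inE => /or3P[]/eqP->; first exact: on_segmentP.
      by apply: hull_mem; rewrite !inE eqxx.
    by apply: hull_mem; rewrite !inE eqxx orbT.
  - apply: small_hull_sub (small_hull2 a c) => v.
    rewrite !inE => /or3P[]/eqP->; last 1 first.
    + by apply: hull_mem; rewrite !inE eqxx orbT.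
    + by apply: hull_mem; rewrite !inE eqxx.
    + exact: on_segmentP.
  - apply: small_hull_sub (small_hull2 a b) => v.
    rewrite !inE => /or3P[]/eqP->; last exact: on_segmentP.
      by apply: hull_mem; rewrite !inE eqxx.
    by apply: hull_mem; rewrite !inE eqxx orbT.
have [s hs K0] : exists2 s, s = 1 \/ s = -1 & 0 < s * orient a b c.
  move: oz; rewrite neq_lt => /orP[oN|oP]; last by exists 1; rewrite ?mul1r //; left.
  by exists (-1); rewrite ?mulN1r ?oppr_gt0 //; right.
exists (s * orient a b c / 2).
  (* With sides X, Y, Z, twice the orientation is at most Y (X + Z), hence at most a quarter of the
     squared perimeter, which is less than 4. *)
  have h1 := orient_le_dist a b c hs.
  have h2 := orient_le_dist b c a hs; rewrite -orient_rot in h2.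
  move: h1 h2 L4; set S := s * _.
  have := dist_ge0 a b; have := dist_ge0 b c; have := dist_ge0 c a.
  move: (dist a b) (dist b c) (dist c a) => X Y Z Z0 Y0 X0 h1 h2 L4.
  have := sqr_ge0 (X + Z - Y); nra.
apply: area_at_mostS (area_triangle hs K0) => x hx.
have e1 y z : s * orient y z y = 0 by rewrite /orient; ring.
have e2 y z : s * orient y z z = 0 by rewrite /orient; ring.
split; apply: hull_orient hx _ => y; rewrite !inE => /or3P[]/eqP->;
  rewrite ?e1 ?e2 // ?(ltW K0) //.
- by rewrite -orient_rot ltW.
- by rewrite orient_rot ltW.
Qed.

(** Cutting along either diagonal gives the same area. Each of the four triangles has an orientation
    at most the product of its two sides on the perimeter, and these products add up to (X + Z) (Y +
    W), at most a quarter of the squared perimeter. *)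
Lemma small_convex4 s a b c d : s = 1 \/ s = -1 ->
  0 < s * orient a b c -> 0 < s * orient b c d -> 0 < s * orient c d a ->
  0 < s * orient d a b ->
  dist a b + dist b c + dist c d + dist d a < 4 ->
  small_hull [:: a; b; c; d].
Proof.
move=> hs oabc obcd ocda odab L4.
exists (s * orient a b c / 2 + s * orient a c d / 2).
  have h1 := orient_le_dist a b c hs; have h2 := orient_le_dist c d a hs.
  have h3 := orient_le_dist b c d hs; have h4 := orient_le_dist d a b hs.
  have E1 : s * orient a c d = s * orient c d a by rewrite (orient_rot a c d).
  have E2 : s * orient a b c + s * orient c d a = s * orient b c d + s * orient d a b.
    by rewrite /orient; ring.
  rewrite E1; move: E2 h1 h2 h3 h4 L4.
  have := dist_ge0 a b; have := dist_ge0 b c; have := dist_ge0 c d.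
  have := dist_ge0 d a.
  move: (dist a b) (dist b c) (dist c d) (dist d a) => X Y Z W W0 Z0 Y0 X0.
  move: (s * orient a b c) (s * orient c d a) (s * orient b c d) (s * orient d a b).
  move=> A B C D E2 h1 h2 h3 h4 L4.
  have := sqr_ge0 (X + Z - Y - W); nra.
have h1 := area_triangle hs oabc.
have ocd : 0 < s * orient a c d by rewrite orient_rot.
have h2 := area_triangle hs ocd.
apply: area_at_mostS (area_at_mostU h1 h2) => x hx.
have e1 y z : s * orient y z y = 0 by rewrite /orient; ring.
have e2 y z : s * orient y z z = 0 by rewrite /orient; ring.
have i1 : 0 <= s * orient a b x.
  apply: hull_orient hx _ => y; rewrite !inE => /or4P[]/eqP->;
    by rewrite ?e1 ?e2 // ltW // -orient_rot.
have i2 : 0 <= s * orient b c x.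
  apply: hull_orient hx _ => y; rewrite !inE => /or4P[]/eqP->;
    by rewrite ?e1 ?e2 // ltW // -orient_rot.
have i3 : 0 <= s * orient c d x.
  apply: hull_orient hx _ => y; rewrite !inE => /or4P[]/eqP->;
    by rewrite ?e1 ?e2 // ltW // -orient_rot.
have i4 : 0 <= s * orient d a x.
  apply: hull_orient hx _ => y; rewrite !inE => /or4P[]/eqP->;
    by rewrite ?e1 ?e2 // ltW // -orient_rot.
have := le_total 0 (s * orient c a x); case/orP => h; [left|right]; split => //.
by rewrite orient_swap mulrN oppr_ge0.
Qed.

Lemma dist_segment a b t : 0 <= t ->
  dist a ((1 - t) *: a + t *: b) = t * dist a b.
Proof.
move=> t0; apply/eqP; rewrite -(@eqrXn2 _ 2) ?mulr_ge0 ?dist_ge0 //.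
by rewrite exprMn !sqr_dist /= /GRing.scale /=; apply/eqP; ring.
Qed.

(** The diagonals meet at a point [X], with parameters [t] and [u]; the triangle inequality through
    [X] bounds each of the two opposite sides. Consequently, putting four points into convex order
    does not lengthen the closed path through them. *)
Lemma crossing_sides_shorter s a b c d :
  0 < s * orient a b c -> 0 < s * orient b c d -> 0 < s * orient c d a ->
  0 < s * orient d a b -> dist a b + dist c d <= dist a c + dist b d.
Proof.
move=> oabc obcd ocda odab.
pose t := s * orient d a b / (s * orient d a b + s * orient b c d).
pose u := s * orient a b c / (s * orient a b c + s * orient c d a).
have D1 : 0 < s * orient d a b + s * orient b c d by rewrite addr_gt0.
have D2 : 0 < s * orient a b c + s * orient c d a by rewrite addr_gt0.
have t0 : 0 <= t by rewrite divr_ge0 // ltW.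
have t1 : 0 <= 1 - t by rewrite subr_ge0 ler_pdivrMr // mul1r lerDl ltW.
have u0 : 0 <= u by rewrite divr_ge0 // ltW.
have u1 : 0 <= 1 - u by rewrite subr_ge0 ler_pdivrMr // mul1r lerDl ltW.
pose X := (1 - t) *: a + t *: c.
have sn0 : s != 0 by apply/eqP => s0; move: oabc; rewrite s0 mul0r ltxx.
have K1 : orient d a b + orient b c d != 0.
  by move: (lt0r_neq0 D1); rewrite -mulrDr mulf_eq0 negb_or => /andP[].
have K2 : orient a b c + orient c d a != 0.
  by move: (lt0r_neq0 D2); rewrite -mulrDr mulf_eq0 negb_or => /andP[].
have E : orient d a b + orient b c d = orient a b c + orient c d a.
  by rewrite /orient; ring.
have tE : t = orient d a b / (orient a b c + orient c d a).
  by rewrite /t -mulrDr E -mulf_div divff // mul1r.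
have uE : u = orient a b c / (orient a b c + orient c d a).
  by rewrite /u -mulrDr -mulf_div divff // mul1r.
have XE : X = (1 - u) *: b + u *: d.
  rewrite /X tE uE; apply: pair_eq; rewrite /= /GRing.scale /=; move: K2;
    rewrite /orient => K2; by field.
have aX : dist a X = t * dist a c by apply: dist_segment.
have X1 : X = (1 - (1 - t)) *: c + (1 - t) *: a by rewrite /X subKr addrC.
have cX : dist c X = (1 - t) * dist a c by rewrite X1 dist_segment // (distC c a).
have bX : dist b X = u * dist b d by rewrite XE dist_segment.
have X2 : X = (1 - (1 - u)) *: d + (1 - u) *: b by rewrite XE subKr addrC.
have dX : dist d X = (1 - u) * dist b d by rewrite X2 dist_segment // (distC d b).
have := dist_triangle a X b; have := dist_triangle c X d.
rewrite (distC X b) (distC X d) aX bX cX dX; lra.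
Qed.

End SmallHulls.

(** * Orientations of four and five points in convex position *)

Section Signs.
Context {R : realType}.
Local Notation plane := (R * R)%type.
Local Notation dist := euclidean_dist.
Implicit Types (a b c d e u v w x y z : plane) (p q : seq plane) (s t k : R).

Lemma hull_subset p q : {subset p <= q} -> hull p `<=` hull q.
Proof. by move=> pq; apply: hull_sub => v /pq; exact: hull_mem. Qed.

Lemma orient_neq0 a b c d : ~ hull [:: b; c; d] a -> ~ hull [:: a; c; d] b ->
  ~ hull [:: a; b; d] c -> orient a b c != 0.
Proof.
move=> na nb nc; apply/eqP => /collinear_on_segment[] /on_segmentP h.
- by apply: na; apply: hull_subset h => v; rewrite !inE => /orP[]/eqP->; rewrite eqxx ?orbT.
- by apply: nb; apply: hull_subset h => v; rewrite !inE => /orP[]/eqP->; rewrite eqxx ?orbT.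
- by apply: nc; apply: hull_subset h => v; rewrite !inE => /orP[]/eqP->; rewrite eqxx ?orbT.
Qed.

(* The orientations of [bcd], [acd], [abd], [abc] when no one of the four points
   is in the hull of the others: one pattern, up to a global sign, for each of
   the three cyclic orders in which the points can be in convex position. *)
Definition convex_signs (k1 k2 k3 k4 : bool) :=
  (k1 == k2) && (k3 == k4) || (k1 == k4) && (k2 == k3).

(** Sixteen sign patterns are conceivable. The affine relation [R0] excludes the two alternating
    ones, and by [F1] to [F4] a single deviating sign puts one point into the triangle of the other
    three; six patterns remain. *)
Lemma four_signs a b c d : ~ hull [:: b; c; d] a -> ~ hull [:: a; c; d] b ->
  ~ hull [:: a; b; d] c -> ~ hull [:: a; b; c] d ->
  [/\ orient b c d != 0, orient a c d != 0, orient a b d != 0, orient a b c != 0 &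
  convex_signs (0 < orient b c d) (0 < orient a c d) (0 < orient a b d)
    (0 < orient a b c)].
Proof.
move=> na nb nc nd.
have perm3 x y z p v : ~ hull [:: x; y; z] v ->
    (forall w, w \in p -> w = x \/ w = y \/ w = z) -> ~ hull p v.
  move=> n pxyz h; apply: n; apply: hull_subset h => w /pxyz.
  by rewrite !inE => -[|[]] ->; rewrite eqxx ?orbT.
have o4 := orient_neq0 na nb nc.
have o3 : orient a b d != 0.
  by apply: (@orient_neq0 _ _ _ c); [apply: (perm3 _ _ _ _ _ na) | apply: (perm3 _ _ _ _ _ nb) |
    apply: (perm3 _ _ _ _ _ nd)] => w; rewrite !inE => /or3P[]/eqP->; tauto.
have o2 : orient a c d != 0.
  by apply: (@orient_neq0 _ _ _ b); [apply: (perm3 _ _ _ _ _ na) | apply: (perm3 _ _ _ _ _ nc) |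
    apply: (perm3 _ _ _ _ _ nd)] => w; rewrite !inE => /or3P[]/eqP->; tauto.
have o1 : orient b c d != 0.
  by apply: (@orient_neq0 _ _ _ a); [apply: (perm3 _ _ _ _ _ nb) | apply: (perm3 _ _ _ _ _ nc) |
    apply: (perm3 _ _ _ _ _ nd)] => w; rewrite !inE => /or3P[]/eqP->; tauto.
split => //.
have R0 : orient b c d - orient a c d + orient a b d - orient a b c = 0.
  by rewrite /orient; ring.
have F1 s : 0 < s * orient b c d -> s * orient a c d < 0 -> 0 < s * orient a b d ->
    0 < s * orient a b c -> False.
  move=> h1 h2 h3 h4; apply: nd; apply: (hull_triangle h4); split; try exact: ltW.
  by rewrite orient_swap mulrN oppr_ge0 ltW.
have F2 s : s * orient b c d < 0 -> 0 < s * orient a c d -> 0 < s * orient a b d ->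
    0 < s * orient a b c -> False.
  move=> h1 h2 h3 h4; apply: nc; apply: (hull_triangle h3); split; first exact: ltW.
    by rewrite -orient_rot orient_swap -orient_rot orient_swap opprK -orient_rot orient_swap mulrN oppr_ge0 ltW.
  by rewrite orient_rot ltW.
have F3 s : 0 < s * orient b c d -> 0 < s * orient a c d -> 0 < s * orient a b d ->
    s * orient a b c < 0 -> False.
  move=> h1 h2 h3 h4; apply: nb; apply: (hull_triangle h2); split.
  - by rewrite orient_rot orient_swap -orient_rot mulrN oppr_ge0 -orient_rot orient_rot ltW.
  - by rewrite -orient_rot ltW.
  - by rewrite orient_rot ltW.
have F4 s : 0 < s * orient b c d -> 0 < s * orient a c d -> s * orient a b d < 0 ->
    0 < s * orient a b c -> False.
  move=> h1 h2 h3 h4; apply: na; apply: (hull_triangle h1); split.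
  - by rewrite -orient_rot ltW.
  - by rewrite -orient_rot ltW.
  - by rewrite orient_rot orient_swap mulrN oppr_ge0 ltW.
move: o1 o2 o3 o4 F1 F2 F3 F4 R0.
move: (orient b c d) (orient a c d) (orient a b d) (orient a b c) => w x y z.
move=> o1 o2 o3 o4 F1 F2 F3 F4 R0.
have [w0|w0|w0] := ltgtP 0 w; last by rewrite w0 eqxx in o1.
all: have [x0|x0|x0] := ltgtP 0 x; last by rewrite x0 eqxx in o2.
all: have [y0|y0|y0] := ltgtP 0 y; last by rewrite y0 eqxx in o3.
all: have [z0|z0|z0] := ltgtP 0 z; last by rewrite z0 eqxx in o4.
all: rewrite /convex_signs //=; exfalso.
all: first [lra | by apply: (F1 1); lra | by apply: (F2 1); lra
  | by apply: (F3 1); lra | by apply: (F4 1); lra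
  | by apply: (F1 (-1)); lra | by apply: (F2 (-1)); lra
  | by apply: (F3 (-1)); lra | by apply: (F4 (-1)); lra].
Qed.

Lemma small_hull4 a b c d : dist a b + dist b c + dist c d + dist d a < 4 ->
  small_hull [:: a; b; c; d].
Proof.
move=> L4.
have tab := dist_triangle a b c; have tbc := dist_triangle b c d.
have tcd := dist_triangle c d a; have tda := dist_triangle d a b.
have mem v p : v \in p -> hull p v by exact: hull_mem.
have [hd|nd] := pselect (hull [:: a; b; c] d).
  apply: (small_hull_sub (q := [:: a; b; c])).
    by move=> v; rewrite !inE => /or4P[]/eqP-> //; apply: mem; rewrite !inE eqxx ?orbT.
  by apply: small_hull3; rewrite (distC c a); move: tcd; rewrite (distC c a); lra.
have [hc|nc] := pselect (hull [:: a; b; d] c).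
  apply: (small_hull_sub (q := [:: a; b; d])).
    by move=> v; rewrite !inE => /or4P[]/eqP-> //; apply: mem; rewrite !inE eqxx ?orbT.
  by apply: small_hull3; lra.
have [hb|nb] := pselect (hull [:: a; c; d] b).
  apply: (small_hull_sub (q := [:: a; c; d])).
    by move=> v; rewrite !inE => /or4P[]/eqP-> //; apply: mem; rewrite !inE eqxx ?orbT.
  by apply: small_hull3; lra.
have [ha|na] := pselect (hull [:: b; c; d] a).
  apply: (small_hull_sub (q := [:: b; c; d])).
    by move=> v; rewrite !inE => /or4P[]/eqP-> //; apply: mem; rewrite !inE eqxx ?orbT.
  by apply: small_hull3; move: tda; rewrite (distC d b); lra.
have [n1 n2 n3 n4 sg] := four_signs na nb nc nd.
have G1 s : s = 1 \/ s = -1 -> 0 < s * orient b c d -> 0 < s * orient a c d ->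
    0 < s * orient a b d -> 0 < s * orient a b c -> small_hull [:: a; b; c; d].
  move=> hs h1 h2 h3 h4; apply: (small_convex4 hs) => //.
    by rewrite -orient_rot.
  by rewrite orient_rot.
have G2 s : s = 1 \/ s = -1 -> s * orient b c d < 0 -> s * orient a c d < 0 ->
    0 < s * orient a b d -> 0 < s * orient a b c -> small_hull [:: a; b; c; d].
  move=> hs h1 h2 h3 h4; apply: (@small_hull_sub _ _ [:: a; b; d; c]).
    by move=> v; rewrite !inE => /or4P[]/eqP->; apply: mem; rewrite !inE eqxx ?orbT.
  have bdc : 0 < s * orient b d c
    by rewrite (_ : orient b d c = - orient b c d) ?mulrN ?oppr_gt0 // /orient; ring.
  have dca : 0 < s * orient d c a
    by rewrite (_ : orient d c a = - orient a c d) ?mulrN ?oppr_gt0 // /orient; ring.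
  have cab : 0 < s * orient c a b
    by rewrite (_ : orient c a b = orient a b c) ?mulrN ?oppr_gt0 // /orient; ring.
  apply: (small_convex4 hs) => //.
  have := crossing_sides_shorter bdc dca cab h3.
  by rewrite (distC d c); lra.
have G3 s : s = 1 \/ s = -1 -> s * orient b c d < 0 -> 0 < s * orient a c d ->
    0 < s * orient a b d -> s * orient a b c < 0 -> small_hull [:: a; b; c; d].
  move=> hs h1 h2 h3 h4; apply: (@small_hull_sub _ _ [:: a; c; b; d]).
    by move=> v; rewrite !inE => /or4P[]/eqP->; apply: mem; rewrite !inE eqxx ?orbT.
  have acb : 0 < s * orient a c b
    by rewrite (_ : orient a c b = - orient a b c) ?mulrN ?oppr_gt0 // /orient; ring.
  have cbd : 0 < s * orient c b d
    by rewrite (_ : orient c b d = - orient b c d) ?mulrN ?oppr_gt0 // /orient; ring.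
  have bda : 0 < s * orient b d a
    by rewrite (_ : orient b d a = orient a b d) ?mulrN ?oppr_gt0 // /orient; ring.
  have dac : 0 < s * orient d a c
    by rewrite (_ : orient d a c = orient a c d) ?mulrN ?oppr_gt0 // /orient; ring.
  apply: (small_convex4 hs) => //.
  have := crossing_sides_shorter acb cbd bda dac.
  by rewrite (distC c b); lra.
move: n1 n2 n3 n4 sg G1 G2 G3.
move: (orient b c d) (orient a c d) (orient a b d) (orient a b c) => w x y z.
move=> n1 n2 n3 n4 sg G1 G2 G3.
move: sg; rewrite /convex_signs.
have [w0|w0|w0] := ltgtP 0 w; last by rewrite w0 eqxx in n1.
all: have [x0|x0|x0] := ltgtP 0 x; last by rewrite x0 eqxx in n2.
all: have [y0|y0|y0] := ltgtP 0 y; last by rewrite y0 eqxx in n3.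
all: have [z0|z0|z0] := ltgtP 0 z; last by rewrite z0 eqxx in n4.
all: rewrite //= => _.
all: have hp : (1 : R) = 1 \/ (1 : R) = -1 by left.
all: have hm : (-1 : R) = 1 \/ (-1 : R) = -1 by right.
all: first [by apply: (G1 _ hp); lra | by apply: (G2 _ hp); lra
  | by apply: (G3 _ hp); lra | by apply: (G1 _ hm); lra
  | by apply: (G2 _ hm); lra | by apply: (G3 _ hm); lra].
Qed.
End Signs.

(* Of the twelve cyclic orders of five points in convex position, all but one
   have two crossing sides. *)
Lemma pentagon_signs (abc abd abe acd ace ade bcd bce bde cde : bool) :
  convex_signs bcd acd abd abc -> convex_signs bce ace abe abc ->
  convex_signs bde ade abe abd -> convex_signs cde ade ace acd ->
  convex_signs cde bde bce bcd ->
  [|| all id [:: abc; abd; abe; acd; ace; ade; bcd; bce; bde; cde],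
    all negb [:: abc; abd; abe; acd; ace; ade; bcd; bce; bde; cde],
    (abc != abd) && (acd != bcd), (abd != abe) && (ade != bde),
    (bcd != bce) && (bde != cde), (bce != abc) && (abe != ace) |
    (cde != acd) && (ace != ade)].
Proof.
by case: abc; case: abd; case: abe; case: acd; case: ace; case: ade; case: bcd;
  case: bce; case: bde; case: cde.
Qed.

(** * Simple pentagons and quadrilaterals *)

Section SimplePolygons.
Context {R : realType}.
Local Notation plane := (R * R)%type.
Implicit Types (a b c d e u v w x y z : plane) (p q : seq plane) (s t k : R).

(** All ten triples are listed, because a pentagram also turns the same way at its five vertices. *)
Definition convex5 s a b c d e :=
  [/\ 0 < s * orient a b c, 0 < s * orient a b d, 0 < s * orient a b e,
      0 < s * orient a c d & 0 < s * orient a c e] /\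
  [/\ 0 < s * orient a d e, 0 < s * orient b c d, 0 < s * orient b c e,
      0 < s * orient b d e & 0 < s * orient c d e].

Lemma convex5_rot s a b c d e : convex5 s a b c d e -> convex5 s b c d e a.
Proof. by move=> [[? ? ? ? ?] [? ? ? ? ?]]; split; split=> //; rewrite -orient_rot. Qed.

Lemma segments_cross a b c d :
  orient a b c * orient a b d < 0 -> orient c d a * orient c d b < 0 ->
  exists s t, [/\ 0 <= s < 1, 0 <= t < 1 &
    (1 - s) *: a + s *: b = (1 - t) *: c + t *: d].
Proof.
have frac (x y : R) : x * y < 0 -> x - y != 0 /\ 0 <= x / (x - y) < 1.
  move=> xy; have [x0|x0] := ltP 0 x.
    have y0 : y < 0 by rewrite -(pmulr_rlt0 _ x0).
    have D : 0 < x - y by lra.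
    split; first exact: lt0r_neq0.
    by rewrite divr_ge0 ?ltW //= ltr_pdivrMr // mul1r; lra.
  have {}x0 : x < 0.
    by rewrite lt_neqAle x0 andbT; apply: contraTneq xy => ->; rewrite mul0r ltxx.
  have y0 : 0 < y by rewrite -(nmulr_rlt0 _ x0).
  have D : 0 < y - x by lra.
  have -> : x / (x - y) = - x / (y - x) by rewrite -mulrNN -invrN opprB.
  split; first by rewrite -opprB oppr_eq0 lt0r_neq0.
  by rewrite divr_ge0 ?oppr_ge0 ?ltW //= ltr_pdivrMr // mul1r; lra.
move=> /frac[D1 h1] /frac[D2 h2].
exists (orient c d a / (orient c d a - orient c d b)).
exists (orient a b c / (orient a b c - orient a b d)); split => //.
apply: pair_eq; rewrite /= /GRing.scale /=; move: D1 D2;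
  rewrite /orient => D1 D2; field; by rewrite D1 D2.
Qed.

Lemma simple_sides p i j s t : simple_polygon p -> (i < size p)%N -> (j < size p)%N ->
  i != j -> 0 <= s < 1 -> 0 <= t < 1 -> side_point p i s != side_point p j t.
Proof.
by move=> [_ sp] ip jp ij s1 t1; apply: contra ij => /eqP /(sp _ _ _ _ ip jp s1 t1)[->].
Qed.

Lemma simple_no_cross p i j (a := vertex p i) (b := vertex p i.+1)
    (c := vertex p j) (d := vertex p j.+1) : simple_polygon p ->
  (i < size p)%N -> (j < size p)%N -> i != j ->
  orient a b c * orient a b d < 0 -> orient c d a * orient c d b < 0 -> False.
Proof.
move=> sp ip jp ij h1 h2; have [s [t [s1 t1 E]]] := segments_cross h1 h2.
by have /eqP := simple_sides sp ip jp ij s1 t1; apply.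
Qed.

(** Every four of the vertices obey [four_signs]. By [pentagon_signs] the cyclic order is then
    convex, or one of the five pairs of nonadjacent sides crosses, against simplicity. *)
Lemma simple_pentagon_convex a b c d e : simple_polygon [:: a; b; c; d; e] ->
  ~ hull [:: b; c; d; e] a -> ~ hull [:: a; c; d; e] b ->
  ~ hull [:: a; b; d; e] c -> ~ hull [:: a; b; c; e] d ->
  ~ hull [:: a; b; c; d] e ->
  exists2 s, s = 1 \/ s = -1 & convex5 s a b c d e.
Proof.
move=> sp na nb nc nd ne.
have sub p q v : ~ hull q v -> {subset p <= q} -> ~ hull p v.
  by move=> n pq h; apply: n; apply: hull_subset h.
have [||||abcd1 abcd2 abcd3 abcd4 abcd] := @four_signs _ a b c d.
1-4: [> apply: sub na _ | apply: sub nb _ | apply: sub nc _ | apply: sub nd _];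
  by move=> v; rewrite !inE => /or3P[]->; rewrite ?orbT.
have [||||abce1 abce2 abce3 abce4 abce] := @four_signs _ a b c e.
1-4: [> apply: sub na _ | apply: sub nb _ | apply: sub nc _ | apply: sub ne _];
  by move=> v; rewrite !inE => /or3P[]->; rewrite ?orbT.
have [||||abde1 abde2 abde3 abde4 abde] := @four_signs _ a b d e.
1-4: [> apply: sub na _ | apply: sub nb _ | apply: sub nd _ | apply: sub ne _];
  by move=> v; rewrite !inE => /or3P[]->; rewrite ?orbT.
have [||||acde1 acde2 acde3 acde4 acde] := @four_signs _ a c d e.
1-4: [> apply: sub na _ | apply: sub nc _ | apply: sub nd _ | apply: sub ne _];
  by move=> v; rewrite !inE => /or3P[]->; rewrite ?orbT.
have [||||bcde1 bcde2 bcde3 bcde4 bcde] := @four_signs _ b c d e.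
1-4: [> apply: sub nb _ | apply: sub nc _ | apply: sub nd _ | apply: sub ne _];
  by move=> v; rewrite !inE => /or3P[]->; rewrite ?orbT.
have opp (x y : R) : x != 0 -> y != 0 -> (0 < x) != (0 < y) -> x * y < 0.
  move=> x0 y0; have [x1|x1|x1] := ltgtP 0 x; last by rewrite x1 eqxx in x0.
    by have [y1|y1|y1] := ltgtP 0 y; rewrite // ?pmulr_rlt0 // y1 eqxx in y0 *.
  by have [y1|y1|y1] := ltgtP 0 y; rewrite // ?nmulr_rlt0 // y1 eqxx in y0 *.
have neg (x : R) : x != 0 -> ~~ (0 < x) -> 0 < -1 * x.
  by move=> x0; rewrite -leNgt le_eqVlt (negbTE x0) mulN1r oppr_gt0.
have cross (i j : nat) (w x y z : R) : [/\ (i < 5)%N, (j < 5)%N & i != j] ->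
    w != 0 -> x != 0 -> y != 0 -> z != 0 -> 
    ((0 < w) != (0 < x)) && ((0 < y) != (0 < z)) ->
    (w, x, y, z) = (orient (vertex [:: a; b; c; d; e] i) (vertex [:: a; b; c; d; e] i.+1)
        (vertex [:: a; b; c; d; e] j),
      orient (vertex [:: a; b; c; d; e] i) (vertex [:: a; b; c; d; e] i.+1)
        (vertex [:: a; b; c; d; e] j.+1),
      orient (vertex [:: a; b; c; d; e] j) (vertex [:: a; b; c; d; e] j.+1)
        (vertex [:: a; b; c; d; e] i),
      orient (vertex [:: a; b; c; d; e] j) (vertex [:: a; b; c; d; e] j.+1)
        (vertex [:: a; b; c; d; e] i.+1)) -> False.
  move=> [i5 j5 ij] w0 x0 y0 z0 /andP[h1 h2] [E1 E2 E3 E4].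
  by apply: (simple_no_cross sp i5 j5 ij); rewrite -?E1 -?E2 -?E3 -?E4; apply: opp.
have /orP[|/orP[|/orP[|/orP[|/orP[|/orP[]]]]]] := pentagon_signs abcd abce abde acde bcde.
- move=> /= /and5P[h1 h2 h3 h4 /and5P[h5 h6 h7 h8 /and3P[h9 h10 _]]].
  by exists 1; [left | split; rewrite !mul1r].
- move=> /= /and5P[h1 h2 h3 h4 /and5P[h5 h6 h7 h8 /and3P[h9 h10 _]]].
  by exists (-1); [right | split; split; apply: neg].
- by move/(cross 0%N 2%N _ _ _ _)=> H; exfalso; apply: H => //; rewrite /vertex /=;
    congr (_, _, _, _); rewrite /orient; ring.
- by move/(cross 0%N 3%N _ _ _ _)=> H; exfalso; apply: H => //; rewrite /vertex /=;
    congr (_, _, _, _); rewrite /orient; ring.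
- by move/(cross 1%N 3%N _ _ _ _)=> H; exfalso; apply: H => //; rewrite /vertex /=;
    congr (_, _, _, _); rewrite /orient; ring.
- by move/(cross 1%N 4%N _ _ _ _)=> H; exfalso; apply: H => //; rewrite /vertex /=;
    congr (_, _, _, _); rewrite /orient; ring.
- by move/(cross 2%N 4%N _ _ _ _)=> H; exfalso; apply: H => //; rewrite /vertex /=;
    congr (_, _, _, _); rewrite /orient; ring.
Qed.

Definition disjoint_sides a b c d := forall s t, 0 <= s < 1 -> 0 <= t < 1 ->
  (1 - s) *: a + s *: b <> (1 - t) *: c + t *: d.

Definition simple4 a b c d :=
  [/\ disjoint_sides a b b c, disjoint_sides a b c d & disjoint_sides a b d a] /\
  [/\ disjoint_sides b c c d, disjoint_sides b c d a & disjoint_sides c d d a].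

Lemma disjoint_sidesC a b c d : disjoint_sides a b c d -> disjoint_sides c d a b.
Proof. by move=> D s t s1 t1 /esym; apply: D. Qed.

Lemma simple4_rot a b c d : simple4 a b c d -> simple4 b c d a.
Proof. by move=> [[h1 h2 h3] [h4 h5 h6]]; split; split=> //; apply: disjoint_sidesC. Qed.

Lemma simple_polygon4 a b c d : simple_polygon [:: a; b; c; d] -> simple4 a b c d.
Proof.
move=> sp.
have D i j : [/\ (i < 4)%N, (j < 4)%N & i != j] ->
    disjoint_sides (vertex [:: a; b; c; d] i) (vertex [:: a; b; c; d] i.+1)
      (vertex [:: a; b; c; d] j) (vertex [:: a; b; c; d] j.+1).
  by move=> [i4 j4 ij] s t s1 t1; apply/eqP; apply: (simple_sides sp i4 j4 ij s1 t1).
by split; split; [exact: (D 0 1)%N | exact: (D 0 2)%N | exact: (D 0 3)%N |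
  exact: (D 1 2)%N | exact: (D 1 3)%N | exact: (D 2 3)%N].
Qed.

Lemma disjoint_sides_neq a b c d : disjoint_sides a b c d -> a <> c.
Proof.
move=> D ac; apply: (D 0 0); rewrite ?lexx ?ltr01 //.
by rewrite !subr0 !scale1r !scale0r !addr0.
Qed.

Lemma straight_vertex a b c d : simple4 a b c d -> orient a b c = 0 ->
  exists2 t, 0 < t < 1 & b = (1 - t) *: a + t *: c.
Proof.
move=> [[ab_bc ab_cd ab_da] [bc_cd bc_da cd_da]].
have ab := disjoint_sides_neq ab_bc; have ac := disjoint_sides_neq ab_cd.
have bc := disjoint_sides_neq bc_cd.
have z1 : 0 <= (0 : R) < 1 by rewrite lexx ltr01.
have at0 x y : (1 - 0) *: x + 0 *: y = x by rewrite subr0 scale1r scale0r addr0.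
have at1 x y : (1 - 1) *: x + 1 *: y = y by rewrite subrr scale1r scale0r add0r.
case/collinear_on_segment => [] [t /andP[t0]]; rewrite le_eqVlt => /predU1P[->|t1].
- by rewrite at1.
- by move=> E; case: (ab_bc 0 t z1); rewrite ?t0 // at0.
- by rewrite at1 => /bc.
- move: t0; rewrite le_eqVlt => /predU1P[<-|t0]; first by rewrite at0 => /esym/ab.
  by exists t; rewrite // t0.
- by rewrite at1 => /esym/bc.
- by move=> E; case: (ab_cd t 0); rewrite ?t0 // at0.
Qed.

(** A straight angle at [b] puts [b] strictly between [a] and [c], so the diagonal from [b] cuts the
    triangle [a c d] in two. This settles the vanishing orientations in [inner_diagonal]. *)
Lemma straight_quadrilateral a b c d : simple4 a b c d -> orient a b c = 0 ->
  0 < orient a b d * orient b c d.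
Proof.
move=> sp o0; have [t /andP[t0 t1] bE] := straight_vertex sp o0.
have E1 : orient a b d = t * orient a c d.
  by rewrite bE /orient /= /GRing.scale /=; ring.
have E2 : orient b c d = (1 - t) * orient a c d.
  by rewrite bE /orient /= /GRing.scale /=; ring.
have [q2|q2] := eqVneq (orient a c d) 0; last first.
  rewrite E1 E2 mulrACA -expr2 pmulr_rgt0; last by rewrite mulr_gt0 // subr_gt0.
  by rewrite lt_neqAle sqr_ge0 eq_sym sqrf_eq0 q2.
have sp1 := simple4_rot sp; have sp2 := simple4_rot sp1.
have [u /andP[u0 u1] dE] : exists2 u, 0 < u < 1 & d = (1 - u) *: c + u *: a.
  by apply: (straight_vertex sp2); rewrite -orient_rot.
have [w /andP[w0 w1] cE] : exists2 w, 0 < w < 1 & c = (1 - w) *: b + w *: d.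
  by apply: (straight_vertex sp1); rewrite E2 q2 mulr0.
(* If [d] lay on the line too, then [b], [c] and [d] would each lie strictly between their
   neighbours. Substituting [b] and [d] into the expression for [c] leaves a combination of [a] and
   [c] in which [c] has weight less than 1, so [a = c]. *)
have lam : (1 - w) * t + w * (1 - u) - 1 != 0.
  apply: ltr0_neq0.
  have h1 : 0 < (1 - w) * (1 - t) by rewrite mulr_gt0 // subr_gt0.
  have h2 : 0 < w * u by rewrite mulr_gt0.
  lra.
have ac : a = c.
  have c1 : c.1 = (1 - w) * ((1 - t) * a.1 + t * c.1) + w * ((1 - u) * c.1 + u * a.1).
    by rewrite {1}cE {1}bE {1}dE.
  have c2 : c.2 = (1 - w) * ((1 - t) * a.2 + t * c.2) + w * ((1 - u) * c.2 + u * a.2).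
    by rewrite {1}cE {1}bE {1}dE.
  apply: pair_eq; apply: (mulfI lam).
    by rewrite -[RHS]subr0 -(subrr c.1) {2}c1; ring.
  by rewrite -[RHS]subr0 -(subrr c.2) {2}c2; ring.
by case: sp => [[_ /disjoint_sides_neq + _] _].
Qed.

(** A positive product means that the two triangles on a diagonal have the same orientation, hence
    lie on opposite sides of it. The four strict sign patterns in which neither diagonal qualifies
    are those of a quadrilateral with two opposite sides crossing. *)
Lemma inner_diagonal a b c d : simple_polygon [:: a; b; c; d] ->
  0 < orient a b d * orient b c d \/ 0 < orient a b c * orient a c d.
Proof.
move=> sp; have q0 := simple_polygon4 sp.
have q1 := simple4_rot q0; have q2 := simple4_rot q1; have q3 := simple4_rot q2.
have e1 : orient c d a = orient a c d by rewrite -orient_rot.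
have e2 : orient d a b = orient a b d by rewrite orient_rot.
have e3 : orient b c a = orient a b c by rewrite -orient_rot.
have e4 : orient c d b = orient b c d by rewrite -orient_rot.
have e5 : orient d a c = orient a c d by rewrite orient_rot.
have z1 := straight_quadrilateral q1; have z2 := straight_quadrilateral q2.
have z3 := straight_quadrilateral q3; have z4 := straight_quadrilateral q0.
have x1 := @simple_no_cross _ 0%N 2%N sp isT isT isT.
have x2 := @simple_no_cross _ 1%N 3%N sp isT isT isT.
move: z1 z2 z3 z4 x1 x2; rewrite /vertex /= e1 e2 e3 e4 e5.
have : orient b c d - orient a c d + orient a b d - orient a b c = 0.
  by rewrite /orient; ring.
move: (orient b c d) (orient a c d) (orient a b d) (orient a b c) => w x y z E.
move=> z1 z2 z3 z4 x1 x2.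
have [w0|w0|w0] := ltgtP 0 w; last by right; rewrite mulrC mulrC; apply: z1.
all: have [x0|x0|x0] := ltgtP 0 x; last by left; rewrite mulrC; apply: z2.
all: have [y0|y0|y0] := ltgtP 0 y; last by right; rewrite mulrC; apply: z3.
all: have [h0|h0|h0] := ltgtP 0 z; last by left; apply: z4.
all: first [exfalso; lra | by left; nra | by right; nra
  | by exfalso; apply: x1; nra | by exfalso; apply: x2; nra].
Qed.

End SimplePolygons.

(** * Regions *)

Section Topology.
Context {R : realType}.
Local Notation plane := (R * R)%type.
Implicit Types (a b c d e u v w x y z : plane) (p q : seq plane) (s t k : R).

Lemma mem_vertex p i : (0 < size p)%N -> vertex p i \in p.
Proof. by move=> p0; rewrite mem_nth // ltn_mod. Qed.

Lemma boundary_hull p : (0 < size p)%N -> boundary p `<=` hull p.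
Proof.
move=> p0 x [i _ [t]]; rewrite /= in_itv /= => t01 <-.
have /hull_sub : forall v, v \in [:: vertex p i; vertex p i.+1] -> hull p v.
  by move=> v; rewrite !inE => /orP[]/eqP->; apply/hull_mem/mem_vertex.
by apply; apply: hull_segment.
Qed.

Lemma line_continuous x w : continuous (fun t : R => x + t *: w).
Proof.
by move=> t; apply: cvgD; [exact: cvg_cst | apply: cvgZr_tmp; exact: cvg_id].
Qed.

Lemma line_connected x w (i : interval R) :
  connected ((fun t : R => x + t *: w) @` [set` i]).
Proof.
apply: connected_continuous_connected; last exact/continuous_subspaceT/line_continuous.
by apply/connected_intervalP; exact: interval_is_interval.
Qed.

Lemma bounded_setP (A : set plane) : bounded_set A <->
  exists M, forall x, A x -> `|x.1| <= M /\ `|x.2| <= M.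
Proof.
split.
  move=> [M [_ hM]]; exists (M + 1) => x Ax.
  have := hM (M + 1) _ x Ax; rewrite ltrDl ltr01 => /(_ isT).
  by rewrite /Num.Def.normr /= ge_max => /andP.
move=> [M hM]; exists M; split; first exact: num_real.
move=> N MN x /hM[h1 h2]; rewrite /Num.Def.normr /= ge_max.
by rewrite (le_trans h1) ?(le_trans h2) // ltW.
Qed.

Lemma coordinates_bound p : exists M, forall v, v \in p -> `|v.1| <= M /\ `|v.2| <= M.
Proof.
elim: p => [|v p [M hM]]; first by exists 0.
exists (`|v.1| + `|v.2| + `|M|) => w; rewrite inE => /predU1P[->|/hM[h1 h2]].
  have := normr_ge0 M; have := normr_ge0 v.1; have := normr_ge0 v.2; lra.
have := ler_norm M; have := normr_ge0 v.1; have := normr_ge0 v.2; lra.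
Qed.

Lemma hull_bounded p : bounded_set (hull p).
Proof.
have [M hM] := coordinates_bound p; apply/bounded_setP; exists M => x px.
have d1 (u v : plane) : dot u v = u.1 * v.1 + u.2 * v.2 by [].
split; rewrite ler_norml; apply/andP; split.
- have := px (1, 0) (- M); rewrite d1 /= mul1r mul0r addr0; apply => v /hM[+ _].
  by rewrite d1 /= mul1r mul0r addr0 ler_norml => /andP[].
- rewrite -lerN2; have := px (-1, 0) (- M); rewrite d1 /= mulN1r mul0r addr0; apply => v /hM[+ _].
  by rewrite d1 /= mulN1r mul0r addr0 lerN2 ler_norml => /andP[].
- have := px (0, 1) (- M); rewrite d1 /= mul1r mul0r add0r; apply => v /hM[_].
  by rewrite d1 /= mul1r mul0r add0r ler_norml => /andP[].
- rewrite -lerN2; have := px (0, -1) (- M); rewrite d1 /= mulN1r mul0r add0r; apply => v /hM[_].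
  by rewrite d1 /= mulN1r mul0r add0r lerN2 ler_norml => /andP[].
Qed.

Lemma ray_unbounded x w : w != 0 ->
  ~ bounded_set ((fun t : R => x + t *: w) @` `[0, +oo[).
Proof.
move=> w0 /bounded_setP[M hM].
have key (y v : R) : v != 0 -> (forall t, 0 <= t -> `|y + t * v| <= M) -> False.
  move=> v0 H; have M0 : 0 <= M by apply: le_trans (H 0 (lexx _)); exact: normr_ge0.
  pose t := (M + `|y| + 1) / `|v|.
  have vp : 0 < `|v| by rewrite normr_gt0.
  have t0 : 0 <= t by rewrite divr_ge0 ?addr_ge0.
  have := H t t0; have := ler_normB (y + t * v) y.
  rewrite addrC addKr normrM (ger0_norm t0) /t divfK ?gt_eqF //; lra.
have [w1|w1] := eqVneq w.1 0.
  have w2 : w.2 != 0.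
    by apply: contra w0 => /eqP w2; apply/eqP; apply: pair_eq.
  apply: (key x.2 _ w2) => t t0.
  have [_] : _ /\ _ := hM (x + t *: w) ltac:(by exists t => //; rewrite /= in_itv /= t0).
  by [].
apply: (key x.1 _ w1) => t t0.
have [+ _] : _ /\ _ := hM (x + t *: w) ltac:(by exists t => //; rewrite /= in_itv /= t0).
by [].
Qed.

Lemma bounded_subset (A B : set plane) : A `<=` B -> bounded_set B -> bounded_set A.
Proof.
move=> AB /bounded_setP[M hM]; apply/bounded_setP; exists M => x /AB.
exact: hM.
Qed.

(** The ray is connected and unbounded, and lies in the component of its origin. This is the tool
    for bounding regions from outside. *)
Lemma ray_not_inside p x w : w != 0 ->
  (forall t, 0 <= t -> ~ boundary p (x + t *: w)) -> ~ inside p x.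
Proof.
move=> w0 ray [nb bc]; apply: (ray_unbounded (x := x) w0).
apply: bounded_subset bc; apply: connected_component_max.
- by exists 0; rewrite /= ?in_itv /= ?lexx // scale0r addr0.
- by move=> _ [t /= + <-]; rewrite in_itv /= andbT; exact: ray.
- exact: line_connected.
Qed.

(** From a point beyond a supporting half-plane, the ray pointing away from this half-plane never
    meets the boundary. *)
Lemma region_hull p : (0 < size p)%N -> region p `<=` hull p.
Proof.
move=> p0 x [ix|]; last exact: boundary_hull.
move=> u k pk; rewrite leNgt; apply/negP => xk.
have u0 : - u != 0.
  rewrite oppr_eq0; apply/eqP => u0; move: xk (pk _ (mem_vertex 0 p0)).
  by rewrite u0 /dot /= !mul0r addr0; lra.
case: (ray_not_inside (x := x) u0 _ ix) => t t0 /(boundary_hull p0)/(_ u k pk).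
have -> : dot u (x + t *: - u) = dot u x - t * dot u u.
  by rewrite /dot /= /GRing.scale /=; ring.
have : 0 <= t * dot u u by rewrite mulr_ge0 // addr_ge0 // sqr_ge0.
lra.
Qed.

Lemma boundary_closed p : closed (boundary p).
Proof.
apply: closed_bigcup; first exact: finite_II.
move=> i _; apply: compact_closed; first exact: norm_hausdorff.
apply: continuous_compact; last exact: segment_compact.
apply: continuous_subspaceT.
have -> : side_point p i = fun t => vertex p i + t *: (vertex p i.+1 - vertex p i).
  by apply/funext => t; rewrite /side_point scalerBl scale1r scalerBr addrAC addrA.
exact: line_continuous.
Qed.

Lemma segment_component (A : set plane) x w t : 0 <= t ->
  (forall r, 0 <= r <= t -> A (x + r *: w)) -> connected_component A x (x + t *: w).
Proof.
move=> t0 hA; apply: (@connected_component_max _ _ ((fun r : R => x + r *: w) @` `[0, t])).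
- by exists 0; rewrite /= ?in_itv /= ?lexx // scale0r addr0.
- by move=> _ [r + <-]; rewrite /= in_itv /=; exact: hA.
- exact: line_connected.
- by exists t; rewrite /= ?in_itv /= ?t0 ?lexx.
Qed.

(* Only arbitrarily small [t] are required, not all small [t], so that the
   predicate distributes over finite unions of regions. *)
Definition points_into (S : set plane) v d :=
  forall r, 0 < r -> exists2 t, 0 < t < r & S (v + t *: d).

(** If [v] is off the boundary, a short segment from [v] along [d] avoids the boundary too, so [v]
    is in the same component as a point of the region on it. *)
Lemma region_closed_along p v d : points_into (region p) v d -> region p v.
Proof.
move=> into; have [bv|nbv] := pselect (boundary p v); first by right.
left; split => //.
have /(_ v nbv)/nbhs_ballP[e /= e0 be] : open (~` boundary p).
  exact/closed_openC/boundary_closed.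
have [r r0 hr] : exists2 r, 0 < r & forall t, 0 <= t < r -> ~ boundary p (v + t *: d).
  exists (e / (`|d| + 1)); first by rewrite divr_gt0 // ltr_wpDl.
  move=> t /andP[t0 tr]; apply: be; rewrite -ball_normE /= opprD addNKr normrN normrZ.
  rewrite ger0_norm //; apply: le_lt_trans (_ : t * (`|d| + 1) < e).
    by rewrite ler_wpM2l // lerDl.
  by rewrite -ltr_pdivlMr // ltr_wpDl.
have [t /andP[t0 tr] [[_ bt]|bt]] := into r r0; last by case: (hr t) => //; rewrite (ltW t0).
rewrite (@same_connected_component _ _ _ (v + t *: d)) //.
apply: segment_component; first exact: ltW.
by move=> u /andP[u0 ut]; apply: hr; rewrite u0 (le_lt_trans ut).
Qed.

Lemma area_region_small p : (0 < size p)%N -> small_hull p -> area p <> 1%E.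
Proof.
move=> p0 [A A1 hA] ap; have := area_at_mostP (area_at_mostS (region_hull p0) hA).
by rewrite -/(area p) ap lee_fin leNgt A1.
Qed.

End Topology.

(** * Convexity and wide angles of efficient pentagons *)

Section Pentagons.
Context {R : realType}.
Local Notation plane := (R * R)%type.
Local Notation dist := euclidean_dist.
Implicit Types (a b c d e u v w x y z : plane) (p q : seq plane) (s t k : R).

Lemma perimeter5E a b c d e : perimeter [:: a; b; c; d; e] = perimeter5 a b c d e.
Proof. by rewrite /perimeter !big_ord_recl big_ord0 /vertex /perimeter5 /= !addrA addr0. Qed.

Lemma shoelace5_rot a b c d e : shoelace5 a b c d e = shoelace5 b c d e a.
Proof. by rewrite /shoelace5 /orient; ring. Qed.

Lemma perimeter5_rot a b c d e : perimeter5 a b c d e = perimeter5 b c d e a.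
Proof. by rewrite /perimeter5; ring. Qed.

Lemma hull_convex5 s a b c d e x : convex5 s a b c d e -> hull [:: a; b; c; d; e] x ->
  0 <= s * orient a b x.
Proof.
move=> [[h1 h2 h3 h4 h5] [h6 h7 h8 h9 h10]] hx; apply: hull_orient hx _ => v.
have e1 y z : s * orient y z y = 0 by rewrite /orient; ring.
have e2 y z : s * orient y z z = 0 by rewrite /orient; ring.
by rewrite !inE => /orP[/eqP->|/or4P[]/eqP->]; rewrite ?e1 ?e2 // ltW.
Qed.

Lemma hull_rot5 a b c d e : hull [:: a; b; c; d; e] `<=` hull [:: b; c; d; e; a].
Proof.
apply: hull_subset => v; rewrite !inE => /orP[->|/or4P[]->]; by rewrite ?orbT.
Qed.

Definition closed5 s a b c d e : set plane :=
  [set x | [/\ 0 <= s * orient a b x, 0 <= s * orient b c x, 0 <= s * orient c d x,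
    0 <= s * orient d e x & 0 <= s * orient e a x]].

Lemma hull_closed5 s a b c d e : convex5 s a b c d e ->
  hull [:: a; b; c; d; e] `<=` closed5 s a b c d e.
Proof.
move=> h1 x x1; have h2 := convex5_rot h1; have x2 := hull_rot5 x1.
have h3 := convex5_rot h2; have x3 := hull_rot5 x2.
have h4 := convex5_rot h3; have x4 := hull_rot5 x3.
have h5 := convex5_rot h4; have x5 := hull_rot5 x4.
by split; [exact: hull_convex5 h1 x1 | exact: hull_convex5 h2 x2 |
  exact: hull_convex5 h3 x3 | exact: hull_convex5 h4 x4 | exact: hull_convex5 h5 x5].
Qed.

(** This fan of three triangles serves for the hull, for the area and for the count of directions
    entering a pentagon. *)
Lemma closed5_fan s a b c d e : convex5 s a b c d e ->
  closed5 s a b c d e `<=`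
    triangle s a b e `|` (triangle s b c d `|` triangle s b d e).
Proof.
move=> cv x [i1 i2 i3 i4 i5].
have [h|/ltW h] := leP 0 (s * orient b e x); first by left.
have eb : 0 <= s * orient e b x.
  rewrite (_ : orient e b x = - orient b e x) ?mulrN ?oppr_ge0 // /orient; ring.
have [h'|/ltW h'] := leP 0 (s * orient b d x); first by right; right.
right; left; split => //.
by rewrite (_ : orient d b x = - orient b d x) ?mulrN ?oppr_ge0 // /orient; ring.
Qed.

Lemma closed5_hull s a b c d e : convex5 s a b c d e ->
  closed5 s a b c d e `<=` hull [:: a; b; c; d; e].
Proof.
move=> cv; have [[h1 h2 h3 h4 h5] [h6 h7 h8 h9 h10]] := cv.
move=> x /(closed5_fan cv)[|[]] /hull_triangle.
- by move=> /(_ h3); apply: hull_subset => v; rewrite !inE => /or3P[]->; rewrite ?orbT.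
- by move=> /(_ h7); apply: hull_subset => v; rewrite !inE => /or3P[]->; rewrite ?orbT.
- by move=> /(_ h9); apply: hull_subset => v; rewrite !inE => /or3P[]->; rewrite ?orbT.
Qed.

Lemma area_convex5 s a b c d e : s = 1 \/ s = -1 -> convex5 s a b c d e ->
  area_at_most (hull [:: a; b; c; d; e]) (s * shoelace5 a b c d e / 2).
Proof.
move=> hs cv; have [[h1 h2 h3 h4 h5] [h6 h7 h8 h9 h10]] := cv.
apply: area_at_mostS (subset_trans (hull_closed5 cv) (closed5_fan cv)) _.
have -> : s * shoelace5 a b c d e / 2 = s * orient a b e / 2 +
    (s * orient b c d / 2 + s * orient b d e / 2) by rewrite /shoelace5; field.
by apply: area_at_mostU; [|apply: area_at_mostU]; apply: area_triangle.
Qed.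

(* An angle with cosine less than 7/25 is larger than 73 degrees, hence larger
   than the 72 degrees at which five corners would fit around a vertex. *)
Definition wide_corner u v w := dot (v - u) (w - u) < 7 / 25 * (dist u v * dist u w).

Lemma wide_corner_convex5 s a b c d e : s = 1 \/ s = -1 -> convex5 s a b c d e ->
  2 <= s * shoelace5 a b c d e -> perimeter5 a b c d e ^+ 2 < 15 ->
  wide_corner a b e.
Proof.
move=> hs [[h1 h2 h3 h4 h5] [h6 h7 h8 h9 h10]] A2 L15; rewrite /wide_corner.
case: hs => s1; rewrite s1 in h1 h2 h3 h4 h5 h6 h7 h8 h9 h10 A2.
  rewrite (distC a e); apply: (@efficient_corner_angle _ a b c d e) => //.
    by rewrite !mul1r in h7 h9; rewrite ltW // addr_gt0.
  by rewrite mul1r in A2.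
(* A clockwise pentagon is read backwards from [a]. *)
have -> : dot (b - a) (e - a) = dot (e - a) (b - a) by rewrite /dot; ring.
rewrite [dist a b * _]mulrC (distC a b); apply: (@efficient_corner_angle _ a e d c b).
- have -> : orient e d c = - orient c d e by rewrite /orient; ring.
  have -> : orient e c b = - orient b c e by rewrite /orient; ring.
  by rewrite !mulN1r in h8 h10; rewrite ltW // addr_gt0.
- suff -> : shoelace5 a e d c b = -1 * shoelace5 a b c d e by [].
  by rewrite /shoelace5 /orient; ring.
- suff -> : perimeter5 a e d c b = perimeter5 a b c d e by [].
  rewrite /perimeter5 (distC a e) (distC e d) (distC d c) (distC c b) (distC b a); ring.
Qed.

(** The value is 8 + 4 sqrt 3, and sqrt 3 is less than 7/4. *)
Lemma efficient_perimeter_sqr : (2 * Num.sqrt (2 + Num.sqrt 3)) ^+ 2 < 15 :> R.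
Proof.
have s3 : Num.sqrt 3 < 7 / 4 :> R.
  have h : (7 / 4 : R) = Num.sqrt ((7 / 4) ^+ 2) by rewrite sqrtr_sqr ger0_norm.
  rewrite h ltr_sqrt; lra.
have s0 : 0 <= Num.sqrt 3 :> R by exact: sqrtr_ge0.
by rewrite exprMn sqr_sqrtr; lra.
Qed.

Lemma efficient_pentagon_shape p : efficient_pentagon p ->
  exists a b c d e s, [/\ p = [:: a; b; c; d; e], s = 1 \/ s = -1,
    convex5 s a b c d e &
    [/\ wide_corner a b e, wide_corner b c a, wide_corner c d b,
        wide_corner d e c & wide_corner e a d]].
Proof.
case: p => [|a [|b [|c [|d [|e [|? ?]]]]]] [sp //= _ ap per].
exists a, b, c, d, e; rewrite perimeter5E in per.
have L0 : 0 <= perimeter5 a b c d e by rewrite /perimeter5 !addr_ge0 // dist_ge0.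
have L15 : perimeter5 a b c d e ^+ 2 < 15.
  apply: le_lt_trans efficient_perimeter_sqr.
  by apply: lerXn2r => //; rewrite nnegrE // mulr_ge0 // sqrtr_ge0.
have L4 : perimeter5 a b c d e < 4.
  by rewrite -(@ltr_pXn2r _ 2) ?nnegrE //; apply: lt_trans L15 _; lra.
have notsmall q : small_hull q -> (forall v, v \in [:: a; b; c; d; e] -> hull q v) -> False.
  by move=> sq pq; apply: (@area_region_small _ [:: a; b; c; d; e]); [|exact: small_hull_sub sq|].
have mem v q : v \in q -> hull q v by exact: hull_mem.
move: (L4); rewrite /perimeter5 => L4'.
(* By the triangle inequality, omitting a vertex does not lengthen the closed path, so the four
   others still have a perimeter below 4 and a hull too small for unit area. *)
have [||||| s hs cv] := simple_pentagon_convex sp.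
- move=> h; apply: (notsmall [:: b; c; d; e]).
    by apply: small_hull4; have := dist_triangle e a b; lra.
  by move=> v; rewrite inE => /predU1P[->//|/mem].
- move=> h; apply: (notsmall [:: a; c; d; e]).
    by apply: small_hull4; have := dist_triangle a b c; lra.
  by move=> v; rewrite !inE => /orP[|/or4P[]] /eqP-> //; apply: mem; rewrite !inE eqxx ?orbT.
- move=> h; apply: (notsmall [:: a; b; d; e]).
    by apply: small_hull4; have := dist_triangle b c d; lra.
  by move=> v; rewrite !inE => /orP[|/or4P[]] /eqP-> //; apply: mem; rewrite !inE eqxx ?orbT.
- move=> h; apply: (notsmall [:: a; b; c; e]).
    by apply: small_hull4; have := dist_triangle c d e; lra.
  by move=> v; rewrite !inE => /orP[|/or4P[]] /eqP-> //; apply: mem; rewrite !inE eqxx ?orbT.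
- move=> h; apply: (notsmall [:: a; b; c; d]).
    by apply: small_hull4; have := dist_triangle d e a; lra.
  by move=> v; rewrite !inE => /orP[|/or4P[]] /eqP-> //; apply: mem; rewrite !inE eqxx ?orbT.
exists s; split => //.
(* The region lies in the hull, whose area is at most half of the shoelace sum; unit area bounds
   that sum from below. *)
have A2 : 2 <= s * shoelace5 a b c d e.
  have hull_area := area_at_mostS (@region_hull _ [:: a; b; c; d; e] isT) (area_convex5 hs cv).
  have := area_at_mostP hull_area.
  by rewrite -/(area _) ap lee_fin; lra.
have cv2 := convex5_rot cv; have cv3 := convex5_rot cv2.
have cv4 := convex5_rot cv3; have cv5 := convex5_rot cv4.
have S2 := A2; rewrite shoelace5_rot in S2; have S3 := S2; rewrite shoelace5_rot in S3.
have S4 := S3; rewrite shoelace5_rot in S4; have S5 := S4; rewrite shoelace5_rot in S5.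
have L2 := L15; rewrite perimeter5_rot in L2; have L3 := L2; rewrite perimeter5_rot in L3.
have L6 := L3; rewrite perimeter5_rot in L6; have L7 := L6; rewrite perimeter5_rot in L7.
by split; [exact: wide_corner_convex5 hs cv A2 L15 | exact: wide_corner_convex5 hs cv2 S2 L2
  | exact: wide_corner_convex5 hs cv3 S3 L3 | exact: wide_corner_convex5 hs cv4 S4 L6
  | exact: wide_corner_convex5 hs cv5 S5 L7].
Qed.

End Pentagons.

(** * At most four wide corners fit around a vertex *)

Section FifthTurn.
Context {R : realType}.
Local Notation plane := (R * R)%type.
Implicit Types (u v w x y z : plane) (s t k : R).

Definition cross u v : R := u.1 * v.2 - u.2 * v.1.

(* cos (2 pi / 5) and sin (2 pi / 5) *)
Definition cos5 : R := (Num.sqrt 5 - 1) / 4.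
Definition sin5 : R := Num.sqrt (1 - cos5 ^+ 2).

Lemma cos5_eq : 4 * cos5 ^+ 2 + 2 * cos5 = 1.
Proof.
have : Num.sqrt 5 ^+ 2 = 5 :> R by rewrite sqr_sqrtr.
rewrite /cos5; move: (Num.sqrt 5 : R) => r r2.
have -> : 4 * ((r - 1) / 4) ^+ 2 + 2 * ((r - 1) / 4) = (r ^+ 2 - 1) / 4 by field.
by rewrite r2; field.
Qed.

Lemma cos5_gt : 7 / 25 < cos5.
Proof.
suff : 53 / 25 < Num.sqrt 5 :> R by rewrite /cos5; lra.
have h : (53 / 25 : R) = Num.sqrt ((53 / 25) ^+ 2) by rewrite sqrtr_sqr ger0_norm.
by rewrite h ltr_sqrt; lra.
Qed.

Lemma cos5_gt0 : 0 < cos5. Proof. by have := cos5_gt; lra. Qed.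

Lemma cos5_lt1 : cos5 < 1.
Proof. by have := cos5_eq; have := cos5_gt; nra. Qed.

Lemma sin5_sqr : sin5 ^+ 2 = 1 - cos5 ^+ 2.
Proof. by rewrite sqr_sqrtr //; have := cos5_gt0; have := cos5_lt1; nra. Qed.

Lemma sin5_gt0 : 0 < sin5.
Proof. by rewrite sqrtr_gt0; have := cos5_gt0; have := cos5_lt1; nra. Qed.

(** The tangent of 72 degrees is less than 24/7, the tangent of the angle with cosine 7/25. *)
Lemma sin5_lt : 7 * sin5 < 24 * cos5.
Proof.
have h1 := cos5_gt; have h2 := sin5_gt0; have h3 := cos5_gt0; have h4 := sin5_sqr.
rewrite ltNge; apply/negP => h.
have h5 : (24 * cos5) * (24 * cos5) <= (7 * sin5) * (7 * sin5) by apply: ler_pM; lra.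
by move: h4; rewrite !expr2 => h4; nra.
Qed.

Definition fifth_turn v : plane :=
  (cos5 * v.1 - sin5 * v.2, sin5 * v.1 + cos5 * v.2).

(** The Cayley-Hamilton relation of the rotation. Every linear function thus satisfies a two-term
    recurrence along the successive turns, and [cos5_eq] gives it period five. *)
Lemma fifth_turn_twice x :
  fifth_turn (fifth_turn x) = (2 * cos5 * (fifth_turn x).1 - x.1, 2 * cos5 * (fifth_turn x).2 - x.2).
Proof.
have h := sin5_sqr; apply: pair_eq; rewrite /=.
  have -> : cos5 * (cos5 * x.1 - sin5 * x.2) - sin5 * (sin5 * x.1 + cos5 * x.2) =
     cos5 ^+ 2 * x.1 - sin5 ^+ 2 * x.1 - 2 * cos5 * sin5 * x.2 by ring.
  by rewrite h; ring.
have -> : sin5 * (cos5 * x.1 - sin5 * x.2) + cos5 * (sin5 * x.1 + cos5 * x.2) =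
   cos5 ^+ 2 * x.2 - sin5 ^+ 2 * x.2 + 2 * cos5 * sin5 * x.1 by ring.
by rewrite h; ring.
Qed.

Definition in_sector u w x := 0 < cross u x /\ 0 < cross x w.

(* [24 * dot u w < 7 * cross u w] says that the cosine of the angle from [u] to
   [w] is less than 7/25. *)
Lemma sector_after_turn u w x : 0 < cross u w -> 24 * dot u w < 7 * cross u w ->
  cross u x <= 0 -> 0 < cross u (fifth_turn x) -> in_sector u w (fifth_turn x).
Proof.
move=> B0 EB f0; set y := fifth_turn x => A0; split => //.
have c0 := cos5_gt0; have s0 := sin5_gt0; have sc := sin5_lt.
have U0 : 0 < dot u u.
  rewrite lt_neqAle addr_ge0 ?sqr_ge0 // andbT eq_sym.
  apply: contraTneq B0 => /eqP; rewrite /dot -!expr2 paddr_eq0 ?sqr_ge0 // !sqrf_eq0.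
  by move=> /andP[/eqP u1 /eqP u2]; rewrite /cross u1 u2 !mul0r subrr ltxx.
(* Since [x] is [y] turned back by 72 degrees, [D0] says that [y] is at most 72 degrees ahead of
   [u], whereas by [E0] the vector [w] is more than 72 degrees ahead. *)
have xE : cross u x = cos5 * cross u y - sin5 * dot u y.
  have h := sin5_sqr.
  have -> : cos5 * cross u y - sin5 * dot u y = (cos5 ^+ 2 + sin5 ^+ 2) * cross u x.
    by rewrite /y /cross /dot /=; ring.
  by rewrite h addrC subrK mul1r.
have D0 : cos5 * cross u y <= sin5 * dot u y by lra.
have E0 : sin5 * dot u w < cos5 * cross u w.
  have h1 : 0 < sin5 * (7 * cross u w - 24 * dot u w) by apply: mulr_gt0; lra.
  have h2 : 0 < (24 * cos5 - 7 * sin5) * cross u w by apply: mulr_gt0; lra.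
  lra.
rewrite -(pmulr_rgt0 _ U0) -(pmulr_rgt0 _ s0).
have -> : sin5 * (dot u u * cross y w) =
    (sin5 * dot u y) * cross u w - cross u y * (sin5 * dot u w).
  by rewrite /cross /dot; ring.
rewrite subr_gt0; apply: (@lt_le_trans _ _ (cross u y * (cos5 * cross u w))).
  by rewrite ltr_pM2l.
by rewrite mulrCA mulrA ler_pM2r.
Qed.

(** The values of [cross u] on the five turns add up to 0. They do not all vanish, since [x] is not
    zero, so somewhere in the cycle a nonpositive value is followed by a positive one, and
    [sector_after_turn] applies at that step. *)
Lemma sector_meets_turns u w x : 0 < cross u w -> 24 * dot u w < 7 * cross u w ->
  x != 0 -> exists k : 'I_5, in_sector u w (iter k fifth_turn x).
Proof.
move=> B0 EB x0; pose y i := iter i fifth_turn x.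
have rec i : cross u (y i.+2) = 2 * cos5 * cross u (y i.+1) - cross u (y i).
  by rewrite /y !iterS fifth_turn_twice /cross /=; ring.
have y5 : y 5%N = y 0%N.
  have Y i : y i.+2 = (2 * cos5 * (y i.+1).1 - (y i).1, 2 * cos5 * (y i.+1).2 - (y i).2).
    by rewrite /y !iterS fifth_turn_twice.
  have c := cos5_eq.
  have E (p q : R) : 2 * cos5 * (2 * cos5 * (2 * cos5 * (2 * cos5 * p - q) - p) -
      (2 * cos5 * p - q)) - (2 * cos5 * (2 * cos5 * p - q) - p) = q.
    apply/eqP; rewrite -subr_eq0; apply/eqP.
    transitivity ((4 * cos5 ^+ 2 + 2 * cos5 - 1) *
      ((4 * cos5 ^+ 2 - 2 * cos5 - 1) * p - (2 * cos5 - 1) * q)); first by ring.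
    by rewrite c subrr mul0r.
  by apply: pair_eq; rewrite !Y /= E.
have sum0 : cross u (y 0%N) + cross u (y 1%N) + cross u (y 2%N) + cross u (y 3%N) + cross u (y 4%N) = 0.
  rewrite !rec.
  transitivity ((4 * cos5 ^+ 2 + 2 * cos5 - 1) *
    (2 * cos5 * cross u (y 1%N) - cross u (y 0%N))); first by ring.
  by rewrite cos5_eq subrr mul0r.
have turn i : cross u (y i) <= 0 -> 0 < cross u (y i.+1) -> in_sector u w (y i.+1).
  exact: sector_after_turn.
have [f0|f0] := leP (cross u (y 0%N)) 0; last first.
  have [f4|f4] := leP (cross u (y 4%N)) 0.
    by exists ord0; have := turn 4%N; rewrite y5; apply.
  have [f1|f1] := leP (cross u (y 1%N)) 0; last first.
    have [f2|f2] := leP (cross u (y 2%N)) 0; last first.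
      have [f3|f3] := leP (cross u (y 3%N)) 0; last by exfalso; lra.
      by exists (@Ordinal 5 4 isT); apply: (turn 3%N).
    have [f3|f3] := leP (cross u (y 3%N)) 0; last by exists (@Ordinal 5 3 isT); apply: (turn 2%N).
    by exists (@Ordinal 5 4 isT); apply: (turn 3%N).
  have [f2|f2] := leP (cross u (y 2%N)) 0; last by exists (@Ordinal 5 2 isT); apply: (turn 1%N).
  have [f3|f3] := leP (cross u (y 3%N)) 0; last by exists (@Ordinal 5 3 isT); apply: (turn 2%N).
  by exists (@Ordinal 5 4 isT); apply: (turn 3%N).
have [f1|f1] := leP (cross u (y 1%N)) 0; last by exists (@Ordinal 5 1 isT); apply: (turn 0%N).
have [f2|f2] := leP (cross u (y 2%N)) 0; last by exists (@Ordinal 5 2 isT); apply: (turn 1%N).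
have [f3|f3] := leP (cross u (y 3%N)) 0; last by exists (@Ordinal 5 3 isT); apply: (turn 2%N).
have [f4|f4] := leP (cross u (y 4%N)) 0; last by exists (@Ordinal 5 4 isT); apply: (turn 3%N).
exfalso.
have e0 : cross u x = 0 by apply/le_anti/andP; split; [exact: f0 | rewrite -/(y 0%N); lra].
have e1 : cross u (fifth_turn x) = 0.
  by apply/le_anti/andP; split; [exact: f1 | rewrite -/(y 1%N); lra].
have d0 : dot u x = 0.
  apply: (mulfI (lt0r_neq0 sin5_gt0)); rewrite mulr0 -e1.
  have -> : cross u (fifth_turn x) = sin5 * dot u x + cos5 * cross u x.
    by rewrite /cross /dot /=; ring.
  by rewrite e0 mulr0 addr0.
have : cross u w * dot x x = 0.
  have -> : cross u w * dot x x = dot u x * cross x w + cross u x * dot x w.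
    by rewrite /cross /dot; ring.
  by rewrite e0 d0 !mul0r addr0.
move/eqP; rewrite mulf_eq0 gt_eqF //= /dot -!expr2 paddr_eq0 ?sqr_ge0 // !sqrf_eq0.
by move=> /andP[/eqP x1 /eqP x2]; move/eqP: x0; apply; apply: pair_eq.
Qed.

(** The sector is wider than 72 degrees, so a vector just past [u] is still short of [w] after one
    turn. It is found as [u + r *: w] with [r] small. *)
Lemma sector_contains_turn u w : 0 < cross u w -> 24 * dot u w < 7 * cross u w ->
  exists x, [/\ x != 0, in_sector u w x & in_sector u w (fifth_turn x)].
Proof.
move=> B0 EB; have c0 := cos5_gt0; have s0 := sin5_gt0; have sc := sin5_lt.
have E0 : sin5 * dot u w < cos5 * cross u w.
  have h1 : 0 < sin5 * (7 * cross u w - 24 * dot u w) by apply: mulr_gt0; lra.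
  have h2 : 0 < (24 * cos5 - 7 * sin5) * cross u w by apply: mulr_gt0; lra.
  lra.
have U0 : 0 < dot u u.
  rewrite lt_neqAle addr_ge0 ?sqr_ge0 // andbT eq_sym.
  apply: contraTneq B0 => /eqP; rewrite /dot -!expr2 paddr_eq0 ?sqr_ge0 // !sqrf_eq0.
  by move=> /andP[/eqP u1 /eqP u2]; rewrite /cross u1 u2 !mul0r subrr ltxx.
have W0 : 0 <= dot w w by rewrite addr_ge0 // sqr_ge0.
pose Z := `|cross u (fifth_turn w)|; have Z0 : 0 <= Z by exact: normr_ge0.
pose G := cos5 * cross u w - sin5 * dot u w.
have G0 : 0 < G by rewrite /G; lra.
(* The first term keeps the turned vector on the positive side of [u], the second keeps it short of
   [w]; adding 1 makes the denominators positive. *)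
pose r := Num.min (sin5 * dot u u / (Z + 1)) (G / (sin5 * dot w w + 1)).
have Z1 : 0 < Z + 1 by lra.
have W1 : 0 < sin5 * dot w w + 1 by rewrite ltr_wpDl // mulr_ge0 // ltW.
have r0 : 0 < r by rewrite lt_min !divr_gt0 // mulr_gt0.
have rZ : r * Z < sin5 * dot u u.
  have : r * (Z + 1) <= sin5 * dot u u by rewrite -ler_pdivlMr // ge_min lexx.
  by rewrite mulrDr mulr1; lra.
have rW : r * (sin5 * dot w w) < G.
  have : r * (sin5 * dot w w + 1) <= G by rewrite -ler_pdivlMr // ge_min lexx orbT.
  by rewrite mulrDr mulr1; lra.
have rn : - (r * Z) <= r * cross u (fifth_turn w).
  rewrite -mulrN ler_pM2l //; by have : `|cross u (fifth_turn w)| <= Z by []; rewrite ler_norml => /andP[].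
have B1 : cross u (u + r *: w) = r * cross u w.
  by rewrite /cross /= /GRing.scale /=; ring.
exists (u + r *: w); split.
- apply: contraTneq (mulr_gt0 r0 B0) => x0.
  by rewrite -B1 x0 /cross /= !mulr0 subrr ltxx.
- split; first by rewrite B1 mulr_gt0.
  suff -> : cross (u + r *: w) w = cross u w by [].
  by rewrite /cross /= /GRing.scale /=; ring.
- split.
    have -> : cross u (fifth_turn (u + r *: w)) =
        sin5 * dot u u + r * cross u (fifth_turn w).
      by rewrite /cross /dot /= /GRing.scale /=; ring.
    lra.
  have -> : cross (fifth_turn (u + r *: w)) w = G - r * (sin5 * dot w w).
    by rewrite /G /cross /dot /= /GRing.scale /=; ring.
  lra.
Qed.

(* For a suitable [x] the first sector contains two of the five turns of [x];
   each of the other four contains at least one. *)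
Lemma no_five_sectors (S : 'I_5 -> set plane) (u w : 'I_5 -> plane) :
  (forall i j x, S i x -> S j x -> i = j) ->
  (forall i, [/\ 0 < cross (u i) (w i), 24 * dot (u i) (w i) < 7 * cross (u i) (w i) &
    forall x, in_sector (u i) (w i) x -> S i x]) -> False.
Proof.
move=> disj sec; have [b0 e0 s0] := sec ord0.
have [x [x0 x1 x2]] := sector_contains_turn b0 e0.
have /choice[f hf] : forall i, exists k : 'I_5, S i (iter k fifth_turn x).
  move=> i; have [b e s] := sec i; have [k hk] := sector_meets_turns b e x0.
  by exists k; apply: s.
have meets0 i : S i x -> i = ord0 by move/disj; apply; apply: s0.
have meets1 i : S i (fifth_turn x) -> i = ord0 by move/disj; apply; apply: s0.
(* A choice of one turn in each sector, injective by disjointness and hence onto. So turn 1 is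
   chosen for some sector other than the first, although the first sector contains it. *)
pose g i := if i == ord0 then (ord0 : 'I_5) else f i.
have ginj : injective g.
  move=> i j; rewrite /g; case: eqP => [->|i0]; case: eqP => [->//|j0].
  - by move=> f0; case: j0; apply: meets0; have := hf j; rewrite -f0.
  - by move=> f0; case: i0; apply: meets0; have := hf i; rewrite f0.
  - by move=> fij; apply: (disj _ _ _ (hf i)); rewrite fij.
have [h _ gh] := injF_bij ginj.
have := gh (@Ordinal 5 1 isT); set k := h _; rewrite /g; case: eqP => // k0 fk.
by apply: k0; apply: meets1; have := hf k; rewrite fk.
Qed.

End FifthTurn.

(** * The interior of a convex pentagon *)

Section ConvexPentagon.
Context {R : realType}.
Local Notation plane := (R * R)%type.
Implicit Types (a b c d e u v w x y z : plane) (p q : seq plane) (s t k : R).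

Definition open5 s a b c d e : set plane :=
  [set x | [/\ 0 < s * orient a b x, 0 < s * orient b c x, 0 < s * orient c d x,
    0 < s * orient d e x & 0 < s * orient e a x]].

Lemma closed5_rot s a b c d e x : closed5 s a b c d e x -> closed5 s b c d e a x.
Proof. by case. Qed.

Lemma orient_continuous s a b : continuous ((fun x => s * orient a b x) : plane -> R).
Proof.
have -> : (fun x => s * orient a b x) = fun x : plane =>
    s * (b.1 - a.1) * (x.2 - a.2) - s * (b.2 - a.2) * (x.1 - a.1).
  by apply/funext => x; rewrite /orient; ring.
move=> x; apply: cvgB; apply: cvgMl_tmp; apply: cvgB; try exact: cvg_cst.
  exact: cvg_snd.
exact: cvg_fst.
Qed.

Lemma open5_open s a b c d e : open (open5 s a b c d e).
Proof.
have H u v : open [set x | 0 < s * orient u v x].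
  have -> : [set x | 0 < s * orient u v x] =
      ((fun x => s * orient u v x) : plane -> R) @^-1` `]0, +oo[%classic.
    by apply/seteqP; split => x /=; rewrite in_itv /= andbT.
  by apply: open_comp; [move=> x _; exact: orient_continuous | exact: rray_open].
have -> : open5 s a b c d e = [set x | 0 < s * orient a b x] `&`
    ([set x | 0 < s * orient b c x] `&` ([set x | 0 < s * orient c d x] `&`
    ([set x | 0 < s * orient d e x] `&` [set x | 0 < s * orient e a x]))).
  by apply/seteqP; split => x [] //= h1 [h2 [h3 [h4 h5]]].
by do 4!apply: openI => //.
Qed.

Lemma closed5_closed s a b c d e : closed (closed5 s a b c d e).
Proof.
have H u v : closed [set x | 0 <= s * orient u v x].
  have -> : [set x | 0 <= s * orient u v x] =
      ((fun x => s * orient u v x) : plane -> R) @^-1` `[0, +oo[%classic.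
    by apply/seteqP; split => x /=; rewrite in_itv /= andbT.
  by apply: closed_comp; [move=> x _; exact: orient_continuous | exact: rray_closed].
have -> : closed5 s a b c d e = [set x | 0 <= s * orient a b x] `&`
    ([set x | 0 <= s * orient b c x] `&` ([set x | 0 <= s * orient c d x] `&`
    ([set x | 0 <= s * orient d e x] `&` [set x | 0 <= s * orient e a x]))).
  by apply/seteqP; split => x [] //= h1 [h2 [h3 [h4 h5]]].
by do 4!apply: closedI => //.
Qed.

Lemma side_of_closed5 s a b c d e x : convex5 s a b c d e -> closed5 s a b c d e x ->
  s * orient a b x = 0 -> exists2 t, 0 <= t <= 1 & (1 - t) *: a + t *: b = x.
Proof.
move=> [[h1 h2 h3 _ _] _] [_ x2 _ _ x5] /eqP.
have s0 : s != 0 by apply: contraTneq h1 => ->; rewrite mul0r ltxx.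
rewrite mulf_eq0 (negbTE s0) /= => /eqP o0.
have K0 : orient a b e != 0.
  by have := lt0r_neq0 h3; rewrite mulf_eq0 negb_or => /andP[].
pose t := orient e a x / orient a b e.
have tE : orient a b e * t = orient e a x by rewrite mulrC divfK.
have xE : (1 - t) *: a + t *: b = x.
  apply: pair_eq; rewrite /= /GRing.scale /=; apply: (mulfI K0).
    transitivity (orient a b e * a.1 + orient a b e * t * (b.1 - a.1)); first by ring.
    transitivity (orient a b e * x.1 - orient a b x * (e.1 - a.1)); last by rewrite o0 mul0r subr0.
    by rewrite tE /orient; ring.
  transitivity (orient a b e * a.2 + orient a b e * t * (b.2 - a.2)); first by ring.
  transitivity (orient a b e * x.2 - orient a b x * (e.2 - a.2)); last by rewrite o0 mul0r subr0.
  by rewrite tE /orient; ring.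
exists t => //; apply/andP; split.
  rewrite -(pmulr_rge0 _ h3); suff -> : s * orient a b e * t = s * orient e a x by [].
  by rewrite -tE mulrA.
rewrite -subr_ge0 -(pmulr_rge0 _ h1).
suff -> : s * orient a b c * (1 - t) = s * orient b c x by [].
by rewrite -xE /orient /= /GRing.scale /=; ring.
Qed.

(** The closed pentagon minus the open one lies on the boundary. Within a component of the
    complement of the boundary, the open pentagon is therefore both open and closed, so it contains
    the component of each of its points, and this component is bounded. *)
Lemma open5_inside s a b c d e : convex5 s a b c d e ->
  open5 s a b c d e `<=` inside [:: a; b; c; d; e].
Proof.
move=> cv x ox.
have cv2 := convex5_rot cv; have cv3 := convex5_rot cv2.
have cv4 := convex5_rot cv3; have cv5 := convex5_rot cv4.
have on_line u v t : s * orient u v ((1 - t) *: u + t *: v) = 0.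
  by rewrite /orient /= /GRing.scale /=; ring.
have not_bd y : open5 s a b c d e y -> ~ boundary [:: a; b; c; d; e] y.
  move=> [q1 q2 q3 q4 q5] [i /= i5 [t _ E]].
  by move: i5 E q1 q2 q3 q4 q5; do 5?[case: i => [_ /= <-|i] //];
    rewrite /side_point /vertex /= on_line ltxx.
have bd y : closed5 s a b c d e y -> ~ open5 s a b c d e y -> boundary [:: a; b; c; d; e] y.
  have on_side i t : (i < 5)%N -> 0 <= t <= 1 ->
      side_point [:: a; b; c; d; e] i t = y -> boundary [:: a; b; c; d; e] y.
    by move=> i5 t01 E; exists i => //; exists t; rewrite //= in_itv.
  move=> cy ny; have [i1 i2 i3 i4 i5] := cy; have cy2 := closed5_rot cy.
  have cy3 := closed5_rot cy2; have cy4 := closed5_rot cy3; have cy5 := closed5_rot cy4.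
  have [z1|z1] := eqVneq (s * orient a b y) 0.
    by have [t t01] := side_of_closed5 cv cy z1; exact: (on_side 0%N).
  have [z2|z2] := eqVneq (s * orient b c y) 0.
    by have [t t01] := side_of_closed5 cv2 cy2 z2; exact: (on_side 1%N).
  have [z3|z3] := eqVneq (s * orient c d y) 0.
    by have [t t01] := side_of_closed5 cv3 cy3 z3; exact: (on_side 2%N).
  have [z4|z4] := eqVneq (s * orient d e y) 0.
    by have [t t01] := side_of_closed5 cv4 cy4 z4; exact: (on_side 3%N).
  have [z5|z5] := eqVneq (s * orient e a y) 0.
    by have [t t01] := side_of_closed5 cv5 cy5 z5; exact: (on_side 4%N).
  by case: ny; split; rewrite lt_neqAle eq_sym ?z1 ?z2 ?z3 ?z4 ?z5.
have sub y : open5 s a b c d e y -> closed5 s a b c d e y.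
  by move=> [*]; split; exact: ltW.
set p := [:: a; b; c; d; e].
pose C := connected_component (~` boundary p) x.
have Cx : C x by apply: connected_component_refl; exact: not_bd.
have CE : C `&` open5 s a b c d e = C.
  apply: (@component_connected _ (~` boundary p) x (C `&` open5 s a b c d e)).
  - by exists x.
  - by exists (open5 s a b c d e) => //; exact: open5_open.
  - exists (closed5 s a b c d e); first exact: closed5_closed.
    apply/seteqP; split => y [Cy]; split => //; first exact: sub.
    by apply: contrapT => ny; have := connected_component_sub Cy; apply; exact: bd.
split; first exact: not_bd.
apply: bounded_subset (hull_bounded p); rewrite -/C -CE => y [_ /sub].
exact: closed5_hull.
Qed.

End ConvexPentagon.

(** * Sectors at the corners of efficient pentagons *)

Section Corners.
Context {R : realType}.
Local Notation plane := (R * R)%type.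
Local Notation dist := euclidean_dist.
Implicit Types (a b c d e u v w x y z : plane) (p q : seq plane) (s t k : R).

Lemma positive_nearby (x y : R) : 0 < x -> exists2 r, 0 < r & forall t, 0 < t < r -> 0 < x + t * y.
Proof.
move=> x0; have y1 : 0 < `|y| + 1 by rewrite ltr_wpDl.
exists (x / (`|y| + 1)); first by rewrite divr_gt0.
move=> t /andP[t0]; rewrite ltr_pdivlMr // => tx.
have : - (t * `|y|) <= t * y by rewrite -mulrN ler_pM2l //; have := lexx `|y|; rewrite {1}ler_norml => /andP[].
by lra.
Qed.

Lemma nonneg_limit (x y : R) :
  (forall r, 0 < r -> exists2 t, 0 < t < r & 0 <= x + t * y) -> 0 <= x.
Proof.
move=> H; rewrite leNgt; apply/negP => x0.
have nx : 0 < - x by rewrite oppr_gt0.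
have [r r0 hr] := positive_nearby (- y) nx.
by have [t /hr] := H r r0; lra.
Qed.

(** Near [a] only the two sides at [a] impose a condition: the other three orientations are positive
    at [a] and remain so for small [t]. *)
Lemma corner_sector s a b c d e y : convex5 s a b c d e ->
  0 < s * cross (b - a) y -> 0 < s * cross y (e - a) ->
  exists2 r, 0 < r & forall t, 0 < t < r -> open5 s a b c d e (a + t *: y).
Proof.
move=> [[h1 h2 h3 h4 h5] [h6 h7 h8 h9 h10]] y1 y2.
have bca : 0 < s * orient b c a by rewrite -orient_rot.
have cda : 0 < s * orient c d a by rewrite -orient_rot.
have dea : 0 < s * orient d e a by rewrite -orient_rot.
have [r1 r10 hr1] := positive_nearby (s * cross (c - b) y) bca.
have [r2 r20 hr2] := positive_nearby (s * cross (d - c) y) cda.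
have [r3 r30 hr3] := positive_nearby (s * cross (e - d) y) dea.
exists (Num.min r1 (Num.min r2 r3)); first by rewrite !lt_min r10 r20 r30.
move=> t /andP[t0]; rewrite !lt_min => /and3P[t1 t2 t3].
have E u w : s * orient u w (a + t *: y) = s * orient u w a + t * (s * cross (w - u) y).
  by rewrite /orient /cross /= /GRing.scale /=; ring.
have oa u : orient a u a = 0 by rewrite /orient; ring.
have oa' u : orient u a a = 0 by rewrite /orient; ring.
split; rewrite E.
- by rewrite oa mulr0 add0r mulr_gt0.
- by apply: hr1; rewrite t0.
- by apply: hr2; rewrite t0.
- by apply: hr3; rewrite t0.
- rewrite oa' mulr0 add0r mulr_gt0 //.
  by rewrite (_ : cross (a - e) y = cross y (e - a)) // /cross /=; ring.
Qed.

(** The squared product of the two lengths is the sum of the squares of [dot] and [cross].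
    Eliminating it leaves a condition without square roots, linear in each side of the angle, as the
    sector lemmas require. *)
Lemma wide_corner_cross a b e : wide_corner a b e ->
  24 * dot (b - a) (e - a) < 7 * `|cross (b - a) (e - a)|.
Proof.
rewrite /wide_corner => wd.
have hK : (dist a b * dist a e) ^+ 2 =
    dot (b - a) (e - a) ^+ 2 + cross (b - a) (e - a) ^+ 2.
  by rewrite exprMn !sqr_dist /dot /cross /=; ring.
have N0 : 0 <= dist a b * dist a e by rewrite mulr_ge0 ?dist_ge0.
rewrite -[cross _ _ ^+ 2]real_normK ?num_real // in hK.
have := normr_ge0 (cross (b - a) (e - a)).
move: (dot _ _) `|_| (_ * _) hK wd N0 => D X N hK wd N0 X0.
rewrite ltNge; apply/negP => h.
have D0 : 0 <= D by lra.
have h1 : (25 * D) ^+ 2 < (7 * N) ^+ 2.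
  by apply: ltrXn2r; rewrite ?mulr_ge0 //; lra.
have h2 : (7 * X) ^+ 2 <= (24 * D) ^+ 2 by apply: lerXn2r; rewrite ?nnegrE ?mulr_ge0.
move: h1 h2; rewrite !exprMn hK; lra.
Qed.

Definition sector_inside (S : set plane) v u w :=
  [/\ 0 < cross u w, 24 * dot u w < 7 * cross u w &
    forall y, in_sector u w y ->
      exists2 r, 0 < r & forall t, 0 < t < r -> S (v + t *: y)].

Lemma convex5_sector s a b c d e : s = 1 \/ s = -1 -> convex5 s a b c d e ->
  wide_corner a b e -> exists u w, sector_inside (open5 s a b c d e) a u w.
Proof.
move=> hs cv /wide_corner_cross wd; have [[_ _ abe _ _] _] := cv.
have E : orient a b e = cross (b - a) (e - a) by rewrite /orient /cross /=; ring.
case: hs => s1.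
  rewrite s1 mul1r E in abe.
  exists (b - a), (e - a); split => //; first by rewrite gtr0_norm in wd.
  by move=> y [y1 y2]; apply: corner_sector => //; rewrite s1 mul1r.
rewrite s1 mulN1r oppr_gt0 E in abe.
have C : cross (e - a) (b - a) = - cross (b - a) (e - a) by rewrite /cross /=; ring.
have D : dot (e - a) (b - a) = dot (b - a) (e - a) by rewrite /dot; ring.
exists (e - a), (b - a); split; first by rewrite C oppr_gt0.
  by rewrite C D; rewrite ltr0_norm in wd.
move=> y [y1 y2]; apply: corner_sector => //.
  by rewrite s1 mulN1r (_ : cross _ _ = - cross y (b - a)) ?opprK // /cross /=; ring.
by rewrite s1 mulN1r (_ : cross _ _ = - cross (e - a) y) ?opprK // /cross /=; ring.
Qed.

Lemma efficient_corner p v : efficient_pentagon p -> v \in p ->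
  exists u w, sector_inside (inside p) v u w.
Proof.
move=> /efficient_pentagon_shape[a [b [c [d [e [s [-> hs cv [w1 w2 w3 w4 w5]]]]]]]].
have cv2 := convex5_rot cv; have cv3 := convex5_rot cv2.
have cv4 := convex5_rot cv3; have cv5 := convex5_rot cv4.
have sub S y : (S `<=` open5 s a b c d e) -> (exists u w, sector_inside S y u w) ->
    exists u w, sector_inside (inside [:: a; b; c; d; e]) y u w.
  move=> hS [u [w [h1 h2 h3]]]; exists u, w; split => // x /h3[r r0 hr].
  by exists r => // t /hr /hS; exact: open5_inside.
rewrite !inE => /orP[|/or4P[]] /eqP->.
- by apply: sub (convex5_sector hs cv w1).
- by apply: sub (convex5_sector hs cv2 w2) => x [].
- by apply: sub (convex5_sector hs cv3 w3) => x [].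
- by apply: sub (convex5_sector hs cv4 w4) => x [].
- by apply: sub (convex5_sector hs cv5 w5) => x [].
Qed.

End Corners.

(** * Counting the corners from which a generic direction enters a tile *)

Section Directions.
Context {R : realType}.
Local Notation plane := (R * R)%type.
Implicit Types (a b c d e u v w x y z : plane) (p q : seq plane) (s t k : R) (S : set plane).

Lemma points_into_sub S S' v d : S `<=` S' -> points_into S v d -> points_into S' v d.
Proof. by move=> SS' H r /H[t tr /SS']; exists t. Qed.

Lemma points_intoU S S' v d : points_into (S `|` S') v d ->
  points_into S v d \/ points_into S' v d.
Proof.
move=> H; have [|] := pselect (points_into S v d); first by left.
move=> /existsNP[r /not_implyP[r0 nS]]; right => r' r0'.
have [|t /andP[t0]] := H (Num.min r r'); first by rewrite lt_min r0.
rewrite lt_min => /andP[tr tr'] [St|St]; last by exists t; rewrite // t0.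
by case: nS; exists t; rewrite // t0.
Qed.

Lemma triangle_closed_along s a b c v d : points_into (triangle s a b c) v d ->
  triangle s a b c v.
Proof.
move=> H.
have E x y t : s * orient x y (v + t *: d) = s * orient x y v + t * (s * cross (y - x) d).
  by rewrite /orient /cross /= /GRing.scale /=; ring.
split; [apply: (nonneg_limit (y := s * cross (b - a) d)) |
  apply: (nonneg_limit (y := s * cross (c - b) d)) |
  apply: (nonneg_limit (y := s * cross (a - c) d))];
  by move=> r /H[t tr [h1 h2 h3]]; exists t; rewrite // -E.
Qed.

(* A line enters a triangle through a vertex only if it separates the two other
   vertices. *)
Lemma triangle_middle s a b c d t k : k != 0 -> 0 < s * orient a b c ->
  cross d (b - a) != 0 -> cross d (c - a) != 0 ->
  0 < t -> triangle s a b c (a + t *: (k *: d)) ->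
  cross d (b - a) * cross d (c - a) < 0.
Proof.
move=> k0 K0 nb nc t0 [h1 _ h3].
have s0 : s != 0 by apply: contraTneq K0 => ->; rewrite mul0r ltxx.
pose B := cross d (b - a); pose C := cross d (c - a).
have E1 : s * orient a b (a + t *: (k *: d)) = - (s * k * t) * B.
  by rewrite /B /orient /cross /= /GRing.scale /=; ring.
have E2 : s * orient c a (a + t *: (k *: d)) = s * k * t * C.
  by rewrite /C /orient /cross /= /GRing.scale /=; ring.
rewrite E1 in h1; rewrite E2 in h3; rewrite -/B -/C.
have m0 : s * k * t != 0 by rewrite !mulf_neq0 // gt_eqF.
have h : 0 <= - (s * k * t) ^+ 2 * (B * C).
  by have := mulr_ge0 h1 h3; lra.
have BC : B * C != 0 by rewrite mulf_neq0.
rewrite lt_neqAle BC -(@pmulr_rle0 _ ((s * k * t) ^+ 2)); last first.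
  by rewrite lt_neqAle sqr_ge0 eq_sym sqrf_eq0 m0.
by lra.
Qed.

(** The line through [a] and [b] is crossed at [a] by the direction [d], and the triangle lies on
    one side of it. *)
Lemma triangle_one_way s a b c d t t' : s != 0 -> cross d (b - a) != 0 ->
  0 < t -> 0 < t' -> triangle s a b c (a + t *: d) ->
  triangle s a b c (a + t' *: - d) -> False.
Proof.
move=> s0 nb t0 t0' [h1 _ _] [h1' _ _].
have E1 : s * orient a b (a + t *: d) = t * - (s * cross d (b - a)).
  by rewrite /orient /cross /= /GRing.scale /=; ring.
have E2 : s * orient a b (a + t' *: - d) = t' * (s * cross d (b - a)).
  by rewrite /orient /cross /= /GRing.scale /=; ring.
rewrite E1 pmulr_rge0 // oppr_ge0 in h1; rewrite E2 pmulr_rge0 // in h1'.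
have : s * cross d (b - a) != 0 by rewrite mulf_neq0.
by rewrite (le_anti (introT andP (conj h1 h1'))) eqxx.
Qed.

Definition directions_into S p d : nat :=
  \sum_(v <- p) (`[< points_into S v d >] + `[< points_into S v (- d) >]).

Lemma directions_into_sub S S' p d : S `<=` S' ->
  (directions_into S p d <= directions_into S' p d)%N.
Proof.
move=> SS'; apply: leq_sum => v _; apply: leq_add.
  by case: asboolP => // /(points_into_sub SS') h; rewrite asboolT.
by case: (asboolP (points_into S v (- d))) => // /(points_into_sub SS') h; rewrite asboolT.
Qed.

Lemma directions_intoU S S' p d :
  (directions_into (S `|` S') p d <= directions_into S p d + directions_into S' p d)%N.
Proof.
rewrite -big_split; apply: leq_sum => v _ /=.
have H y : (`[< points_into (S `|` S') v y >] <= `[< points_into S v y >] + `[< points_into S' v y >])%N.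
  case: asboolP => // /points_intoU[] h; first by rewrite asboolT.
  by rewrite addnC asboolT.
by rewrite addnACA leq_add.
Qed.

Lemma sum_le1 (T : eqType) (r : seq T) (F : T -> nat) : uniq r ->
  (forall i, i \in r -> (F i <= 1)%N) ->
  (forall i j, i \in r -> j \in r -> (0 < F i)%N -> (0 < F j)%N -> i = j) ->
  (\sum_(i <- r) F i <= 1)%N.
Proof.
elim: r => [|i r IH] /=; first by rewrite big_nil.
move=> /andP[ir ur] F1 Fu; rewrite big_cons.
have [Fi|Fi] := posnP (F i).
  rewrite Fi; apply: IH => // [j jr|j l jr lr].
    by apply: F1; rewrite inE jr orbT.
  by apply: Fu; rewrite inE ?jr ?lr orbT.
rewrite big1_seq ?addn0; first by apply: F1; rewrite mem_head.
move=> j /andP[_ jr]; apply/eqP; rewrite -leqn0 leqNgt; apply/negP => Fj.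
have ji : j = i by apply: Fu; rewrite ?inE ?eqxx ?jr ?orbT.
by rewrite -ji jr in ir.
Qed.

Definition generic d p := forall u v, u \in p -> v \in p -> u != v -> cross d (v - u) != 0.

(** The count runs over all vertices of a tile; those other than [a], [b], [c] are assumed to lie
    off the triangle, which is closed, so no direction enters it from them. *)
Lemma directions_into_triangle s a b c p d : uniq p -> generic d p ->
  0 < s * orient a b c -> a \in p -> b \in p -> c \in p ->
  (forall v, v \in p -> triangle s a b c v -> v \in [:: a; b; c]) ->
  (directions_into (triangle s a b c) p d <= 1)%N.
Proof.
move=> up gd K0 ap bp cp Tp.
have s0 : s != 0 by apply: contraTneq K0 => ->; rewrite mul0r ltxx.
have ab : a != b by apply: contraTneq K0 => ->; rewrite /orient -leNgt; lra.
have bc : b != c by apply: contraTneq K0 => ->; rewrite /orient -leNgt; lra.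
have ca : c != a by apply: contraTneq K0 => ->; rewrite /orient -leNgt; lra.
have T1 : triangle s a b c = triangle s b c a by exact: triangle_rot.
have T2 : triangle s a b c = triangle s c a b by rewrite T1 triangle_rot.
have K1 : 0 < s * orient b c a by rewrite -orient_rot.
have K2 : 0 < s * orient c a b by rewrite orient_rot.
pose mid x y z := cross d (y - x) * cross d (z - x) < 0.
have key v k : k != 0 -> v \in p -> points_into (triangle s a b c) v (k *: d) ->
    [\/ v = a /\ mid a b c, v = b /\ mid b c a | v = c /\ mid c a b].
  move=> k0 vp H; have := Tp v vp (triangle_closed_along H).
  have [t /andP[t0 _] Ht] := H 1 ltr01.
  rewrite !inE => /or3P[]/eqP E; subst v.
  - constructor 1; split => //; apply: (triangle_middle k0 K0 _ _ t0 Ht); apply: gd => //.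
    by rewrite eq_sym.
  - constructor 2; split => //; rewrite T1 in Ht.
    by apply: (triangle_middle k0 K1 _ _ t0 Ht); apply: gd => //; rewrite eq_sym.
  - constructor 3; split => //; rewrite T2 in Ht.
    by apply: (triangle_middle k0 K2 _ _ t0 Ht); apply: gd => //; rewrite eq_sym.
(* [mid x y z] says that [cross d x] lies strictly between [cross d y] and [cross d z]; of three
   numbers only one can lie between the other two. *)
have excl : [/\ ~ (mid a b c /\ mid b c a), ~ (mid b c a /\ mid c a b) & ~ (mid c a b /\ mid a b c)].
  have E x y : cross d (x - y) = cross d x - cross d y by rewrite /cross /=; ring.
  rewrite /mid !E; move: (cross d a) (cross d b) (cross d c) => A B C.
  by have := sqr_ge0 (A - B); have := sqr_ge0 (B - C); have := sqr_ge0 (C - A);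
    split => -[h1 h2]; lra.
have d1 : d = 1 *: d by rewrite scale1r.
have dN : - d = (-1) *: d by rewrite scaleN1r.
apply: sum_le1 => // [v vp|v w vp wp].
  case: asboolP => [H|_]; case: asboolP => [H'|_] //.
  exfalso; have [t /andP[t0 _] Ht] := H 1 ltr01; have [t' /andP[t0' _] Ht'] := H' 1 ltr01.
  have := Tp v vp (triangle_closed_along H); rewrite !inE => /or3P[]/eqP E; subst v.
  - by apply: (triangle_one_way s0 (gd _ _ ap bp ab) t0 t0' Ht Ht').
  - by rewrite T1 in Ht Ht'; apply: (triangle_one_way s0 (gd _ _ bp cp bc) t0 t0' Ht Ht').
  - by rewrite T2 in Ht Ht'; apply: (triangle_one_way s0 (gd _ _ cp ap ca) t0 t0' Ht Ht').
have mem v' : v' \in p -> (0 < `[< points_into (triangle s a b c) v' d >] +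
      `[< points_into (triangle s a b c) v' (- d) >])%N ->
    [\/ v' = a /\ mid a b c, v' = b /\ mid b c a | v' = c /\ mid c a b].
  move=> vp'; case: asboolP => [H _|_].
    by apply: (key _ 1); [exact: oner_neq0 | exact: vp' | rewrite -d1].
  case: asboolP => // H _.
  by apply: (key _ (-1)); [rewrite oppr_eq0 oner_neq0 | exact: vp' | rewrite -dN].
move=> /(mem v vp) mv /(mem w wp) mw; case: excl => e1 e2 e3.
by case: mv => -[-> m1]; case: mw => -[-> m2] //; exfalso; tauto.
Qed.

Lemma simple_uniq p : simple_polygon p -> uniq p.
Proof.
move=> [p2 sp]; apply/(uniqP 0) => i j; rewrite !inE => ip jp E.
have z1 : 0 <= (0 : R) < 1 by rewrite lexx ltr01.
have E0 : side_point p i 0 = side_point p j 0.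
  by rewrite /side_point !subr0 !scale1r !scale0r !addr0 /vertex !modn_small.
by have [] := sp i j 0 0 ip jp z1 z1 E0.
Qed.

Lemma directions_into_pentagon p d : efficient_pentagon p -> generic d p ->
  (directions_into (region p) p d <= 3)%N.
Proof.
move=> ep gd; have [sp _ _ _] := ep; have up := simple_uniq sp.
have [a [b [c [d' [e [s [pE hs cv _]]]]]]] := efficient_pentagon_shape ep.
have [[h1 h2 h3 h4 h5] [h6 h7 h8 h9 h10]] := cv.
have p0 : (0 < size p)%N by rewrite pE.
have rp : region p `<=` triangle s a b e `|` (triangle s b c d' `|` triangle s b d' e).
  apply: subset_trans (region_hull p0) _; rewrite pE.
  exact: subset_trans (hull_closed5 cv) (closed5_fan cv).
apply: leq_trans (directions_into_sub _ _ rp) _.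
apply: leq_trans (directions_intoU _ _ _ _) _.
apply: (@leq_add _ _ 1 2); last apply: leq_trans (directions_intoU _ _ _ _) (@leq_add _ _ 1 1 _ _).
- apply: directions_into_triangle => //; rewrite ?pE ?inE ?eqxx ?orbT //.
  move=> v; rewrite !inE => /orP[|/or4P[]] /eqP-> //; rewrite ?eqxx ?orbT //; case=> /= k1 k2 k3.
    by move: k2 h8; rewrite (_ : orient b e c = - orient b c e) ?mulrN /orient; [lra | ring].
  by move: k2 h9; rewrite (_ : orient b e d' = - orient b d' e) ?mulrN /orient; [lra | ring].
- apply: directions_into_triangle => //; rewrite ?pE ?inE ?eqxx ?orbT //.
  move=> v; rewrite !inE => /orP[|/or4P[]] /eqP-> //; rewrite ?eqxx ?orbT //; case=> /= k1 k2 k3.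
    by move: k3 h2; rewrite (_ : orient d' b a = - orient a b d') ?mulrN /orient; [lra | ring].
  by move: k3 h9; rewrite (_ : orient d' b e = - orient b d' e) ?mulrN /orient; [lra | ring].
- apply: directions_into_triangle => //; rewrite ?pE ?inE ?eqxx ?orbT //.
  move=> v; rewrite !inE => /orP[|/or4P[]] /eqP-> //; rewrite ?eqxx ?orbT //; case=> /= k1 k2 k3.
    by move: k3 h3; rewrite (_ : orient e b a = - orient a b e) ?mulrN /orient; [lra | ring].
  by move: k1 h7; rewrite (_ : orient b d' c = - orient b c d') ?mulrN /orient; [lra | ring].
Qed.

End Directions.

(** * Quadrilaterals covered by two triangles *)

Section Quadrilaterals.
Context {R : realType}.
Local Notation plane := (R * R)%type.
Implicit Types (a b c d e u v w x y z : plane) (p q : seq plane) (s t k : R) (S : set plane).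

(** When both triangles have the orientation of [s], they lie on opposite sides of the diagonal
    [b d]. Their union need not be convex, so supporting half-planes do not suffice to bound a
    region by it. *)
Definition kite s a b c d := triangle s a b d `|` triangle s b c d.

(** A point on the side of [a] and beyond the line [a b] escapes in the direction [a - b]: it stays
    beyond that line and moves away from the diagonal, hence from the other triangle. The other
    sides are treated alike. *)
Lemma kite_ray s a b c d x : 0 < s * orient a b d -> 0 < s * orient b c d ->
  ~ kite s a b c d x ->
  exists2 w, w != 0 & forall t, 0 <= t -> ~ kite s a b c d (x + t *: w).
Proof.
move=> Ka Kc nx.
have E u v w t : s * orient u v (x + t *: w) = s * orient u v x + t * (s * cross (v - u) w).
  by rewrite /orient /cross /= /GRing.scale /=; ring.
have par u : cross u u = 0 by rewrite /cross; ring.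
have parN u v : cross (u - v) (v - u) = 0 by rewrite /cross /=; ring.
have b1 : s * cross (d - b) (a - b) = s * orient a b d by rewrite /orient /cross /=; ring.
have b2 : s * cross (d - b) (a - d) = s * orient a b d by rewrite /orient /cross /=; ring.
have b3 : s * cross (d - b) (c - b) = - (s * orient b c d) by rewrite /orient /cross /=; ring.
have b4 : s * cross (d - b) (c - d) = - (s * orient b c d) by rewrite /orient /cross /=; ring.
have db y : s * orient d b y = - (s * orient b d y) by rewrite /orient; ring.
have I1 : (s * orient a b d) * (s * orient b c x) - (s * orient b c d) * (s * orient a b x) =
    (s * orient a b c) * (s * orient b d x) by rewrite /orient; ring.
have I2 : (s * orient a b d) * (s * orient c d x) - (s * orient b c d) * (s * orient d a x) =
    (s * orient c d a) * (s * orient b d x) by rewrite /orient; ring.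
have n1 : a - b != 0.
  by apply: contraTneq Ka => /eqP; rewrite subr_eq0 => /eqP ->; rewrite /orient -leNgt; lra.
have n2 : a - d != 0.
  by apply: contraTneq Ka => /eqP; rewrite subr_eq0 => /eqP ->; rewrite /orient -leNgt; lra.
have n3 : c - b != 0.
  by apply: contraTneq Kc => /eqP; rewrite subr_eq0 => /eqP ->; rewrite /orient -leNgt; lra.
have n4 : c - d != 0.
  by apply: contraTneq Kc => /eqP; rewrite subr_eq0 => /eqP ->; rewrite /orient -leNgt; lra.
have n5 : b - d != 0.
  by apply: contraTneq Kc => /eqP; rewrite subr_eq0 => /eqP ->; rewrite /orient -leNgt; lra.
have [h|h|h] := ltgtP 0 (s * orient b d x).
- have [l|l] := ltP (s * orient a b x) 0.
    exists (a - b) => // t t0 [[k1 k2 k3]|[k1 k2 k3]].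
      by rewrite E parN mulr0 mulr0 addr0 leNgt l in k1.
    by have := mulr_ge0 t0 (ltW Ka); rewrite db E b1 in k3; lra.
  have [m|m] := ltP (s * orient d a x) 0.
    exists (a - d) => // t t0 [[k1 k2 k3]|[k1 k2 k3]].
      by rewrite E par mulr0 mulr0 addr0 leNgt m in k3.
    by have := mulr_ge0 t0 (ltW Ka); rewrite db E b2 in k3; lra.
  by case: nx; left; split => //; exact: ltW.
- have [l|l] := ltP (s * orient b c x) 0.
    exists (c - b) => // t t0 [[k1 k2 k3]|[k1 k2 k3]].
      by have := mulr_ge0 t0 (ltW Kc); rewrite E b3 in k2; lra.
    by rewrite E par mulr0 mulr0 addr0 leNgt l in k1.
  have [m|m] := ltP (s * orient c d x) 0.
    exists (c - d) => // t t0 [[k1 k2 k3]|[k1 k2 k3]].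
      by have := mulr_ge0 t0 (ltW Kc); rewrite E b4 in k2; lra.
    by rewrite E parN mulr0 mulr0 addr0 leNgt m in k2.
  by case: nx; right; split => //; rewrite db oppr_ge0 ltW.
(* For [x] on the line of the diagonal, [I1] and [I2] show that it is beyond both sides at [b] or
   both sides at [d]; it escapes along the diagonal. *)
- rewrite -h !mulr0 in I1 I2.
  have [l|l] := ltP (s * orient a b x) 0.
    have l' : s * orient b c x < 0.
      by rewrite -(pmulr_rlt0 _ Ka); have := nmulr_llt0 (s * orient b c d) l; rewrite Kc; lra.
    exists (b - d) => // t t0 [[k1 k2 k3]|[k1 k2 k3]].
      have D : s * cross (b - a) (b - d) = - (s * orient a b d) by rewrite /orient /cross /=; ring.
      by have := mulr_ge0 t0 (ltW Ka); rewrite E D in k1; lra.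
    have D : s * cross (c - b) (b - d) = - (s * orient b c d) by rewrite /orient /cross /=; ring.
    by have := mulr_ge0 t0 (ltW Kc); rewrite E D in k1; lra.
  have [m|m] := ltP (s * orient d a x) 0.
    have m' : s * orient c d x < 0.
      by rewrite -(pmulr_rlt0 _ Ka); have := nmulr_llt0 (s * orient b c d) m; rewrite Kc; lra.
    exists (d - b); first by rewrite -opprB oppr_eq0.
    move=> t t0 [[k1 k2 k3]|[k1 k2 k3]].
      have D : s * cross (a - d) (d - b) = - (s * orient a b d) by rewrite /orient /cross /=; ring.
      by have := mulr_ge0 t0 (ltW Ka); rewrite E D in k3; lra.
    have D : s * cross (d - c) (d - b) = - (s * orient b c d) by rewrite /orient /cross /=; ring.
    by have := mulr_ge0 t0 (ltW Kc); rewrite E D in k2; lra.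
  by case: nx; left; split; rewrite -?h.
Qed.

Lemma region_kite p s a b c d : 0 < s * orient a b d -> 0 < s * orient b c d ->
  boundary p `<=` kite s a b c d -> region p `<=` kite s a b c d.
Proof.
move=> Ka Kc bp x [ix|]; last exact: bp.
apply: contrapT => nx; have [w w0 hw] := kite_ray Ka Kc nx.
by apply: (ray_not_inside w0 _ ix) => t t0 /bp; exact: hw.
Qed.

Lemma triangle_convex s a b c x y t : 0 <= t <= 1 -> triangle s a b c x ->
  triangle s a b c y -> triangle s a b c ((1 - t) *: x + t *: y).
Proof.
move=> /andP[t0 t1] [x1 x2 x3] [y1 y2 y3].
have E u v : s * orient u v ((1 - t) *: x + t *: y) =
    (1 - t) * (s * orient u v x) + t * (s * orient u v y).
  by rewrite /orient /= /GRing.scale /=; ring.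
by split; rewrite E addr_ge0 // mulr_ge0 // subr_ge0.
Qed.

Lemma triangle_vertices s a b c : 0 < s * orient a b c ->
  [/\ triangle s a b c a, triangle s a b c b & triangle s a b c c].
Proof.
move=> K.
have e1 y z : s * orient y z y = 0 by rewrite /orient; ring.
have e2 y z : s * orient y z z = 0 by rewrite /orient; ring.
have k1 : 0 <= s * orient b c a by rewrite -orient_rot ltW.
have k2 : 0 <= s * orient c a b by rewrite orient_rot ltW.
by split; split; rewrite ?e1 ?e2 // ltW.
Qed.

Lemma boundary4 a b c d S :
  (forall t, 0 <= t <= 1 -> [/\ S ((1 - t) *: a + t *: b), S ((1 - t) *: b + t *: c),
     S ((1 - t) *: c + t *: d) & S ((1 - t) *: d + t *: a)]) ->
  boundary [:: a; b; c; d] `<=` S.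
Proof.
move=> H x [i /= i4 [t]]; rewrite /= in_itv /= => /H[h1 h2 h3 h4] <-.
by move: i4; do 4?[case: i => [_|i] //]; rewrite /side_point /vertex.
Qed.

Lemma directions_into_kite p s a b c d w : uniq p -> generic w p ->
  p =i [:: a; b; c; d] -> 0 < s * orient a b d -> 0 < s * orient b c d ->
  region p `<=` kite s a b c d -> (directions_into (region p) p w <= 2)%N.
Proof.
move=> up gw pE Ka Kc rp.
apply: leq_trans (directions_into_sub _ _ rp) _.
apply: leq_trans (directions_intoU _ _ _ _) _.
apply: (@leq_add _ _ 1 1); apply: directions_into_triangle => //;
  rewrite ?pE ?inE ?eqxx ?orbT //.
  move=> v; rewrite pE !inE => /or4P[] /eqP-> //; rewrite ?eqxx ?orbT //; case=> /= k1 k2 k3.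
  by move: k2 Kc; rewrite (_ : orient b d c = - orient b c d) ?mulrN /orient; [lra | ring].
move=> v; rewrite pE !inE => /or4P[] /eqP-> //; rewrite ?eqxx ?orbT //; case=> /= k1 k2 k3.
by move: k3 Ka; rewrite (_ : orient d b a = - orient a b d) ?mulrN /orient; [lra | ring].
Qed.

(** The factor is [x] itself: only its sign matters for [triangle]. *)
Lemma same_sign (x y : R) : 0 < x * y -> exists s, 0 < s * x /\ 0 < s * y.
Proof.
move=> xy; exists x; split => //; rewrite -expr2 lt_neqAle sqr_ge0 eq_sym sqrf_eq0 andbT.
by apply: contraTneq xy => ->; rewrite mul0r ltxx.
Qed.

Lemma directions_into_quadrilateral p w : simple_polygon p -> size p = 4%N ->
  generic w p -> (directions_into (region p) p w <= 2)%N.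
Proof.
case: p => [|a [|b [|c [|d [|? ?]]]]] //= sp _ gw; have up := simple_uniq sp.
case: (inner_diagonal sp) => /same_sign[s [Ka Kc]].
  have [a1 b1 d1] := triangle_vertices Ka; have [b2 c2 d2] := triangle_vertices Kc.
  apply: (directions_into_kite up gw _ Ka Kc) => //; apply: (region_kite Ka Kc).
  by apply: boundary4 => t t01; split; [left | right | right | left]; exact: triangle_convex.
have Ka' : 0 < s * orient b c a by rewrite -orient_rot.
have Kc' : 0 < s * orient c d a by rewrite -orient_rot.
have [b1 c1 a1] := triangle_vertices Ka'; have [c2 d2 a2] := triangle_vertices Kc'.
apply: (directions_into_kite up gw _ Ka' Kc').
  by move=> v; rewrite !inE; case: (v == a); rewrite ?orbT ?orbF.
apply: (region_kite Ka' Kc').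
by apply: boundary4 => t t01; split; [left | left | right | right]; exact: triangle_convex.
Qed.

End Quadrilaterals.

(** * Translation invariance of the area *)

Section AreaTranslation.
Import HBNNSimple.
Context {R : realType}.
Local Notation plane := (R * R)%type.
Local Notation mu := (@lebesgue_measure R).

Let shiftR (h : R) : measurableTypeR R -> measurableTypeR R := fun x => x + h.

Lemma measurable_shift h : measurable_fun setT (shiftR h).
Proof. exact: measurable_funD. Qed.

Lemma lebesgue_shift_measurable h (A : set R) : measurable A ->
  pushforward mu (shiftR h) A = mu A.
Proof.
move=> mA; apply/esym/lebesgue_measure_unique => //=; first exact: measurable_shift.
move=> ? _ [[a b]] _ <-.
rewrite /pushforward.
have -> : shiftR h @^-1` `]a, b] = `](a - h), (b - h)]%classic.
  by apply/seteqP; split => x; rewrite /= !in_itv /= ltrBlDr lerBrDr.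
rewrite !lebesgue_measure_itv /= !lte_fin ltrD2r.
by case: ifP => // _; rewrite -!EFinB opprB addrA subrK.
Qed.

(** An arbitrary set is approximated from outside by open sets, which are measurable. Invariance is
    wanted for all sets because nothing is shown about the measurability of a region. *)
Lemma lebesgue_shift_le h (A : set R) : (mu [set x | A (x + h)%R] <= mu A)%E.
Proof.
apply/lee_addgt0Pr => /= e e0.
have [U [oU AU mU]] := @outer_measure_open_le R A e e0.
apply: le_trans mU; rewrite -(@lebesgue_shift_measurable h U); last exact: open_measurable.
by apply: le_lebesgue => x /AU.
Qed.

Lemma lebesgue_shift h (A : set R) : mu [set x | A (x + h)%R] = mu A.
Proof.
apply/le_anti/andP; split; first exact: lebesgue_shift_le.
have := lebesgue_shift_le (- h) [set x | A (x + h)%R].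
by congr (mu _ <= _)%E; apply/seteqP; split => x /=; rewrite subrK.
Qed.

(** The integral is a supremum over simple functions below [f]. These are measurable, so they can be
    shifted, and their shifts lie below the shift of [f]. *)
Lemma le_integral_shift h (f : R -> \bar R) : (forall x, (0 <= f x)%E) ->
  (\int[mu]_x f x <= \int[mu]_x f (x + h)%R)%E.
Proof.
move=> f0; rewrite [leLHS]ge0_integralTE //; apply: ge_ereal_sup => _ [g gf <-].
have <- : (\int[mu]_x (g x)%:E = sintegral mu g)%E.
  by rewrite integral_nnsfun // patch_setT.
have mg : measurable_fun setT (EFin \o g) by exact/measurable_EFinP.
have -> : (\int[mu]_x (g x)%:E = \int[mu]_x (g (x + h)%R)%:E)%E.
  have := @ge0_integral_pushforward _ _ (measurableTypeR R) (measurableTypeR R) R (shiftR h) (measurable_shift h) mu setT (EFin \o g)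
    measurableT mg.
  rewrite preimage_setT => <-; last by move=> x _; rewrite lee_fin.
  apply: eq_measure_integral; first exact: measurable_shift.
  by move=> ? A mA _; exact/esym/lebesgue_shift_measurable.
by apply: ge0_le_integralT => x; [rewrite lee_fin | exact: gf].
Qed.

Lemma integral_shift h (f : R -> \bar R) : (forall x, (0 <= f x)%E) ->
  (\int[mu]_x f (x + h)%R = \int[mu]_x f x)%E.
Proof.
move=> f0; apply/le_anti/andP; split; last exact: le_integral_shift.
have := @le_integral_shift (- h) (fun x => f (x + h)%R) (fun x => f0 _).
by under [leRHS]eq_integral do rewrite subrK.
Qed.

Lemma product_measure_shift (S : set plane) (v : plane) :
  (mu \x mu)%E [set x | S (x + v)%R] = (mu \x mu)%E S.
Proof.
rewrite /product_measure1 -[RHS](integral_shift v.1) //.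
apply: eq_integral => x _ /=; rewrite -[RHS](lebesgue_shift v.2); congr (mu _).
Qed.

End AreaTranslation.

(** * Torus tilings *)

Section Translation.
Context {R : realType}.
Local Notation plane := (R * R)%type.
Implicit Types (u v w x y z d : plane) (p q : seq plane) (s t k : R).

Definition translate v p : seq plane := [seq x + v | x <- p].

Lemma translateK v p : translate (- v) (translate v p) = p.
Proof. by rewrite /translate -map_comp map_id_in // => x _ /=; rewrite addrK. Qed.

Lemma size_translate v p : size (translate v p) = size p.
Proof. exact: size_map. Qed.

Lemma mem_translate v p x : (x \in translate v p) = (x - v \in p).
Proof.
apply/mapP/idP => [[y yp ->]|xp]; first by rewrite addrK.
by exists (x - v); rewrite // subrK.
Qed.

Lemma vertex_translate v p i : (0 < size p)%N ->
  vertex (translate v p) i = vertex p i + v.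
Proof. by move=> p0; rewrite /vertex size_translate (nth_map 0) // ltn_mod. Qed.

Lemma side_point_translate v p i t : (0 < size p)%N ->
  side_point (translate v p) i t = side_point p i t + v.
Proof.
move=> p0; rewrite /side_point !vertex_translate // !scalerDr addrACA -scalerDl.
by rewrite subrK scale1r.
Qed.

Lemma boundary_translate v p x : (0 < size p)%N ->
  boundary (translate v p) x <-> boundary p (x - v).
Proof.
move=> p0; split.
  move=> [i /= ip [t t01 <-]]; rewrite size_translate in ip.
  by exists i => //; exists t; rewrite // side_point_translate // addrK.
move=> [i /= ip [t t01 E]]; exists i; rewrite /= ?size_translate //.
by exists t; rewrite // side_point_translate // E subrK.
Qed.

Lemma inside_translate_sub v p x : (0 < size p)%N ->
  inside p (x - v) -> inside (translate v p) x.
Proof.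
move=> p0 [nb bc]; split; first by move/(boundary_translate _ _ p0).
have /bounded_setP[M hM] := bc.
set C := connected_component _ x.
have shift_sub y : C y -> connected_component (~` boundary p) (x - v) (y - v).
  move=> Cy; have cC : connected ((fun z => z - v) @` C).
    apply: connected_continuous_connected; first exact: component_connected.
    apply: continuous_subspaceT => z; apply: cvgB; [exact: cvg_id | exact: cvg_cst].
  apply: (connected_component_max _ _ cC).
  - exists x => //; apply: connected_component_refl.
    by move/(boundary_translate _ _ p0).
  - move=> _ [z Cz <-] /= bz; apply: (connected_component_sub Cz).
    exact/(boundary_translate _ _ p0).
  - by exists y.
apply/bounded_setP; exists (M + `|v.1| + `|v.2|) => y /shift_sub /hM[/= h1 h2].
have e1 : `|y.1| <= `|y.1 - v.1| + `|v.1| by rewrite -{1}(subrK v.1 y.1) ler_normD.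
have e2 : `|y.2| <= `|y.2 - v.2| + `|v.2| by rewrite -{1}(subrK v.2 y.2) ler_normD.
have := normr_ge0 v.1; have := normr_ge0 v.2; lra.
Qed.

Lemma inside_translate v p x : (0 < size p)%N ->
  inside (translate v p) x <-> inside p (x - v).
Proof.
move=> p0; split; last exact: inside_translate_sub.
move=> ix; rewrite -(translateK v p); apply: inside_translate_sub.
  by rewrite size_translate.
by rewrite opprK subrK.
Qed.

Lemma region_translate v p x : (0 < size p)%N ->
  region (translate v p) x <-> region p (x - v).
Proof.
move=> p0; split => -[h|h].
- by left; apply/inside_translate.
- by right; apply/boundary_translate.
- by left; apply/inside_translate.
- by right; apply/boundary_translate.
Qed.

Lemma area_translate v p : (0 < size p)%N -> area (translate v p) = area p.
Proof.
move=> p0; rewrite /area -[RHS](product_measure_shift _ (- v)); congr (_ _).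
by apply/seteqP; split => x /(region_translate _ _ p0).
Qed.

Lemma perimeter_translate v p : (0 < size p)%N -> perimeter (translate v p) = perimeter p.
Proof.
move=> p0; rewrite /perimeter size_translate; apply: eq_bigr => i _.
rewrite !vertex_translate // /euclidean_dist /=.
by congr (Num.sqrt (_ ^+ 2 + _ ^+ 2)); rewrite opprD addrACA subrr addr0.
Qed.

Lemma simple_polygon_translate v p : simple_polygon p -> simple_polygon (translate v p).
Proof.
move=> [p2 sp]; have p0 : (0 < size p)%N by apply: leq_trans p2.
split; rewrite size_translate // => i j s t ip jp s1 t1.
by rewrite !side_point_translate // => /addIr; exact: sp.
Qed.

Lemma efficient_pentagon_translate v p : efficient_pentagon p ->
  efficient_pentagon (translate v p).
Proof.
move=> [sp p5 ap pp]; have p0 : (0 < size p)%N by rewrite p5.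
split; first exact: simple_polygon_translate.
- by rewrite size_translate.
- by rewrite area_translate.
- by rewrite perimeter_translate.
Qed.

Lemma points_into_translate v p x d : (0 < size p)%N ->
  points_into (region (translate v p)) x d -> points_into (region p) (x - v) d.
Proof.
move=> p0 H r /H[t tr /(region_translate _ _ p0)]; exists t => //.
by rewrite addrAC.
Qed.

(** An endpoint of a segment is an extreme point: if [a] were strictly between [c] and [d], both of
    which lie on the segment from [a] to [b], then they would coincide with [a]. *)
Lemma segment_endpoint (a b c d : plane) :
  (forall x, on_segment a b x <-> on_segment c d x) -> a = c \/ a = d.
Proof.
move=> H.
have at0 x y : (1 - 0) *: x + 0 *: y = x by rewrite subr0 scale1r scale0r addr0.
have at1 x y : (1 - 1) *: x + 1 *: y = y by rewrite subrr scale1r scale0r add0r.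
have ends x y : on_segment x y x /\ on_segment x y y.
  by split; [exists 0; rewrite ?at0 // lexx ler01 | exists 1; rewrite ?at1 // lexx ler01].
have [t /andP[t0 t1] aE] := (H a).1 (ends a b).1.
have [s /andP[s0 s1] cE] := (H c).2 (ends c d).1.
have [s' /andP[s0' s1'] dE] := (H d).2 (ends c d).2.
have [t00|tn0] := eqVneq t 0; first by left; rewrite aE t00 at0.
have [t11|tn1] := eqVneq t 1; first by right; rewrite aE t11 at1.
have tp : 0 < t by rewrite lt_neqAle eq_sym tn0.
have tq : 0 < 1 - t by rewrite subr_gt0 lt_neqAle tn1.
have E : ((1 - t) * s + t * s') *: (b - a) = 0.
  have E' : ((1 - t) * s + t * s') *: (b - a) =
      (1 - t) *: ((1 - s) *: a + s *: b) + t *: ((1 - s') *: a + s' *: b) - a.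
    by apply: pair_eq; rewrite /= /GRing.scale /=; ring.
  by rewrite E' -cE -dE -aE subrr.
move: E => /eqP; rewrite scaler_eq0 paddr_eq0; last 2 first.
- by rewrite mulr_ge0 // ltW.
- by rewrite mulr_ge0 // ltW.
rewrite mulf_eq0 (gt_eqF tq) /= subr_eq0 => /orP[/andP[/eqP s00 _]|/eqP ba].
  by left; rewrite cE s00 at0.
by left; rewrite cE ba -scalerDl subrK scale1r.
Qed.

Lemma on_segment_side p i x : side p i x <-> on_segment (vertex p i) (vertex p i.+1) x.
Proof.
split; first by move=> [t]; rewrite /= in_itv /= => t01 <-; exists t.
by move=> [t t01 ->]; exists t; rewrite //= in_itv.
Qed.

Lemma on_segmentC (a b x : plane) : on_segment a b x -> on_segment b a x.
Proof.
move=> [t /andP[t0 t1] ->]; exists (1 - t); last by rewrite subKr addrC.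
by rewrite subr_ge0 t1 lerBlDr lerDl.
Qed.

Lemma vertex_on_side p i v : simple_polygon p -> (i < size p)%N -> v \in p ->
  side p i v -> v = vertex p i \/ v = vertex p i.+1.
Proof.
move=> sp ip vp [t]; rewrite /= in_itv /= => /andP[t0 t1] E.
have [t11|tn1] := eqVneq t 1.
  by right; rewrite -E /side_point t11 subrr scale0r add0r scale1r.
have jp : (index v p < size p)%N by rewrite index_mem.
have vE : side_point p (index v p) 0 = v.
  by rewrite /side_point subr0 scale1r scale0r addr0 /vertex modn_small // nth_index.
have z1 : 0 <= (0 : R) < 1 by rewrite lexx ltr01.
have tl : 0 <= t < 1 by rewrite t0 lt_neqAle tn1.
have [ji _] := sp.2 _ _ _ _ jp ip z1 tl (etrans vE (esym E)).
by left; rewrite -ji /vertex modn_small // nth_index.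
Qed.

(** If the tiles share a whole side through [v], then [v] is an endpoint of that side for [q], hence
    for [p]. This excludes a vertex in the relative interior of a side of another tile, so the tiles
    at a vertex can be counted by corners. *)
Lemma meet_edge_to_edge_vertex p q v : simple_polygon p -> simple_polygon q ->
  meet_edge_to_edge p q -> region p v -> v \in q -> v \in p.
Proof.
move=> sp sq pq pv vq.
have q0 : (0 < size q)%N by apply: leq_trans sq.1.
have p0 : (0 < size p)%N by apply: leq_trans sp.1.
have qv : region q v.
  right; exists (index v q); first by rewrite /= index_mem.
  exists 0; first by rewrite /= in_itv /= lexx ler01.
  by rewrite /side_point subr0 scale1r scale0r addr0 /vertex modn_small ?index_mem // nth_index.
have [[]//|[i [j [ip jq E iv]]]] := pq v pv qv.
have S x : on_segment (vertex q j) (vertex q j.+1) x <->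
    on_segment (vertex p i) (vertex p i.+1) x.
  by split => /on_segment_side h; apply/on_segment_side; [rewrite E | rewrite -E].
have vert : v = vertex p i \/ v = vertex p i.+1.
  have jv : side q j v by rewrite -E.
  case: (vertex_on_side sq jq vq jv) => ->; first exact: segment_endpoint S.
  by apply: segment_endpoint => x; split => [/on_segmentC/S|/S/on_segmentC].
by case: vert => ->; exact: mem_vertex.
Qed.

End Translation.

(** * The lattice *)

Section Tilings.
Context {R : realType} {I : finType}.
Local Notation plane := (R * R)%type.
Variables (b1 b2 : plane) (P : I -> seq plane).
Local Notation K := (I * (int * int))%type.
Local Notation lattice := (lattice_vector b1 b2).
Local Notation tile := (tile b1 b2 P).
Implicit Types (k l : K) (m : int * int) (u v w x y d : plane).

Lemma latticeB m m' : lattice m - lattice m' = lattice (m.1 - m'.1, m.2 - m'.2).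
Proof. by rewrite /lattice_vector /= !mulrzBr opprD addrACA. Qed.

Lemma latticeD m m' : lattice m + lattice m' = lattice (m.1 + m'.1, m.2 + m'.2).
Proof. by rewrite /lattice_vector /= !mulrzDr addrACA. Qed.

Lemma pair_mulrz u (n : int) : u *~ n = (n%:~R * u.1, n%:~R * u.2).
Proof. by apply: pair_eq; rewrite /= mulrzl; [exact: (raddfMz fst) | exact: (raddfMz snd)]. Qed.

Lemma lattice_cross1 m : cross (lattice m) b2 = m.1%:~R * (b1.1 * b2.2 - b1.2 * b2.1).
Proof.
by rewrite /cross /lattice_vector /= !pair_mulrz /=; ring.
Qed.

Lemma lattice_cross2 m : cross b1 (lattice m) = m.2%:~R * (b1.1 * b2.2 - b1.2 * b2.1).
Proof.
by rewrite /cross /lattice_vector /= !pair_mulrz /=; ring.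
Qed.

Hypothesis basis : lattice_basis b1 b2.

Lemma lattice_inj : injective lattice.
Proof.
move=> [m1 m2] [n1 n2] E; congr pair.
  have := lattice_cross1 (m1, m2); rewrite E lattice_cross1 /=.
  by move=> /(mulIf basis)/eqP; rewrite eqr_int => /eqP.
have := lattice_cross2 (m1, m2); rewrite E lattice_cross2 /=.
by move=> /(mulIf basis)/eqP; rewrite eqr_int => /eqP.
Qed.

Lemma int_range (N : nat) : exists r : seq int, forall n : int, `|n%:~R| <= (N%:R : R) -> n \in r.
Proof.
exists [seq n%:Z - N%:Z | n <- iota 0 (N + N).+1] => n.
rewrite -intr_norm -[N%:R]/(N%:~R) ler_int => nN.
have n0 : 0 <= n + N%:Z by move: nN; rewrite ler_norml => /andP[]; lra.
apply/mapP; exists (absz (n + N%:Z)); last by rewrite gez0_abs // addrK.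
rewrite mem_iota /= add0n ltnS -lez_nat gez0_abs // PoszD lerD2r.
by move: nN; rewrite ler_norml => /andP[].
Qed.

(** By Cramer's rule the two integer coordinates are [cross] products with a basis vector divided by
    the determinant, hence bounded by [B]. *)
Lemma lattice_finite (M : R) : exists r : seq (int * int),
  forall m, `|(lattice m).1| <= M -> `|(lattice m).2| <= M -> m \in r.
Proof.
pose D := b1.1 * b2.2 - b1.2 * b2.1.
have D0 : 0 < `|D| by rewrite normr_gt0.
pose B := `|M| * (`|b1.1| + `|b1.2| + `|b2.1| + `|b2.2|) / `|D|.
have B0 : 0 <= B by rewrite divr_ge0 // mulr_ge0 // !addr_ge0.
have [r hr] := int_range (Num.bound B).
exists [seq (i, j) | i <- r, j <- r] => m h1 h2.
have h1' : `|(lattice m).1| <= `|M| by apply: le_trans h1 (ler_norm _).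
have h2' : `|(lattice m).2| <= `|M| by apply: le_trans h2 (ler_norm _).
have prod (x y z t : R) : `|x| <= `|M| -> `|y| <= `|M| -> `|x * z - y * t| <= `|M| * (`|z| + `|t|).
  move=> hx hy; apply: le_trans (ler_normB _ _) _.
  by rewrite !normrM mulrDr lerD // ler_wpM2r.
have n0 := normr_ge0 M.
have p1 := mulr_ge0 n0 (normr_ge0 b1.1); have p2 := mulr_ge0 n0 (normr_ge0 b1.2).
have p3 := mulr_ge0 n0 (normr_ge0 b2.1); have p4 := mulr_ge0 n0 (normr_ge0 b2.2).
apply/allpairsP; exists m; split; last by case: (m).
  apply: hr; apply: le_trans (ltW (archi_boundP B0)); rewrite ler_pdivlMr //.
  rewrite -normrM -lattice_cross1 /cross.
  by apply: le_trans (prod _ _ _ _ h1' h2') _; lra.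
apply: hr; apply: le_trans (ltW (archi_boundP B0)); rewrite ler_pdivlMr //.
rewrite -normrM -lattice_cross2 /cross mulrC [b1.2 * _]mulrC.
by apply: le_trans (prod _ _ _ _ h2' h1') _; lra.
Qed.

End Tilings.

(** * Tiles around a vertex *)

Section TorusTilings.
Context {R : realType} {I : finType}.
Local Notation plane := (R * R)%type.
Variables (b1 b2 : plane) (P : I -> seq plane).
Local Notation K := (I * (int * int))%type.
Local Notation lattice := (lattice_vector b1 b2).
Local Notation tile := (tile b1 b2 P).
Hypothesis tilingP : edge_to_edge_torus_tiling b1 b2 P.
Implicit Types (k l : K) (m : int * int) (u v w x y d : plane).

Lemma tile_size_gt0 i : (0 < size (P i))%N.
Proof. by case: tilingP => _ /(_ i)[/(leq_trans _)-> //]. Qed.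

Lemma tileE k : tile k = translate (lattice k.2) (P k.1).
Proof. by []. Qed.

Lemma simple_tile k : simple_polygon (tile k).
Proof. by case: tilingP => _ sp _ _ _; apply: simple_polygon_translate. Qed.

Lemma region_tile k x : region (tile k) x <-> region (P k.1) (x - lattice k.2).
Proof. exact/region_translate/tile_size_gt0. Qed.

Lemma tile_vertex k l v : v \in tile l -> region (tile k) v -> v \in tile k.
Proof.
case: tilingP => _ _ _ _ ee vl kv; have [->//|kl] := eqVneq k l.
exact: (meet_edge_to_edge_vertex (simple_tile k) (simple_tile l) (ee _ _ kl) kv vl).
Qed.

Lemma vertex_region p v : v \in p -> region p v.
Proof.
move=> vp; right; exists (index v p); first by rewrite /= index_mem.
exists 0; first by rewrite /= in_itv /= lexx ler01.
by rewrite /side_point subr0 scale1r scale0r addr0 /vertex modn_small ?index_mem // nth_index.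
Qed.

Lemma regions_bounded : exists M, forall i x, region (P i) x -> `|x.1| <= M /\ `|x.2| <= M.
Proof.
have H i : exists M, forall x, region (P i) x -> `|x.1| <= M /\ `|x.2| <= M.
  have /bounded_setP[M hM] := hull_bounded (P i).
  by exists M => x /(region_hull (tile_size_gt0 i))/hM.
have [f hf] := choice H.
exists (\sum_i `|f i|) => i x /hf[h1 h2].
have fi : f i <= \sum_i `|f i|.
  by rewrite (bigD1 i) //=; apply: le_trans (ler_norm _) _; rewrite lerDl sumr_ge0.
by split; [exact: le_trans h1 fi | exact: le_trans h2 fi].
Qed.

Lemma tiles_near_finite v : exists r : seq K, forall k x,
  `|x.1 - v.1| <= 1 -> `|x.2 - v.2| <= 1 -> region (tile k) x -> k \in r.
Proof.
have [M hM] := regions_bounded; case: tilingP => basis _ _ _ _.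
have [r hr] := lattice_finite basis (M + 1 + `|v.1| + `|v.2|).
exists [seq (i, m) | i <- enum I, m <- r] => -[i m] x x1 x2 /region_tile/hM[/= h1 h2].
have v1 := normr_ge0 v.1; have v2 := normr_ge0 v.2.
have tri (a b c : R) : `|a - c| <= 1 -> `|a - b| <= M -> `|b| <= M + 1 + `|c|.
  move=> h h'; have -> : b = (b - a) + ((a - c) + c) by ring.
  apply: le_trans (ler_normD _ _) _; rewrite distrC.
  by have := ler_normD (a - c) c; lra.
apply/allpairsP; exists (i, m); split; rewrite ?mem_enum //.
apply: hr; first by have := tri _ _ _ x1 h1; lra.
by have := tri _ _ _ x2 h2; lra.
Qed.

(** Only finitely many tiles come near [v]. Were none entered along [d], a common [r] would serve
    for all of them, and the points of the ray closer than [r] and within the unit box around [v]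
    would be uncovered. *)
Lemma tile_into v d : exists k, points_into (region (tile k)) v d.
Proof.
apply: contrapT => no.
have {}no k : exists2 r, 0 < r & forall t, 0 < t < r -> ~ region (tile k) (v + t *: d).
  apply: contrapT => nk; apply: no; exists k => r r0; apply: contrapT => nr.
  by apply: nk; exists r => // t tr Rt; apply: nr; exists t.
have [rs hrs] := tiles_near_finite v.
have [r r0 hr] : exists2 r, 0 < r & forall k, k \in rs -> forall t, 0 < t < r ->
    ~ region (tile k) (v + t *: d).
  elim: rs {hrs} => [|k rs [r r0 hr]]; first by exists 1.
  have [r' r0' hr'] := no k; exists (Num.min r r'); first by rewrite lt_min r0.
  move=> l; rewrite inE => /predU1P[->|/hr hl] t /andP[t0]; rewrite lt_min => /andP[tr tr'].
    by apply: hr'; rewrite t0.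
  by apply: hl; rewrite t0.
pose B := `|d.1| + `|d.2| + 1.
have d1 := normr_ge0 d.1; have d2 := normr_ge0 d.2.
have B0 : 0 < B by rewrite /B; lra.
pose t := Num.min (r / 2) B^-1.
have t0 : 0 < t by rewrite lt_min divr_gt0 // invr_gt0.
have tr : t < r by apply: (@le_lt_trans _ _ (r / 2)); [rewrite ge_min lexx | lra].
have tB : t * B <= 1 by rewrite -ler_pdivlMr // mul1r ge_min lexx orbT.
have small (x : R) : `|x| <= B -> `|t * x| <= 1.
  move=> xB; rewrite normrM gtr0_norm //; apply: le_trans tB.
  by rewrite ler_pM2l.
case: tilingP => _ _ cover _ _.
have [k _ kt] : (\bigcup_k region (tile k)) (v + t *: d) by rewrite cover.
apply: (hr k _ t _ kt); last by rewrite t0.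
apply: (hrs _ _ _ _ kt); rewrite /= /GRing.scale /= addrC addKr; apply: small; rewrite /B; lra.
Qed.

Lemma vertex_tile_into v d : tiling_vertex b1 b2 P v ->
  exists k, v \in tile k /\ points_into (region (tile k)) v d.
Proof.
move=> [l vl]; have [k kd] := tile_into v d; exists k; split => //.
exact: tile_vertex vl (region_closed_along kd).
Qed.

Lemma no_five_efficient v (k : 'I_5 -> K) : injective k ->
  (forall j, v \in tile (k j)) -> (forall j, efficient_pentagon (P (k j).1)) -> False.
Proof.
move=> kinj vk ek.
have sec j : exists uw : plane * plane, sector_inside (inside (tile (k j))) v uw.1 uw.2.
  have [u [w h]] := efficient_corner (efficient_pentagon_translate _ (ek j)) (vk j).
  by exists (u, w).
have [uw huw] := choice sec.
(* Unlike in [points_into], all small [t] are required, so that two tiles entered in a common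
   direction share an interior point. *)
pose S j : set plane :=
  [set y | exists2 r, 0 < r & forall t, 0 < t < r -> inside (tile (k j)) (v + t *: y)].
apply: (@no_five_sectors _ S (fst \o uw) (snd \o uw)) => [i j y [r r0 hr] [r' r0' hr']|j]; last first.
  by have [h1 h2 h3] := huw j.
apply: contrapT => ij.
have kij : k i != k j by apply/eqP => /kinj.
case: tilingP => _ _ _ /(_ _ _ kij) disj _.
pose t := Num.min r r' / 2.
have t0 : 0 < t by rewrite divr_gt0 // lt_min r0.
have tlt : t < Num.min r r'.
  have : 0 < Num.min r r' by rewrite lt_min r0.
  by rewrite /t; lra.
move: tlt; rewrite lt_min => /andP[tr tr'].
have : (inside (tile (k i)) `&` inside (tile (k j))) (v + t *: y).
  by split; [apply: hr | apply: hr']; rewrite t0.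
by rewrite disj.
Qed.

End TorusTilings.

(** * Generic directions and sums over classes *)

Lemma exists_generic {R : realType} (p : seq (R * R)) : exists d, generic d p.
Proof.
have avoid (r : seq R) : exists t, forall x, x \in r -> x < t.
  elim: r => [|y r [t ht]]; first by exists 0.
  exists (Num.max t (y + 1)) => x; rewrite inE lt_max => /predU1P[->|/ht->//].
  by rewrite ltrDl ltr01 orbT.
(* The direction is [(1, t)] with [t] above all slopes; vertical pairs, for which the quotient is
   meaningless, are treated apart. *)
have [t ht] := avoid [seq (v.2 - u.2) / (v.1 - u.1) | u <- p, v <- p].
exists (1, t) => u v up vp uv; rewrite /cross /= mul1r subr_eq0.
have [e1|n1] := eqVneq (v.1 - u.1) 0.
  rewrite e1 mulr0 subr_eq0; apply: contra uv => /eqP e2; apply/eqP.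
  by apply: pair_eq => //; apply/eqP; rewrite eq_sym -subr_eq0 e1.
have : (v.2 - u.2) / (v.1 - u.1) < t by apply: ht; apply/allpairsP; exists (u, v).
by apply: contraTneq => ->; rewrite mulfK // ltxx.
Qed.

(** The vertices of the torus are the classes of corners modulo the lattice. Comparing sums class by
    class avoids forming the quotient and counting the vertices. *)
Lemma leq_sum_classes (T : finType) (A : pred T) (e : rel T) (F G : T -> nat) :
  {in A, forall x, e x x} ->
  {in A & A, forall x y, e x y -> e x =1 e y} ->
  {in A, forall x, (\sum_(y | A y && e x y) F y <= \sum_(y | A y && e x y) G y)%N} ->
  (\sum_(x | A x) F x <= \sum_(x | A x) G x)%N.
Proof.
move=> refl trans H.
pose rep x := odflt x [pick y | A y && e x y].
have repP x : A x -> A (rep x) && e x (rep x).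
  by move=> Ax; rewrite /rep; case: pickP => [y|/(_ x)] //=; rewrite Ax refl.
have repE x y : A x -> A y -> (rep y == rep x) = e x y.
  move=> Ax Ay; apply/eqP/idP => [E|exy].
    have /andP[Ar exr] := repP x Ax; have /andP[_ eyr] := repP y Ay.
    by rewrite (trans _ _ Ax Ar exr) -E -(trans _ _ Ay _ eyr) ?refl // E.
  rewrite /rep; have -> : [pick z | A z && e y z] = [pick z | A z && e x z].
    by apply: eq_pick => z /=; rewrite (trans _ _ Ax Ay exy).
  by case: pickP => //= /(_ y); rewrite Ay exy.
rewrite (partition_big rep A) /=; last by move=> x /repP/andP[].
rewrite [leqRHS](partition_big rep A) /=; last by move=> x /repP/andP[].
apply: leq_sum => r Ar; have [x /andP[Ax /eqP xr]|none] := pickP [pred x | A x && (rep x == r)].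
  have E (W : T -> nat) : (\sum_(y | A y && (rep y == r)) W y = \sum_(y | A y && e x y) W y)%N.
    by apply: eq_bigl => y; case Ay : (A y); rewrite //= -xr repE.
  by rewrite !E; exact: H.
by rewrite !big_pred0.
Qed.

(** * The count of corners on the torus *)

Section Counting.
Context {R : realType} {I : finType}.
Local Notation plane := (R * R)%type.
Variables (b1 b2 : plane) (P : I -> seq plane).
Local Notation K := (I * (int * int))%type.
Local Notation lattice := (lattice_vector b1 b2).
Local Notation tile := (tile b1 b2 P).
Hypothesis tilingP : edge_to_edge_torus_tiling b1 b2 P.
Hypothesis tilesP : forall i, efficient_pentagon (P i) \/ unit_nonconvex_quadrilateral (P i).

Local Notation corner := (I * 'I_5)%type.
Implicit Types (c : corner) (k : K) (i : I).

(** Corners of all tiles are indexed in one finite type; the index 4 is spurious for a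
    quadrilateral. *)
Definition is_corner c := (c.2 < size (P c.1))%N.
Definition corner_point c := vertex (P c.1) c.2.
Definition same_vertex c c' := `[< exists m, corner_point c' + lattice m = corner_point c >].
Definition pentagonal i := size (P i) == 5%N.

Lemma pentagonalP i : pentagonal i -> efficient_pentagon (P i).
Proof. by case: (tilesP i) => // -[_ s4 _ _] /eqP; rewrite s4. Qed.

Lemma quadrangularP i : ~~ pentagonal i -> unit_nonconvex_quadrilateral (P i).
Proof. by case: (tilesP i) => // -[_ s5 _ _] /eqP; rewrite s5. Qed.

Lemma size_tile i : size (P i) = (if pentagonal i then 5 else 4)%N.
Proof.
have [/pentagonalP[_ -> _ _] //|/quadrangularP[_ -> _ _] //] := boolP (pentagonal i).
Qed.

Lemma same_vertex_refl c : same_vertex c c.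
Proof. by apply/asboolP; exists (0, 0); rewrite /lattice_vector /= !mulr0z !addr0. Qed.

Lemma same_vertex_eq c c' : same_vertex c c' -> same_vertex c =1 same_vertex c'.
Proof.
move=> /asboolP[m mE] c''; apply/asboolP/asboolP => -[m' m'E].
  exists (m'.1 - m.1, m'.2 - m.2).
  by rewrite -latticeB addrA m'E -mE addrK.
exists (m'.1 + m.1, m'.2 + m.2).
by rewrite -latticeD addrA m'E mE.
Qed.

Lemma corner_point_inj c c' : is_corner c -> is_corner c' -> c.1 = c'.1 ->
  corner_point c = corner_point c' -> c = c'.
Proof.
case: c c' => [i j] [i' j']; rewrite /is_corner /corner_point /= => jp jp' E.
subst i'; rewrite /vertex !modn_small // => /eqP.
rewrite nth_uniq //; first by move=> /eqP/ord_inj ->.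
by apply: simple_uniq; case: tilingP.
Qed.

Lemma corner_of_tile k v : v \in tile k ->
  exists c, [/\ is_corner c, c.1 = k.1 & corner_point c + lattice k.2 = v].
Proof.
rewrite tileE mem_translate; set x := v - _ => vk.
have ip : (index x (P k.1) < size (P k.1))%N by rewrite index_mem.
have i5 : (index x (P k.1) < 5)%N.
  by apply: leq_trans ip _; rewrite size_tile; case: ifP.
exists (k.1, Ordinal i5); split => //.
by rewrite /corner_point /vertex modn_small //= nth_index // subrK.
Qed.

Lemma corner_in_tile c k : is_corner c -> k.1 = c.1 ->
  corner_point c \in P k.1.
Proof. by move=> cc ->; apply: mem_vertex; exact: leq_trans cc. Qed.

(** The inequality fails only if there are at least five pentagonal corners, which
    [no_five_efficient] excludes, or exactly four and no quadrangular one, when the vertex is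
    efficient of degree four. *)
Lemma few_pentagons c0 :
  ~ (exists v, efficient_vertex b1 b2 P v /\ vertex_degree b1 b2 P v 4) -> is_corner c0 ->
  (#|[set c | [&& is_corner c, same_vertex c0 c & pentagonal c.1]]%SET| <=
   3 + #|[set c | [&& is_corner c, same_vertex c0 c & ~~ pentagonal c.1]]%SET|)%N.
Proof.
move=> no4 c0c; set Xp := finset _; set Xq := (finset _ in leqRHS); set v := corner_point c0.
rewrite leqNgt; apply/negP => big.
(* [kap c] is the lift of the tile of [c] that has this very corner at [v]. Several corners of one
   tile at the same vertex of the torus give different lifts. Outside the class the value is
   arbitrary. *)
have /choice[kap hkap] : forall c, exists k : K, is_corner c -> same_vertex c0 c ->
    k.1 = c.1 /\ corner_point c + lattice k.2 = v.
  move=> c; have [/asboolP[m mE]|n] := boolP (same_vertex c0 c).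
    by exists (c.1, m).
  by exists (c.1, (0, 0)) => _.
have vkap c : is_corner c -> same_vertex c0 c -> v \in tile (kap c).
  move=> cc ec; have [k1 k2] := hkap c cc ec.
  by rewrite tileE mem_translate -k2 addrK corner_in_tile.
have kapI c c' : is_corner c -> is_corner c' -> same_vertex c0 c -> same_vertex c0 c' ->
    kap c = kap c' -> c = c'.
  move=> cc cc' ec ec' E; have [k1 k2] := hkap c cc ec; have [k1' k2'] := hkap c' cc' ec'.
  apply: corner_point_inj => //; first by rewrite -k1 -k1' E.
  by apply: (addIr (lattice (kap c).2)); rewrite k2 E k2'.
have XpP c : c \in Xp -> [/\ is_corner c, same_vertex c0 c & pentagonal c.1].
  by rewrite inE => /and3P.
have [p5|p4] := leqP 5 #|Xp|.
  pose f (j : 'I_5) := enum_val (widen_ord p5 j).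
  have fX j : f j \in Xp by apply: enum_valP.
  apply: (@no_five_efficient _ _ _ _ _ tilingP v (kap \o f)).
  - move=> j j' /= E; have [h1 h2 _] := XpP _ (fX j); have [h1' h2' _] := XpP _ (fX j').
    by have /enum_val_inj/(congr1 val)/= := kapI _ _ h1 h1' h2 h2' E; exact: ord_inj.
  - by move=> j; have [h1 h2 _] := XpP _ (fX j); exact: vkap.
  - move=> j /=; have [h1 h2 h3] := XpP _ (fX j); have [-> _] := hkap _ h1 h2.
    exact: pentagonalP.
have Xq0 : #|Xq| = 0%N by apply/eqP; rewrite -leqn0; move: big p4; lia.
have Xp4 : #|Xp| = 4%N by move: big p4; rewrite Xq0; lia.
have inXp c : is_corner c -> same_vertex c0 c -> c \in Xp.
  move=> cc ec; rewrite inE cc ec /=; apply/negPn/negP => np.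
  have : c \in Xq by rewrite inE cc ec np.
  by rewrite (cards0_eq Xq0) inE.
have vtile : tiling_vertex b1 b2 P v.
  by exists (kap c0); apply: vkap => //; exact: same_vertex_refl.
(* A lifted tile whose region contains [v] has [v] as a corner, since the tiling is edge-to-edge, so
   the degree is the number of corners in the class. *)
have atv k : tiles_at b1 b2 P v k -> exists c, c \in Xp /\ k = kap c.
  move=> kv; have [l vl] := vtile; have vk := tile_vertex tilingP vl kv.
  have [c [cc c1 cE]] := corner_of_tile vk.
  have ec : same_vertex c0 c by apply/asboolP; exists k.2.
  exists c; split; first exact: inXp.
  have [k1 k2] := hkap c cc ec.
  rewrite [k]surjective_pairing [kap c]surjective_pairing k1 c1; congr pair.
  case: tilingP => basis _ _ _ _; apply: (lattice_inj basis).
  by apply: (addrI (corner_point c)); rewrite k2.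
apply: no4; exists v; split; first split => // k /atv[c [/XpP[cc ec pc] ->]].
  have [k1 _] := hkap c cc ec; apply: efficient_pentagon_translate.
  by rewrite k1; apply: pentagonalP.
have p4' : (4 <= #|Xp|)%N by rewrite Xp4.
pose f (j : 'I_4) := kap (enum_val (widen_ord p4' j)).
have fX (j : 'I_4) : enum_val (widen_ord p4' j) \in Xp by apply: enum_valP.
rewrite /vertex_degree; have -> : tiles_at b1 b2 P v = f @` setT.
  apply/seteqP; split => [k /atv[c [cX ->]]|_ [j _ <-]].
    have r4 : (enum_rank_in cX c < 4)%N by rewrite -[X in (_ < X)%N]Xp4 ltn_ord.
    exists (Ordinal r4) => //; rewrite /f; congr kap.
    rewrite -[RHS](enum_rankK_in cX cX); congr enum_val; exact: val_inj.
  have [h1 h2 _] := XpP _ (fX j).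
  by apply/vertex_region/vkap.
have finj : {in [set: 'I_4] &, injective f}.
  move=> j j' _ _ E; have [h1 h2 _] := XpP _ (fX j); have [h1' h2' _] := XpP _ (fX j').
  by have /enum_val_inj/(congr1 val)/= := kapI _ _ h1 h1' h2 h2' E; exact: ord_inj.
rewrite (card_eql (inj_card_eq finj)).
by rewrite card_eq_sym; exact: card_II.
Qed.

Definition corner_directions d c : nat :=
  `[< points_into (region (P c.1)) (corner_point c) d >] +
  `[< points_into (region (P c.1)) (corner_point c) (- d) >].

Lemma class_directions d c0 : is_corner c0 ->
  (2 <= \sum_(c | is_corner c && same_vertex c0 c) corner_directions d c)%N.
Proof.
move=> cc0.
have into y : (1 <= \sum_(c | is_corner c && same_vertex c0 c)
    `[< points_into (region (P c.1)) (corner_point c) y >])%N.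
  have v0 : tiling_vertex b1 b2 P (corner_point c0).
    exists (c0.1, (0, 0)); rewrite tileE mem_translate /lattice_vector /= !mulr0z addr0 subr0.
    exact: mem_vertex (tile_size_gt0 tilingP _).
  have [k [vk vy]] := vertex_tile_into tilingP y v0.
  have [c [cc c1 cE]] := corner_of_tile vk.
  rewrite (bigD1 c) /=; last by rewrite cc; apply/asboolP; exists k.2.
  rewrite asboolT // c1.
  have -> : corner_point c = corner_point c0 - lattice k.2 by rewrite -cE addrK.
  exact: points_into_translate (tile_size_gt0 tilingP _) vy.
by rewrite big_split /= (leq_add (into d) (into (- d))).
Qed.

Lemma sum_corners (F : I -> nat -> nat) :
  (\sum_(c | is_corner c) F c.1 c.2 = \sum_i \sum_(j < size (P i)) F i j)%N.
Proof.
have -> : (\sum_(c | is_corner c) F c.1 c.2 =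
    \sum_i \sum_(j < 5 | (j < size (P i))%N) F i j)%N by rewrite pair_big_dep.
apply: eq_bigr => i _; rewrite -(big_ord_widen 5 (F i)) //.
by rewrite size_tile; case: ifP.
Qed.

Lemma sum_directions d i : (\sum_(j < size (P i))
    (`[< points_into (region (P i)) (vertex (P i) j) d >] +
     `[< points_into (region (P i)) (vertex (P i) j) (- d) >]) =
  directions_into (region (P i)) (P i) d)%N.
Proof.
rewrite /directions_into (big_nth 0) big_mkord; apply: eq_bigr => j _.
by rewrite /vertex modn_small.
Qed.

Lemma pentagon_ratio :
  ~ (exists v, efficient_vertex b1 b2 P v /\ vertex_degree b1 b2 P v 4) ->
  (#|[set i | pentagonal i]%SET| <= 14 * #|[set i | ~~ pentagonal i]%SET|)%N.
Proof.
move=> no4; set n5 := #|_|; set n4 := #|_|.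
have [d gd] := exists_generic (flatten [seq P i | i <- enum I]).
have gP i : generic d (P i).
  by move=> u v up vp; apply: gd; apply/flatten_mapP; exists i; rewrite ?mem_enum.
have dl (n : nat) (Q : pred corner) (W : corner -> nat) :
    (\sum_(c | Q c) n * W c = n * \sum_(c | Q c) W c)%N by rewrite big_distrr.
have ds (Q : pred corner) (W V : corner -> nat) :
    (\sum_(c | Q c) (W c + V c) = \sum_(c | Q c) W c + \sum_(c | Q c) V c)%N by rewrite big_split.
(* Twice the inequality p <= 3 + q, with the resulting 6 replaced by three times the number of
   entering directions, which is at least 2 at each vertex. *)
have per_class : (\sum_(c | is_corner c) 2 * pentagonal c.1 <=
    \sum_(c | is_corner c) (3 * corner_directions d c + 2 * ~~ pentagonal c.1))%N.
  apply: (@leq_sum_classes _ is_corner same_vertex) => [c _|c c' _ _|c0 cc0].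
  - exact: same_vertex_refl.
  - exact: same_vertex_eq.
  have few := few_pentagons no4 cc0; have dirs := class_directions d cc0.
  have card (Q : pred I) : (\sum_(c | is_corner c && same_vertex c0 c) Q c.1 =
      #|[set c | [&& is_corner c, same_vertex c0 c & Q c.1]]%SET|)%N.
    rewrite -sum1dep_card -big_mkcondr; apply: eq_bigl => c; first by rewrite andbA.
  cbv beta; rewrite dl ds !dl (card pentagonal) (card (fun i => ~~ pentagonal i)); move: few dirs; lia.
have S5 : (\sum_(c | is_corner c) 2 * pentagonal c.1 = 10 * n5)%N.
  rewrite (sum_corners (fun i _ => 2 * pentagonal i)%N).
  rewrite /n5 -sum1dep_card big_distrr /= [RHS]big_mkcond; apply: eq_bigr => i _.
  by rewrite sum_nat_const card_ord size_tile; case: pentagonal.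
have S4 : (\sum_(c | is_corner c) 2 * ~~ pentagonal c.1 = 8 * n4)%N.
  rewrite (sum_corners (fun i _ => 2 * ~~ pentagonal i)%N).
  rewrite /n4 -sum1dep_card big_distrr /= [RHS]big_mkcond; apply: eq_bigr => i _.
  by rewrite sum_nat_const card_ord size_tile; case: pentagonal.
have SD : (\sum_(c | is_corner c) corner_directions d c <= 3 * n5 + 2 * n4)%N.
  rewrite (sum_corners (fun i j => `[< points_into (region (P i)) (vertex (P i) j) d >] +
     `[< points_into (region (P i)) (vertex (P i) j) (- d) >])%N).
  rewrite /n5 /n4 -!sum1dep_card !big_distrr /= [X in (_ <= X + _)%N]big_mkcond
    [X in (_ <= _ + X)%N]big_mkcond -big_split /=.
  apply: leq_sum => i _; rewrite sum_directions.
  have [pi|qi] := boolP (pentagonal i).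
    by rewrite addn0; exact: directions_into_pentagon (pentagonalP pi) (gP i).
  have [si s4 _ _] := quadrangularP qi.
  exact: directions_into_quadrilateral si s4 (gP i).
(* The sums give 10 n5 <= 3 (3 n5 + 2 n4) + 8 n4. *)
by move: per_class; rewrite S5 ds S4 dl; move: SD; lia.
Qed.

End Counting.

Theorem proposition3p5 (R : realType) (I : finType) (b1 b2 : R * R)
    (P : I -> seq (R * R))
    (tilingP : edge_to_edge_torus_tiling b1 b2 P)
    (tilesP : forall i, efficient_pentagon (P i) \/
                        unit_nonconvex_quadrilateral (P i))
    (ratioP : (14 * #|[set i | `[< unit_nonconvex_quadrilateral (P i) >]]%SET|
               < #|[set i | `[< efficient_pentagon (P i) >]]%SET|)%N) :
  exists v : R * R, efficient_vertex b1 b2 P v /\ vertex_degree b1 b2 P v 4.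
Proof.
apply: contrapT => no4; move: ratioP; rewrite ltnNge => /negP; apply.
have -> : [set i | `[< efficient_pentagon (P i) >]]%SET = [set i | pentagonal P i]%SET.
  apply/setP => i; rewrite !inE; apply/asboolP/idP => [[_ s5 _ _]|].
    by rewrite /pentagonal s5.
  exact: (pentagonalP tilesP).
have -> : [set i | `[< unit_nonconvex_quadrilateral (P i) >]]%SET = [set i | ~~ pentagonal P i]%SET.
  apply/setP => i; rewrite !inE; apply/asboolP/idP => [[_ s4 _ _]|].
    by rewrite /pentagonal s4.
  exact: (quadrangularP tilesP).
exact: (pentagon_ratio tilingP tilesP no4).
Qed.
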